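(* Let $b\ge3$ be an integer and let $a_1\not\equiv a_2\pmod b$ be two residue classes modulo $b$. Put $\zeta_b:=e^{2\pi i/b}$ and $\lambda_1+i\lambda_2:=\mathrm{Li}_3(\zeta_b)^{\frac13}$ with $\lambda_1,\lambda_2$ real, and define $B_{a_1,a_2,b}>0$ and $\alpha_{a_1,a_2,b}\in[0,2\pi)$ by $$B_{a_1,a_2,b}\,e^{i\alpha_{a_1,a_2,b}}=\frac{2^{\frac23}}{b\sqrt{3\pi}}\left(\zeta_b^{-a_1}-\zeta_b^{-a_2}\right)\left(1-\zeta_b\right)^{\frac1{12}}(\lambda_1+i\lambda_2)^{\frac12}.$$ Then, as $n\to\infty$, $$\frac{pp(a_1,b,n)-pp(a_2,b,n)}{B_{a_1,a_2,b}\,n^{-\frac23}\exp\left(\frac{3}{2^{\frac23}}\lambda_1n^{\frac23}\right)}=\cos\left(\alpha_{a_1,a_2,b}+\frac{3}{2^{\frac23}}\lambda_2n^{\frac23}\right)+o(1).$$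
   Context: A plane partition of $n$ is an array $\pi=\{\pi_{j,k}\}_{j,k\ge1}$ of non-negative integers, non-increasing in both indices, with $\sum_{j,k}\pi_{j,k}=n$. Its trace is $t(\pi)=\sum_{j\ge1}\pi_{j,j}$. $pp(a,b,n)$ denotes the number of plane partitions of $n$ with trace congruent to $a$ modulo $b$. The trilogarithm is $\mathrm{Li}_3(z)=\sum_{n\ge1}\frac{z^n}{n^3}$ for $|z|\le1$. All fractional powers of complex numbers are principal branches. *)

(* Defs.v *)
From HB Require Import structures.
From mathcomp Require Import all_boot all_order all_algebra.
From mathcomp Require Import all_classical all_reals all_analysis.
From mathcomp Require Import finmap complex.

Set Implicit Arguments.
Unset Strict Implicit.
Unset Printing Implicit Defensive.

Import Order.TTheory GRing.Theory Num.Theory.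
Import numFieldNormedType.Exports.

Local Open Scope classical_set_scope.
Local Open Scope ring_scope.
Local Open Scope complex_scope.

(* The rows and columns of the infinite array are numbered from 0.  Finiteness
   of the support has to be required: a finitely supported sum [\big_(x \in A)]
   over an infinite support is 0 by convention. *)
Definition is_plane_partition (n : nat) (p : nat -> nat -> nat) : Prop :=
  [/\ forall j k, (p j.+1 k <= p j k)%N,
      forall j k, (p j k.+1 <= p j k)%N,
      finite_set [set jk : nat * nat | p jk.1 jk.2 != 0%N] &
      \big[addn/0%N]_(jk \in [set: nat * nat]) p jk.1 jk.2 = n].

Definition pp_trace (p : nat -> nat -> nat) : nat :=
  \big[addn/0%N]_(j \in [set: nat]) p j j.

Lemma plane_partition_le n p i j k l : is_plane_partition n p ->
  (i <= j)%N -> (k <= l)%N -> (p j l <= p i k)%N.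
Proof.
case=> prow pcol _ _ ij kl; apply: (@leq_trans (p i l)).
  rewrite -(subnK ij); elim: (j - i)%N => // m; exact/leq_trans/prow.
rewrite -(subnK kl); elim: (l - k)%N => // m; exact/leq_trans/pcol.
Qed.

(* The plane partitions of n are finitely many, hence their cardinal [pp] below
   is meaningful ([fset_set] of an infinite set is empty by convention). *)
Lemma finite_plane_partition n : finite_set [set p | is_plane_partition n p].
Proof.
pose G (f : {ffun 'I_n * 'I_n -> 'I_n.+1}) (j k : nat) : nat :=
  if insub j is Some j' then if insub k is Some k' then f (j', k') : nat
  else 0%N else 0%N.
apply: (@sub_finite_set _ _ (G @` setT)); last exact/finite_image/finite_finset.
move=> p ppp; have [prow pcol pfin psum] := ppp.
set F := finite_support 0%N [set: nat * nat] (fun jk => p jk.1 jk.2).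
have memF jk : (jk \in F) = (p jk.1 jk.2 != 0%N).
  rewrite in_finite_support; last first.
    by apply: sub_finite_set pfin => x [_ /=] /eqP.
  apply/idP/idP => [/set_mem[_ /= /eqP]//|p0].
  by apply: mem_set; split=> //=; exact/eqP.
have uF : uniq F by exact: finite_support_uniq.
have sF : \sum_(jk <- F) p jk.1 jk.2 = n by [].
have pn j k : (p j k <= n)%N.
  have [->//|p0] := eqVneq (p j k) 0%N.
  have jkF : (j, k) \in F by rewrite memF.
  by rewrite -sF (big_rem _ jkF) leq_addr.
have szF : (size F <= n)%N.
  rewrite -sF -sum1_size big_seq [X in (_ <= X)%N]big_seq.
  by apply: leq_sum => jk; rewrite memF lt0n.
have psupp j k : (n <= maxn j k)%N -> p j k = 0%N.
  move=> njk; apply/eqP; apply: contraT => pjk0.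
  suff: (maxn j k < size F)%N by rewrite ltnNge (leq_trans szF).
  pose s := [seq (minn i j, minn i k) | i <- iota 0 (maxn j k).+1].
  have <- : size s = (maxn j k).+1 by rewrite size_map size_iota.
  apply: uniq_leq_size.
    rewrite map_inj_in_uniq ?iota_uniq// => a b.
    rewrite !mem_iota !add0n !ltnS /= => am bm [ej ek].
    have E c : (c <= maxn j k)%N -> c = maxn (minn c j) (minn c k).
      by rewrite -minn_maxr => /minn_idPl.
    by rewrite (E a)// (E b)// ej ek.
  move=> _ /mapP[i _ ->]; rewrite memF /= -lt0n.
  by rewrite (leq_trans _ (plane_partition_le ppp (geq_minr i j) (geq_minr i k)))// lt0n.
exists [ffun jk : 'I_n * 'I_n => inord (p jk.1 jk.2)] => //.
apply/funext => j; apply/funext => k; rewrite /G.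
case: insubP => [j' _ <-|]; last first.
  by rewrite -leqNgt => nj; rewrite psupp// leq_max nj.
case: insubP => [k' _ <-|]; last first.
  by rewrite -leqNgt => nk; rewrite psupp// leq_max nk orbT.
by rewrite ffunE inordK// ltnS.
Qed.

Definition pp (a : int) (b n : nat) : nat :=
  #|` fset_set [set p | is_plane_partition n p /\
                        ((pp_trace p)%:Z = a %[mod b%:Z])%Z]|.

Section ComplexFunctions.
Context {R : realType}.

Definition cexp (z : R[i]) : R[i] :=
  let: x +i* y := z in (expR x * cos y) +i* (expR x * sin y).

Definition carg (z : R[i]) : R :=
  let t := acos (complex.Re z / Normc.normc z) in if 0 <= complex.Im z then t else - t.

Lemma carg_itv z : - pi < carg z <= pi.
Proof.
have lt_u (x y : R) : y < 0 -> x / Normc.normc (x +i* y : R[i]) \in `]-1, 1[.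
  move=> y0; have y2 : 0 < y ^+ 2 by rewrite exprn_even_gt0//= lt_eqF.
  have s0 : 0 < Num.sqrt (x ^+ 2 + y ^+ 2).
    by rewrite sqrtr_gt0 ltr_wpDl// sqr_ge0.
  have : `|x / Num.sqrt (x ^+ 2 + y ^+ 2)| < 1.
    rewrite normrM normfV (gtr0_norm s0) ltr_pdivrMr// mul1r -sqrtr_sqr.
    by rewrite ltr_sqrt ?ltrDl// (lt_le_trans y2)// lerDr sqr_ge0.
  by rewrite ltr_norml in_itv.
have le_u : -1 <= complex.Re z / Normc.normc z <= 1.
  case: z => x y /=; rewrite -ler_norml normrM normfV (ger0_norm (sqrtr_ge0 _)).
  have [->|s0] := eqVneq (Num.sqrt (x ^+ 2 + y ^+ 2)) 0.
    by rewrite invr0 mulr0.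
  rewrite ler_pdivrMr ?lt0r ?s0 ?sqrtr_ge0// mul1r -sqrtr_sqr.
  by rewrite ler_wsqrtr// lerDl sqr_ge0.
rewrite /carg /=; case: (leP 0 (complex.Im z)) => [_|z0].
  rewrite acos_lepi// andbT (lt_le_trans _ (acos_ge0 le_u))//.
  by rewrite oppr_lt0 pi_gt0.
case: z z0 {le_u} => x y /= /(lt_u x); rewrite in_itv /= => /andP[u1 u2].
rewrite ltrN2 acos_ltpi ?u1 ?(ltW u2)//=.
rewrite (le_trans _ (pi_ge0 R))// oppr_le0 acos_ge0// (ltW u1) (ltW u2)//.
Qed.

Definition clog (z : R[i]) : R[i] := ln (Normc.normc z) +i* carg z.

Lemma clogK z : z != 0 -> cexp (clog z) = z.
Proof.
case: z => x y z0; rewrite /cexp /clog /carg /=.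
have s2 : 0 < x ^+ 2 + y ^+ 2.
  rewrite lt0r addr_ge0 ?sqr_ge0// andbT paddr_eq0 ?sqr_ge0// !sqrf_eq0.
  by move: z0; rewrite eq_complex.
set s := Num.sqrt _; have s0 : 0 < s by rewrite sqrtr_gt0.
have sE : s ^+ 2 = x ^+ 2 + y ^+ 2 by rewrite sqr_sqrtr// ltW.
have u1 : -1 <= x / s <= 1.
  rewrite -ler_norml normrM normfV (gtr0_norm s0) ler_pdivrMr// mul1r.
  by rewrite -sqrtr_sqr ler_wsqrtr// lerDl sqr_ge0.
have sq : s * Num.sqrt (1 - (x / s) ^+ 2) = `|y|.
  rewrite -{1}(gtr0_norm s0) -sqrtr_sqr -sqrtrM ?sqr_ge0// mulrBr mulr1.
  rewrite -exprMn mulrCA divff ?gt_eqF// mulr1 sE addrAC subrr add0r.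
  by rewrite sqrtr_sqr.
rewrite lnK ?posrE//; case: (leP 0 y) => y0.
  rewrite acosK// sin_acos// sq ger0_norm// mulrCA divff ?gt_eqF// mulr1//.
rewrite cosN sinN acosK// sin_acos// mulrN sq ltr0_norm// opprK.
by rewrite mulrCA divff ?gt_eqF// mulr1.
Qed.

Definition cpow (z : R[i]) (s : R) : R[i] :=
  if z == 0 then (s == 0)%:R else cexp (s%:C * clog z).

(* [R[i]^o] is [R[i]] with its topology of a normed field. *)
Definition Li3 (z : R[i]) : R[i] :=
  limn (fun N : nat => \sum_(1 <= k < N) z ^+ k / k%:R ^+ 3 : R[i]^o).

Definition zeta (b : nat) : R[i] := cexp ((2 * pi / b%:R)*i).

End ComplexFunctions.

Arguments zeta : clear implicits.

(* Main.v *)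
(* Tracking the trace by a variable z, plane partitions have the generating
   function prod_m (1 - z q^m)^(-m), with coefficients H_n(z) = sum of z^trace;
   up to any fixed order this follows from a bijection with finite matrices of
   natural numbers built on local rules (growth diagrams).  Orthogonality of the
   characters of Z/b writes pp(a1,b,n) - pp(a2,b,n) as a combination of the
   H_n(zeta^j), 0 < j < b.  With q = exp(-x) the logarithm of the product is
   Li3(z)/x^2 + log(1-z)/12 + o(1) in any cone |Im x| <= C Re x, and outside it
   has real part at most (1/4 + eps)/(Re x)^2.  For z = zeta, put
   Li3(zeta) = (l(1+ia))^3: integrating over the line through the saddle point
   t(1+ia), n t^3 = 2 l^3, gives the asymptotics of H_n(zeta), and the Gaussian
   integral J satisfies (1-ia) J^2 = pi.  The roots zeta and zeta^(-1) dominate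
   because x |-> Re(Li3(e^{ix})^(1/3)) is strictly decreasing on (0,pi]; this
   follows from the fact that (l(1+ia))^3/w^2 has real part at most l^3 on the
   line Re w = 1, with equality at w = 1+ia, combined with the monotonicity of
   Re(e^{-ib} Li3(e^{ix})) in x >= b, a consequence of the positivity of convex
   sine sums.  Since l^3 > 1/4 for b >= 3, the arcs outside the cone are
   negligible. *)
Require Import Defs.
From HB Require Import structures.
From mathcomp Require Import all_boot all_order all_algebra.
From mathcomp Require Import all_classical all_reals all_analysis.
From mathcomp Require Import measurable_realfun complex.
From mathcomp Require Import finmap ring lra zify.

Import Order.TTheory GRing.Theory Num.Theory.
Import numFieldNormedType.Exports.

Local Open Scope classical_set_scope.
Local Open Scope ring_scope.
Local Open Scope complex_scope.

(** * Growth diagrams and the trace generating function *)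

(** Neither infinite products nor contour shifts occur. A coefficient is extracted from a polynomial
    (a finite box of factors, each a truncated geometric sum) by integrating over one period of a
    vertical line, where the polynomial equals [cexp (Tsum z x)] up to an additive error 1,
    negligible at the saddle point. Mellin transforms and Laurent expansions are replaced by the
    relation 4h(x) = h(x/2) - w/(1+w)^2, w = e^{-x/2}, for h(x) = e^{-x}/(1-e^{-x})^2: iterating it
    writes h(x) - 1/x^2 as a series that is Lipschitz in a cone and has the value -1/12 at 0. As |z|
    = 1, the series of log(1-z) converges only conditionally, so this expansion is summed by parts.
    The constant 1/4 bounds the sum of 1/k^3 over k >= 2: away from the real axis only the term k =
    1 of the logarithm is known to be small. By monotonicity the extreme case to compare with 1/4 is
    b = 3. The cube roots are never differentiated: the direction optimal for an angle is inserted
    as a test direction at a slightly smaller one. *)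

Section GrowthDiagrams.
Local Open Scope nat_scope.

(** Each [G u v] is a partition with parts [G u v k]; the four inequalities say that neighbours on
    the grid interlace. The rule is the piecewise linear form of the Robinson-Schensted-Knuth local
    rule: given the two neighbours [G u.+1 v] and [G u v.+1], it trades [G u.+1 v.+1] for all parts
    of [G u v] except the first. *)
Record growth (G : nat -> nat -> nat -> nat) : Prop := Growth {
  growth_lel : forall u v k, G u.+1 v k <= G u v k;
  growth_gel : forall u v k, G u v k.+1 <= G u.+1 v k;
  growth_ler : forall u v k, G u v.+1 k <= G u v k;
  growth_ger : forall u v k, G u v k.+1 <= G u v.+1 k;
  growth_rule : forall u v k, G u v k.+1 + G u.+1 v.+1 k =
    maxn (G u.+1 v k.+1) (G u v.+1 k.+1) + minn (G u.+1 v k) (G u v.+1 k) }.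

Definition vanish (N : nat) (G : nat -> nat -> nat -> nat) : Prop :=
  forall u v k, N <= u \/ N <= v -> G u v k = 0.

(** The first part of [G u v] is the only one that the rule leaves free; interlacing bounds it below
    by the maximum, and the excess is the matrix entry attached to the square. *)
Definition growth_cell (G : nat -> nat -> nat -> nat) (u v : nat) : nat :=
  G u v 0 - maxn (G u.+1 v 0) (G u v.+1 0).

Lemma growth_cellE G u v : growth G ->
  G u v 0 = maxn (G u.+1 v 0) (G u v.+1 0) + growth_cell G u v.
Proof.
move=> gG; have := growth_lel _ gG u v 0; have := growth_ler _ gG u v 0.
rewrite /growth_cell; lia.
Qed.

(** The rule solved for [G u.+1 v.+1 k] propagates equality away from the two axes. *)
Lemma growth_eq_boundary G H : growth G -> growth H ->
  (forall v k, G 0 v k = H 0 v k) -> (forall u k, G u 0 k = H u 0 k) ->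
  forall u v k, G u v k = H u v k.
Proof.
move=> gG gH b0 b1; elim=> [//|u IHu]; elim=> [//|v IHv] k.
have := growth_rule _ gG u v k; have := growth_rule _ gH u v k.
rewrite !IHu !IHv; lia.
Qed.

(** The rule solved for [G u v k.+1] propagates equality from the empty region towards the origin,
    each cell supplying the missing first part. *)
Lemma growth_eq_cell N G H : growth G -> growth H -> vanish N G -> vanish N H ->
  (forall u v, growth_cell G u v = growth_cell H u v) ->
  forall u v k, G u v k = H u v k.
Proof.
move=> gG gH vG vH eGH.
suff E m u v k : N - u + (N - v) <= m -> G u v k = H u v k.
  by move=> u v k; exact: E (leqnn _).
elim: m u v k => [|m IHm] u v k uvm.
  by rewrite vG ?vH//; left; lia.
have [Nu|uN] := leqP N u; first by rewrite vG ?vH//; left.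
have [Nv|vN] := leqP N v; first by rewrite vG ?vH//; right.
have E1 l : G u.+1 v l = H u.+1 v l by apply: IHm; lia.
have E2 l : G u v.+1 l = H u v.+1 l by apply: IHm; lia.
have E3 l : G u.+1 v.+1 l = H u.+1 v.+1 l by apply: IHm; lia.
case: k => [|k]; first by rewrite growth_cellE// [RHS]growth_cellE// E1 E2 eGH.
have := growth_rule _ gG u v k; have := growth_rule _ gH u v k.
rewrite !E1 !E2 !E3; lia.
Qed.

(** One step in [u] costs one index: [G u v (m + l) <= G (u + l) v m], so after [N] steps the empty
    region is reached. *)
Lemma growth_vanish N G u v k : growth G -> vanish N G -> N <= k -> G u v k = 0.
Proof.
move=> gG vG Nk.
have H l : G u v (k - l + l) <= G (u + l) v (k - l).
  elim: l (k - l) => [|l IHl] m; first by rewrite !addn0.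
  rewrite addnS (leq_trans (IHl m.+1 : G u v (m.+1 + l) <= _))//.
  rewrite addnS; exact: growth_gel.
have := H N; rewrite subnK// (vG (u + N)); last by left; lia.
by rewrite leqn0 => /eqP.
Qed.

(** The maximum and the minimum of two numbers add up to their sum, so summing the rule over [k]
    yields |G u v| + |G u.+1 v.+1| = cell + |G u.+1 v| + |G u v.+1|. This is inclusion-exclusion for
    sums over quadrants. *)
Lemma growth_sum N G u v : growth G -> vanish N G ->
  \sum_(k < N) G u v k = \sum_(u <= i < N) \sum_(v <= j < N) growth_cell G i j.
Proof.
move=> gG vG.
suff E m : forall u v, N - u + (N - v) <= m ->
  \sum_(k < N) G u v k = \sum_(u <= i < N) \sum_(v <= j < N) growth_cell G i j.
  exact: E (leqnn _).
elim: m => [|m IHm] {}u {}v uvm.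
  rewrite big1 => [|k _]; last by apply: vG; left; lia.
  by rewrite big_geq//; lia.
have [Nu|uN] := leqP N u.
  by rewrite big_geq// big1// => k _; apply: vG; left.
have [Nv|vN] := leqP N v.
  rewrite big1 => [|k _]; last by apply: vG; right.
  by rewrite big1// => i _; rewrite big_geq.
have E1 : \sum_(k < N) G u.+1 v k =
    \sum_(u.+1 <= i < N) \sum_(v <= j < N) growth_cell G i j by apply: IHm; lia.
have E2 : \sum_(k < N) G u v.+1 k =
    \sum_(u <= i < N) \sum_(v.+1 <= j < N) growth_cell G i j by apply: IHm; lia.
have E3 : \sum_(k < N) G u.+1 v.+1 k =
    \sum_(u.+1 <= i < N) \sum_(v.+1 <= j < N) growth_cell G i j by apply: IHm; lia.
have shift H : H N = 0 -> \sum_(k < N) H k = H 0 + \sum_(k < N) H k.+1.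
  by move=> HN; rewrite -(big_ord_recl N H) big_ord_recr /= HN addn0.
have M : \sum_(k < N) G u v k + \sum_(k < N) G u.+1 v.+1 k =
  growth_cell G u v + (\sum_(k < N) G u.+1 v k + \sum_(k < N) G u v.+1 k).
  have van w x : G w x N = 0 by apply: (@growth_vanish N).
  rewrite shift ?van// -addnA -big_split /=.
  under eq_bigr => k _ do rewrite (growth_rule _ gG).
  rewrite big_split /= growth_cellE// [LHS]addnA [X in X + _ = _]addnAC.
  have <- : \sum_(k < N) maxn (G u.+1 v k) (G u v.+1 k) =
     maxn (G u.+1 v 0) (G u v.+1 0) +
     \sum_(k < N) maxn (G u.+1 v k.+1) (G u v.+1 k.+1).
    by rewrite (shift (fun k => maxn (G u.+1 v k) (G u v.+1 k)))// !van.
  rewrite [X in X + _ = _]addnC -addnA; congr addn.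
  by rewrite -!big_split /=; apply: eq_bigr => k _; lia.
have S1 F : \sum_(u <= i < N) F i = F u + \sum_(u.+1 <= i < N) F i.
  by rewrite big_ltn.
have S2 i : \sum_(v <= j < N) growth_cell G i j =
  growth_cell G i v + \sum_(v.+1 <= j < N) growth_cell G i j by rewrite big_ltn.
move: M; rewrite E1 E2 E3 !S1 !S2.
have -> : \sum_(u.+1 <= i < N) \sum_(v <= j < N) growth_cell G i j =
   \sum_(u.+1 <= i < N) growth_cell G i v +
   \sum_(u.+1 <= i < N) \sum_(v.+1 <= j < N) growth_cell G i j.
  by rewrite -big_split; apply: eq_bigr => i _; exact: S2.
lia.
Qed.

(* The rows of the diagram are read from the origin outwards: the local rule
   recovers the inner partition from the three outer ones. *)
Fixpoint peel (p : nat -> nat -> nat) (u : nat) : nat -> nat -> nat :=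
  match u with
  | 0 => fun v k => p k (k + v)
  | u'.+1 => fix row v := match v with
    | 0 => fun k => p (k + u'.+1) k
    | v'.+1 => fun k => maxn (row v' k.+1) (peel p u' v'.+1 k.+1) +
        minn (row v' k) (peel p u' v'.+1 k) - peel p u' v' k.+1
    end
  end.

(** Inverse direction of [peel]: here [i] and [j] count from the far corner, where the partitions
    are empty, so larger arguments mean larger partitions. Interlacing makes the truncated
    subtraction exact. *)
Fixpoint insert (a : nat -> nat -> nat) (i : nat) : nat -> nat -> nat :=
  match i with
  | 0 => fun _ _ => 0
  | i'.+1 => fix row j := match j with
    | 0 => fun _ => 0
    | j'.+1 => fun k =>
        match k with
        | 0 => maxn (insert a i' j'.+1 0) (row j' 0) + a i' j'
        | k'.+1 => maxn (insert a i' j'.+1 k) (row j' k) +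
           minn (insert a i' j'.+1 k') (row j' k') - insert a i' j' k'
        end
    end
  end.

Lemma peelSS p u v k : peel p u.+1 v.+1 k =
  maxn (peel p u.+1 v k.+1) (peel p u v.+1 k.+1) +
  minn (peel p u.+1 v k) (peel p u v.+1 k) - peel p u v k.+1.
Proof. by []. Qed.

Lemma insertSS a i j k : insert a i.+1 j.+1 k.+1 =
  maxn (insert a i j.+1 k.+1) (insert a i.+1 j k.+1) +
  minn (insert a i j.+1 k) (insert a i.+1 j k) - insert a i j k.
Proof. by []. Qed.

Lemma insertSS0 a i j : insert a i.+1 j.+1 0 =
  maxn (insert a i j.+1 0) (insert a i.+1 j 0) + a i j.
Proof. by []. Qed.

(** Interlacing is proved alongside the construction, row by row, because the rule holds only if the
    subtraction in [peel] does not truncate: the subtracted part has to be at most the minimum. *)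
Lemma growth_peel p : (forall j k, p j.+1 k <= p j k) ->
  (forall j k, p j k.+1 <= p j k) -> growth (peel p).
Proof.
move=> pr pc.
have H u : (forall v k, peel p u v.+1 k <= peel p u v k /\
                   peel p u v k.+1 <= peel p u v.+1 k) /\
           (forall v k, peel p u.+1 v k <= peel p u v k /\
                   peel p u v k.+1 <= peel p u.+1 v k).
  elim: u => [|u [IH1 IH2]].
    have B v k : peel p 0 v.+1 k <= peel p 0 v k /\
                   peel p 0 v k.+1 <= peel p 0 v.+1 k.
      by rewrite /= !(addnS, addSn).
    split=> //; elim=> [|v IHv] k.
      by rewrite /= !addn0 addn1; split=> //; apply: pc.
    have := B v k; have := IHv k; have := B v k.+1; have := IHv k.+1.
    rewrite peelSS; lia.
  have B v : forall k, peel p u.+1 v.+1 k <= peel p u.+1 v k /\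
                   peel p u.+1 v k.+1 <= peel p u.+1 v.+1 k.
    move=> k.
    have := IH1 v k; have := IH2 v k; have := IH1 v k.+1; have := IH2 v k.+1.
    rewrite peelSS; lia.
  split=> //; elim=> [|v IHv] k.
    rewrite [peel p u.+2 0 k]/= [peel p u.+1 0 k]/= [peel p u.+1 0 k.+1]/=.
    by rewrite addnS addSn.
  have := B v k; have := IHv k; have := B v k.+1; have := IHv k.+1.
  rewrite (peelSS p u.+1); lia.
have H1 u := (H u).1; have H2 u := (H u).2.
split=> u v k; [exact: (H2 u v k).1|exact: (H2 u v k).2|exact: (H1 u v k).1
  |exact: (H1 u v k).2|].
have := H1 u v k; have := H2 u v k; have := H1 u v k.+1; have := H2 u v k.+1.
rewrite peelSS; lia.
Qed.

Lemma vanish_peel p N : (forall j k, p j.+1 k <= p j k) ->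
  (forall j k, p j k.+1 <= p j k) ->
  (forall j k, N <= j \/ N <= k -> p j k = 0) -> vanish N (peel p).
Proof.
move=> pr pc pN; have gp := growth_peel _ pr pc.
move=> u v k uvN; apply/eqP; rewrite -leqn0.
have [Nu|Nv] := uvN.
  apply: (@leq_trans (peel p u 0 k)).
    by elim: v {uvN} => // v; apply/leq_trans/(growth_ler _ gp).
  by case: u Nu {uvN} => [|u] Nu /=; rewrite pN//; left; lia.
apply: (@leq_trans (peel p 0 v k)).
  by elim: u {uvN} => // u; apply/leq_trans/(growth_lel _ gp).
by rewrite /= pN//; right; lia.
Qed.

Definition outer (N : nat) (a : nat -> nat -> nat) (u v k : nat) : nat :=
  insert (fun i j => a (N - i.+1) (N - j.+1)) (N - u) (N - v) k.

Lemma insert0r a i : insert a i 0 = fun=> 0.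
Proof. by case: i. Qed.

Lemma insert_interlace a i j k :
  [/\ insert a i j k <= insert a i.+1 j k, insert a i.+1 j k.+1 <= insert a i j k,
     insert a i j k <= insert a i j.+1 k & insert a i j.+1 k.+1 <= insert a i j k].
Proof.
suff H : (forall j k, insert a i j k <= insert a i j.+1 k /\
                   insert a i j.+1 k.+1 <= insert a i j k) /\
           (forall j k, insert a i j k <= insert a i.+1 j k /\
                   insert a i.+1 j k.+1 <= insert a i j k).
  by have [H1 H2] := H; have := H1 j k; have := H2 j k; case=> ? ? [].
elim: i {j k} => [|i [IH1 IH2]].
  split=> //; elim=> [|j IHj] k //.
  have := IHj k; rewrite insertSS; case: k => [|k]; rewrite ?insertSS0 ?insertSS /=; lia.
have B j : forall k, insert a i.+1 j k <= insert a i.+1 j.+1 k /\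
                   insert a i.+1 j.+1 k.+1 <= insert a i.+1 j k.
  move=> k; have := IH1 j k; have := IH2 j k.
  have := IH1 j k.-1; have := IH2 j k.-1.
  rewrite insertSS; case: k => [|k]; rewrite ?insertSS0 ?insertSS [_.-1]/=; lia.
split=> //; elim=> [|j IHj] k; first by rewrite !insert0r.
have := IHj k; have := B j k.
have := IHj k.-1; have := B j k.-1.
by rewrite (insertSS _ i.+1); case: k => [|k];
   rewrite ?(insertSS0 _ i.+1) ?(insertSS _ i.+1) [_.-1]/=; lia.
Qed.

Lemma insert_rule a i j k : insert a i.+1 j.+1 k.+1 + insert a i j k =
  maxn (insert a i j.+1 k.+1) (insert a i.+1 j k.+1) +
  minn (insert a i j.+1 k) (insert a i.+1 j k).
Proof.
have := insert_interlace a i j k.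
rewrite insertSS => -[]; lia.
Qed.

Lemma growth_outer N a : growth (outer N a).
Proof.
have S u : N - u.+1 = (N - u).-1 by lia.
have step u : (N <= u /\ N - u = 0 /\ N - u.+1 = 0) \/ (u < N /\ N - u = (N - u.+1).+1).
  by have [?|?] := leqP N u; [left|right]; lia.
split=> u v k; rewrite /outer.
- have [[_ [-> ->]]//|[_ ->]] := step u.
  by have [] := insert_interlace (fun i j => a (N - i.+1) (N - j.+1)) (N - u.+1) (N - v) k.
- have [[_ [-> ->]]//|[_ ->]] := step u.
  by have [] := insert_interlace (fun i j => a (N - i.+1) (N - j.+1)) (N - u.+1) (N - v) k.
- have [[_ [-> ->]]//|[_ ->]] := step v.
  by have [] := insert_interlace (fun i j => a (N - i.+1) (N - j.+1)) (N - u) (N - v.+1) k.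
- have [[_ [-> ->]]|[_ ->]] := step v; first by rewrite insert0r.
  by have [] := insert_interlace (fun i j => a (N - i.+1) (N - j.+1)) (N - u) (N - v.+1) k.
- have [[_ [-> ->]]//|[_ ->]] := step u.
  have [[_ [-> ->]]|[_ ->]] := step v; first by rewrite !insert0r.
  exact: insert_rule.
Qed.

Lemma vanish_outer N a : vanish N (outer N a).
Proof.
move=> u v k [Nu|Nv]; rewrite /outer.
  by have -> : N - u = 0 by lia.
have -> : N - v = 0 by lia.
by rewrite insert0r.
Qed.

Lemma growth_cell_outer N a : (forall u v, N <= u \/ N <= v -> a u v = 0) ->
  forall u v, growth_cell (outer N a) u v = a u v.
Proof.
move=> aN u v; rewrite /growth_cell.
have [Nu|uN] := leqP N u; first by rewrite vanish_outer ?aN//; left.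
have [Nv|vN] := leqP N v; first by rewrite vanish_outer ?aN//; right.
rewrite /outer.
have -> : N - u = (N - u.+1).+1 by lia.
have -> : N - v = (N - v.+1).+1 by lia.
rewrite insertSS0 addKn.
by congr a; lia.
Qed.

(** The partitions on the two axes of a diagram are the diagonals of an array, [G 0 0] being the
    main one; the size of [G 0 0] is thus the trace. *)
Definition unpeel (G : nat -> nat -> nat -> nat) (j k : nat) : nat :=
  if j <= k then G 0 (k - j) j else G (j - k) 0 k.

Lemma unpeel_row G j k : growth G -> unpeel G j.+1 k <= unpeel G j k.
Proof.
move=> gG; rewrite /unpeel; case: (leqP j.+1 k) => h1; case: (leqP j k) => h2; try lia.
- have -> : k - j = (k - j.+1).+1 by lia.
  exact: growth_ger.
- have -> : j = k by lia.
  by rewrite subSnn subnn; apply: growth_lel.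
- by rewrite subSn; [exact: growth_lel|lia].
Qed.

Lemma unpeel_col G j k : growth G -> unpeel G j k.+1 <= unpeel G j k.
Proof.
move=> gG; rewrite /unpeel; case: (leqP j k.+1) => h1; case: (leqP j k) => h2; try lia.
- by rewrite subSn//; exact: growth_ler.
- have -> : j = k.+1 by lia.
  by rewrite subSnn subnn; apply: growth_gel.
have -> : j - k = (j - k.+1).+1 by lia.
exact: growth_gel.
Qed.

Lemma unpeel0r G v k : unpeel G k (k + v) = G 0 v k.
Proof. by rewrite /unpeel leq_addr addKn. Qed.

Lemma unpeel0l G u k : unpeel G (k + u) k = G u 0 k.
Proof.
rewrite /unpeel; case: (leqP (k + u) k) => h; last by rewrite addKn.
have -> : u = 0 by lia.
by rewrite addn0 subnn.
Qed.

Lemma unpeel_vanish N G j k : growth G -> vanish N G -> N <= j \/ N <= k ->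
  unpeel G j k = 0.
Proof.
move=> gG vG jk; rewrite /unpeel; case: (leqP j k) => h; apply/eqP; rewrite -leqn0.
  have [Nj|jN] := leqP N j; first by rewrite (growth_vanish N).
  have := growth_vanish N G 0 0 N gG vG (leqnn _).
  have H l : G 0 (k - j) j <= G 0 (k - j) (j - l).
    elim: l => [|l IH]; first by rewrite subn0.
    apply: (leq_trans IH); have [?|?] := leqP j l.
      by have -> : j - l = j - l.+1 by lia.
    have -> : j - l = (j - l.+1).+1 by lia.
    exact: leq_trans (growth_ger _ gG _ _ _) (growth_ler _ gG _ _ _).
  move=> _; clear H; move: (k - j) (subnK h) => v vk.
  have H l : l <= j -> G 0 v j <= G 0 (v + l) (j - l).
    elim: l => [|l IH] lj; first by rewrite addn0 subn0.
    apply: (leq_trans (IH (ltnW lj))).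
    have -> : j - l = (j - l.+1).+1 by lia.
    by rewrite addnS; exact: growth_ger.
  by apply: leq_trans (H j (leqnn _)) _; rewrite vG//; right; lia.
move: (j - k) (subnK (ltnW h)) => u uj.
have H l : l <= k -> G u 0 k <= G (u + l) 0 (k - l).
  elim: l => [|l IH] lk; first by rewrite addn0 subn0.
  apply: (leq_trans (IH (ltnW lk))).
  have -> : k - l = (k - l.+1).+1 by lia.
  by rewrite addnS; exact: growth_gel.
by apply: leq_trans (H k (leqnn _)) _; rewrite vG//; left; lia.
Qed.

Lemma peel_unpeel G : growth G -> forall u v k, peel (unpeel G) u v k = G u v k.
Proof.
move=> gG; apply: growth_eq_boundary => //.
- apply: growth_peel => j k; [exact: unpeel_row|exact: unpeel_col].
- by move=> v k /=; rewrite unpeel0r.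
- by move=> [|u] k /=; rewrite ?unpeel0l// unpeel0r.
Qed.

Lemma unpeel_peel p j k : unpeel (peel p) j k = p j k.
Proof.
rewrite /unpeel; case: (leqP j k) => h /=; first by rewrite subnKC.
case E : (j - k) => [|u]; first lia.
by rewrite /=; congr p; lia.
Qed.

Lemma sum_diagonals N p : (forall j k, N <= j \/ N <= k -> p j k = 0) ->
  \sum_(j < N) \sum_(k < N) p j k =
  \sum_(v < N) \sum_(k < N) p k (k + v) + \sum_(1 <= u < N) \sum_(k < N) p (k + u) k.
Proof.
move=> pN.
have row j : \sum_(k < N) p j k = \sum_(k < N | k < j) p j k + \sum_(v < N) p j (j + v).
  rewrite (bigID (fun k : 'I_N => k < j)) /=; congr addn.
  under eq_bigl => k do rewrite -leqNgt.
  rewrite -!(big_mkord (fun k => j <= k) (p j)) -(big_mkord xpredT (fun v => p j (j + v))).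
  have [jN|Nj] := leqP j N; last first.
    rewrite !big1// => k _; apply: pN; left; exact: ltnW.
  rewrite (big_cat_nat (leq0n j) jN) /= big_nat_cond big1 ?add0n; last by move=> i; lia.
  rewrite [in RHS](@big_cat_nat _ _ _ (N - j))//=; last lia.
  rewrite [X in _ = _ + X]big_nat_cond [X in _ = _ + X]big1 ?addn0; last first.
    by move=> i; rewrite andbT => /andP[? ?]; apply: pN; right; lia.
  rewrite -{1}(add0n j) big_addn; apply: congr_big_nat => // i; last by rewrite addnC.
  by move=> ?; lia.
rewrite (eq_bigr _ (fun (j : 'I_N) _ => row j)).
rewrite big_split /= addnC; congr addn; first by rewrite exchange_big.
rewrite (eq_bigr _ (fun (j : 'I_N) _ => big_mkcond _ _)).
rewrite exchange_big /= [in RHS]exchange_big /=; apply: eq_bigr => k _.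
rewrite -big_mkcond -(big_mkord (fun j => k < j) (fun j => p j k)).
have kN : k.+1 <= N by [].
rewrite (big_cat_nat (leq0n _) kN) /= big_nat_cond big1 ?add0n; last by move=> i; lia.
have kN' : 0 < N by lia.
rewrite [in RHS](@big_cat_nat _ _ _ (N - k))//=; try lia.
rewrite [X in _ = _ + X]big_nat_cond [X in _ = _ + X]big1 ?addn0; last first.
  by move=> i; rewrite andbT => /andP[? ?]; apply: pN; left; lia.
rewrite -(add1n k) big_addn [in RHS]big_nat_cond; apply: congr_big_nat => // i ?; last by rewrite addnC.
lia.
Qed.

(** By [growth_sum] the cell (i, j) is counted in the diagonals [G 0 v] for v <= j and [G u 0] for 1
    <= u <= i, that is i + j + 1 times. *)
Lemma sum_unpeel N G : growth G -> vanish N G ->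
  \sum_(j < N) \sum_(k < N) unpeel G j k =
  \sum_(i < N) \sum_(j < N) growth_cell G i j * (i + j).+1.
Proof.
move=> gG vG; rewrite sum_diagonals; last by move=> j k; exact: unpeel_vanish.
have -> : \sum_(v < N) \sum_(k < N) unpeel G k (k + v) =
    \sum_(i < N) \sum_(j < N) growth_cell G i j * j.+1.
  have E (v : 'I_N) : true -> \sum_(k < N) unpeel G k (k + v) =
      \sum_(i < N) \sum_(j < N) (if v <= j then growth_cell G i j else 0).
    move=> _; rewrite (eq_bigr _ (fun (k : 'I_N) _ => unpeel0r G v k)).
    rewrite (growth_sum N)// big_mkord; apply: eq_bigr => i _.
    rewrite -(big_mkord xpredT (fun j => if v <= j then growth_cell G i j else 0)).
    rewrite (big_cat_nat (leq0n v) (ltnW (ltn_ord v))) /= [X in _ = X + _]big_nat_cond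
      [X in _ = X + _]big1 ?add0n.
      by apply: eq_big_nat => j /andP[-> _].
    by move=> j /andP[/andP[_ jv] _]; rewrite leqNgt jv.
  rewrite (eq_bigr _ E) exchange_big; apply: eq_bigr => i _.
  rewrite exchange_big; apply: eq_bigr => j _ /=.
  rewrite -big_mkcond -(big_mkord (fun v => v <= j) (fun=> growth_cell G i j)).
  rewrite (big_cat_nat (leq0n j.+1) (ltn_ord j)) /=.
  rewrite [X in _ + X]big_nat_cond [X in _ + X]big1 ?addn0; last by move=> l; lia.
  rewrite big_nat_cond (eq_bigl (fun l => 0 <= l < j.+1)).
    by rewrite -big_nat sum_nat_const_nat subn0 mulnC.
  by move=> l; lia.
have -> : \sum_(1 <= u < N) \sum_(k < N) unpeel G (k + u) k =
    \sum_(i < N) \sum_(j < N) growth_cell G i j * i.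
  have E u : (1 <= u < N) -> \sum_(k < N) unpeel G (k + u) k =
      \sum_(i < N) \sum_(j < N) (if u <= i then growth_cell G i j else 0).
    move=> /andP[_ uN]; rewrite (eq_bigr _ (fun (k : 'I_N) _ => unpeel0l G u k)).
    rewrite (growth_sum N)//.
    rewrite -(big_mkord xpredT (fun i => \sum_(j < N) if u <= i then growth_cell G i j else 0)).
    rewrite (big_cat_nat (leq0n u) (ltnW uN)) /= [X in _ = X + _]big_nat_cond
      [X in _ = X + _]big1 ?add0n.
      by apply: eq_big_nat => j /andP[-> _]; rewrite big_mkord.
    by move=> j /andP[/andP[_ jv] _]; rewrite big1// => l _; rewrite leqNgt jv.
  rewrite (eq_big_nat _ _ E) exchange_big; apply: eq_bigr => i _.
  rewrite exchange_big; apply: eq_bigr => j _ /=.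
  rewrite -big_mkcond (big_cat_nat (ltn0Sn i) (ltn_ord i)) /=.
  rewrite [X in _ + X]big_nat_cond [X in _ + X]big1 ?addn0; last by move=> l; lia.
  rewrite big_nat_cond (eq_bigl (fun l => 0 < l < i.+1)).
    by rewrite -big_nat sum_nat_const_nat subSS subn0 mulnC.
  by move=> l; lia.
rewrite -big_split; apply: eq_bigr => i _; rewrite -big_split; apply: eq_bigr => j _.
by rewrite /= -mulnDr addSn addnC.
Qed.

Lemma fsum_square N (p : nat -> nat -> nat) :
  (forall j k, N <= j \/ N <= k -> p j k = 0) ->
  \big[addn/0]_(jk \in [set: nat * nat]) p jk.1 jk.2 =
  \sum_(j < N) \sum_(k < N) p j k.
Proof.
move=> pN; pose s := [seq (j, k) | j <- iota 0 N, k <- iota 0 N].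
have us : uniq s by apply: allpairs_uniq => //; [exact: iota_uniq..|case=> ? ? [? ?] _ _ [-> ->]].
rewrite -(@fsbig_widen _ _ _ _ [set` s])//.
  rewrite -fsbig_seq// big_allpairs -(big_mkord xpredT (fun j => \sum_(k < N) p j k)).
  rewrite /index_iota subn0; apply: eq_bigr => j _.
  by rewrite -[RHS](big_mkord xpredT (p j)) /index_iota subn0.
move=> [j k] [_ /= jks]; apply: pN; have [jN|] := leqP N j; [by left|move=> jN].
have [kN|kN] := leqP N k; [by right|exfalso; apply: jks].
by apply/allpairsP; exists (j, k); rewrite !mem_iota.
Qed.

Lemma fsum_line N (f : nat -> nat) : (forall j, N <= j -> f j = 0) ->
  \big[addn/0]_(j \in [set: nat]) f j = \sum_(j < N) f j.
Proof.
move=> fN; rewrite -(@fsbig_widen _ _ _ _ [set` iota 0 N])//.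
  by rewrite -fsbig_seq ?iota_uniq// -(big_mkord xpredT f) /index_iota subn0.
move=> j [_ /= js]; apply: fN; rewrite leqNgt; apply: contra_notN js.
by rewrite mem_iota.
Qed.

End GrowthDiagrams.

(** * The generating function of plane partitions by trace *)

Section TraceGeneratingFunction.
Local Open Scope nat_scope.

Lemma sum_pair (I J : finType) (F : I * J -> nat) :
  \sum_ij F ij = \sum_i \sum_j F (i, j).
Proof.
by rewrite (pair_bigA _ (fun i j => F (i, j))); apply: eq_bigr => -[].
Qed.

Lemma sum_widen N M (F : nat -> nat) : N <= M -> (forall i, N <= i -> F i = 0) ->
  \sum_(i < M) F i = \sum_(i < N) F i.
Proof.
move=> NM F0; rewrite (big_ord_widen M F NM) [RHS]big_mkcond; apply: eq_bigr => i _.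
by case: ltnP => // /F0.
Qed.

Variables (N K : nat).

Implicit Type f : {ffun 'I_N * 'I_N -> 'I_K}.

Definition array_ext f (i j : nat) : nat :=
  if insub i is Some i' then if insub j is Some j' then f (i', j') : nat
  else 0 else 0.

Definition array_pp f : nat -> nat -> nat := unpeel (outer N (array_ext f)).

Lemma array_ext_ord f (i j : 'I_N) : array_ext f i j = f (i, j).
Proof. by rewrite /array_ext !valK. Qed.

Lemma array_ext0 f i j : N <= i \/ N <= j -> array_ext f i j = 0.
Proof.
rewrite /array_ext; case: insubP => [i' iN _|//].
case: insubP => [j' jN _|//]; lia.
Qed.

Lemma cell_array f i j : growth_cell (outer N (array_ext f)) i j = array_ext f i j.
Proof. by apply: growth_cell_outer; exact: array_ext0. Qed.

(** [peel] rebuilds the whole diagram from the array, and the matrix entries are the cells of the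
    diagram. *)
Lemma array_pp_inj : injective array_pp.
Proof.
move=> f g fg; apply/ffunP => -[i j]; apply/val_inj.
rewrite /= -!array_ext_ord -!cell_array.
have E := peel_unpeel _ (growth_outer N (array_ext f)).
have E' := peel_unpeel _ (growth_outer N (array_ext g)).
by rewrite /growth_cell -!E -!E' -!/(array_pp _) fg.
Qed.

Lemma array_ppP f : is_plane_partition
  (\sum_(ij : 'I_N * 'I_N) f ij * (ij.1 + ij.2).+1) (array_pp f).
Proof.
have gG := growth_outer N (array_ext f); have vG := vanish_outer N (array_ext f).
have van j k : N <= j \/ N <= k -> array_pp f j k = 0 by exact: unpeel_vanish.
split=> [j k|j k||]; [exact: unpeel_row|exact: unpeel_col| |].
  apply: (@sub_finite_set _ _ (`I_N `*` `I_N)%classic).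
    move=> [j k] /= /eqP p0; split=> /=; rewrite ltnNge; apply/negP => h; apply: p0.
      by apply: van; left.
    by apply: van; right.
  exact: finite_setX.
rewrite (fsum_square N)// sum_unpeel//.
rewrite sum_pair.
by apply: eq_bigr => i _; apply: eq_bigr => j _; rewrite cell_array array_ext_ord.
Qed.

Lemma trace_array_pp f : pp_trace (array_pp f) = \sum_ij f ij.
Proof.
have gG := growth_outer N (array_ext f); have vG := vanish_outer N (array_ext f).
rewrite /pp_trace (fsum_line N); last first.
  by move=> j Nj; apply: (unpeel_vanish N) => //; left.
have E (j : 'I_N) : true -> array_pp f j j = outer N (array_ext f) 0 0 j.
  by move=> _; rewrite -{2}(addn0 j); exact: unpeel0r.
rewrite (eq_bigr _ E).
rewrite (growth_sum N)// big_mkord.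
rewrite sum_pair; apply: eq_bigr => i _; rewrite big_mkord.
by apply: eq_bigr => j _; rewrite cell_array array_ext_ord.
Qed.

(** The weight [(i + j).+1] makes the two size conditions sufficient: a nonzero cell has i + j < n
    <= N, and its value is at most n < K. *)
Lemma array_pp_surj n p : n <= N -> n < K -> is_plane_partition n p ->
  exists2 f : {ffun 'I_N * 'I_N -> 'I_K}, \sum_(ij : 'I_N * 'I_N) f ij * (ij.1 + ij.2).+1 = n & array_pp f = p.
Proof.
move=> nN nK [pr pc pfin psum].
(* The support of [p] is first enclosed in some large square; that the diagram fits into side [N]
   follows only from the cells. *)
have [M NM pM] : exists2 M, N <= M & forall j k, M <= j \/ M <= k -> p j k = 0.
  case/finite_seqP: pfin => s sE.
  have ins j k : p j k != 0 -> (j, k) \in s.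
    by move=> p0; have : [set jk | p jk.1 jk.2 != 0]%classic (j, k) by []; rewrite sE.
  pose m := \max_(jk <- s) (maxn jk.1 jk.2).
  exists (maxn N m.+1); first exact: leq_maxl.
  move=> j k jk; apply/eqP/negP => /negP/ins jks.
  have : maxn j k <= m :=
    @leq_bigmax_seq _ s xpredT (fun jk : nat * nat => maxn jk.1 jk.2) (j, k) jks isT.
  lia.
have gG := growth_peel _ pr pc; have vG := vanish_peel _ _ pr pc pM.
pose a := growth_cell (peel p).
have sum_a : \sum_(i < M) \sum_(j < M) a i j * (i + j).+1 = n.
  rewrite -sum_unpeel// -psum (fsum_square M)//.
  by apply: eq_bigr => i _; apply: eq_bigr => j _; rewrite unpeel_peel.
have a_le i j : i < M -> j < M -> a i j * (i + j).+1 <= n.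
  move=> iM jM; rewrite -sum_a (bigD1 (Ordinal iM))//= (bigD1 (Ordinal jM))//=.
  by rewrite -addnA leq_addr.
have a0 i j : N <= i \/ N <= j -> a i j = 0.
  move=> ij; have [Mi|iM] := leqP M i; first by rewrite /a /growth_cell vG//; left.
  have [Mj|jM] := leqP M j; first by rewrite /a /growth_cell vG//; right.
  by have := a_le _ _ iM jM; case: (a i j) => // m; rewrite mulSn; lia.
have a_lt i j : a i j < K.
  have [Mi|iM] := leqP M i; first by rewrite a0; [lia|left; lia].
  have [Mj|jM] := leqP M j; first by rewrite a0; [lia|right; lia].
  by have := a_le _ _ iM jM; rewrite mulnS; lia.
pose f : {ffun 'I_N * 'I_N -> 'I_K} := 
  [ffun ij : 'I_N * 'I_N => Ordinal (a_lt ij.1 ij.2)].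
have fE i j : array_ext f i j = a i j.
  have [Ni|iN] := leqP N i; first by rewrite array_ext0 ?a0//; left.
  have [Nj|jN] := leqP N j; first by rewrite array_ext0 ?a0//; right.
  by rewrite (array_ext_ord f (Ordinal iN) (Ordinal jN)) ffunE.
have vGN : vanish N (peel p).
  move=> u v k uv; have [Mk|kM] := leqP M k; first exact: (growth_vanish M).
  have := growth_sum _ _ u v gG vG; rewrite [RHS]big_nat [RHS]big1 => [S|i iu].
    by apply/eqP; rewrite -leqn0 -S (bigD1 (Ordinal kM))//= leq_addr.
  by rewrite big_nat big1// => j jv; apply: a0; lia.
exists f.
  rewrite sum_pair -sum_a (sum_widen _ _ (fun i => \sum_(j < M) a i j * (i + j).+1) NM).
    apply: eq_bigr => i _.
    rewrite (sum_widen _ _ (fun j => a i j * (i + j).+1) NM); last first.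
      by move=> j Nj; rewrite a0//; right.
    by apply: eq_bigr => j _; rewrite ffunE.
  by move=> i Ni; rewrite big1// => j _; rewrite a0//; left.
apply/funext => j; apply/funext => k; rewrite -[RHS]unpeel_peel /array_pp /unpeel.
have E := growth_eq_cell _ _ _ (growth_outer N (array_ext f)) gG (vanish_outer _ _) vGN.
by rewrite !E// => u v; rewrite cell_array fE.
Qed.

(** For m <= N exactly m pairs (i, j) satisfy i + j + 1 = m, which is the source of the exponent -m
    of 1 - z q^m; the truncations at [N] and [K] do not affect the coefficient of order n. *)
Lemma pp_trace_gf (C : comNzRingType) (z : C) n : n <= N -> n < K ->
  (\sum_(p <- fset_set [set p | is_plane_partition n p]) z ^+ pp_trace p =
  (\prod_(ij : 'I_N * 'I_N)
     \sum_(k < K) z ^+ k *: 'X^(k * (ij.1 + ij.2).+1))`_n)%R.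
Proof.
move=> nN nK; rewrite bigA_distr_bigA coef_sum /=.
pose w (f : {ffun 'I_N * 'I_N -> 'I_K}) := \sum_(ij : 'I_N * 'I_N) f ij * (ij.1 + ij.2).+1.
have termE f : (\prod_(ij : 'I_N * 'I_N) (z ^+ f ij *: 'X^(f ij * (ij.1 + ij.2).+1)) =
    z ^+ (\sum_ij f ij) *: 'X^(w f))%R.
  rewrite scaler_prod -!expr_sum; congr (_ *: _)%R.
transitivity (\sum_(f | w f == n) z ^+ pp_trace (array_pp f))%R; last first.
  rewrite big_mkcond; apply: eq_bigr => f _.
  rewrite termE coefZ coefXn eq_sym trace_array_pp.
  by case: eqP; rewrite ?mulr1 ?mulr0.
transitivity (\sum_(p <- [seq array_pp f | f <- index_enum {ffun 'I_N * 'I_N -> 'I_K} & w f == n])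
  z ^+ pp_trace p)%R; last by rewrite big_map big_filter.
apply: perm_big; apply: uniq_perm; first exact: fset_uniq.
  rewrite map_inj_uniq ?filter_uniq ?index_enum_uniq//; exact: array_pp_inj.
move=> p; rewrite in_fset_set; last exact: finite_plane_partition.
apply/idP/mapP => [/set_mem /= ppp|[f + ->]].
  have [f fn <-] := array_pp_surj _ _ nN nK ppp; exists f => //.
  by rewrite mem_filter mem_index_enum andbT /w fn.
rewrite mem_filter => /andP[/eqP <- _]; apply/mem_set; exact: array_ppP.
Qed.

End TraceGeneratingFunction.
Set Implicit Arguments.
Unset Strict Implicit.
Unset Printing Implicit Defensive.

Local Notation nc := (@Normc.normc _).
Local Notation Re := (@complex.Re _).
Local Notation Im := (@complex.Im _).
Local Notation mu := (@lebesgue_measure _).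

(** * Complex exponential and logarithm *)

Section ComplexBasics.
Context {R : realType}.
Implicit Types (z w : R[i]) (x y : R).

Lemma complexP z w : Re z = Re w -> Im z = Im w -> z = w.
Proof. by case: z w => [a b] [c d] /= -> ->. Qed.

Lemma nc_ge0 z : 0 <= nc z.
Proof. by case: z => a b; exact: sqrtr_ge0. Qed.

Lemma nc_sqr z : nc z ^+ 2 = Re z ^+ 2 + Im z ^+ 2.
Proof. by case: z => a b /=; rewrite sqr_sqrtr// addr_ge0 ?sqr_ge0. Qed.

Lemma ReD z w : Re (z + w) = Re z + Re w. Proof. by case: z w => [? ?] []. Qed.
Lemma ImD z w : Im (z + w) = Im z + Im w. Proof. by case: z w => [? ?] []. Qed.
Lemma ReN z : Re (- z) = - Re z. Proof. by case: z. Qed.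
Lemma ImN z : Im (- z) = - Im z. Proof. by case: z. Qed.
Lemma ReB z w : Re (z - w) = Re z - Re w. Proof. by rewrite ReD ReN. Qed.
Lemma ImB z w : Im (z - w) = Im z - Im w. Proof. by rewrite ImD ImN. Qed.
Lemma ReM z w : Re (z * w) = Re z * Re w - Im z * Im w.
Proof. by case: z w => [? ?] []. Qed.
Lemma ImM z w : Im (z * w) = Re z * Im w + Im z * Re w.
Proof. by case: z w => [? ?] []. Qed.

Lemma ReV z : Re z^-1 = Re z / (Re z ^+ 2 + Im z ^+ 2).
Proof. by case: z. Qed.
Lemma ImV z : Im z^-1 = - (Im z / (Re z ^+ 2 + Im z ^+ 2)).
Proof. by case: z. Qed.
Lemma ReZ x z : Re (x%:C * z) = x * Re z.
Proof. by rewrite ReM /= mul0r subr0. Qed.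
Lemma ImZ x z : Im (x%:C * z) = x * Im z.
Proof. by rewrite ImM /= mul0r addr0. Qed.

Lemma Re_sum I (r : seq I) (P : pred I) (F : I -> R[i]) :
  Re (\sum_(i <- r | P i) F i) = \sum_(i <- r | P i) Re (F i).
Proof. by elim/big_rec2: _ => // i y1 y2 _ <-; rewrite ReD. Qed.

Lemma Im_sum I (r : seq I) (P : pred I) (F : I -> R[i]) :
  Im (\sum_(i <- r | P i) F i) = \sum_(i <- r | P i) Im (F i).
Proof. by elim/big_rec2: _ => // i y1 y2 _ <-; rewrite ImD. Qed.

Lemma real_natC n : (n%:R : R)%:C = n%:R :> R[i].
Proof. exact: rmorph_nat. Qed.

Lemma normr_Re z : `|Re z| <= nc z.
Proof. by case: z => a b /=; rewrite -sqrtr_sqr ler_wsqrtr// lerDl sqr_ge0. Qed.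

Lemma normr_Im z : `|Im z| <= nc z.
Proof. by case: z => a b /=; rewrite -sqrtr_sqr ler_wsqrtr// lerDr sqr_ge0. Qed.

Lemma Re_le z : Re z <= nc z. Proof. exact: le_trans (ler_norm _) (normr_Re z). Qed.

Lemma ncM z w : nc (z * w) = nc z * nc w. Proof. exact: Normc.normcM. Qed.
Lemma ncD z w : nc (z + w) <= nc z + nc w. Proof. exact: le_normcD. Qed.
Lemma ncN z : nc (- z) = nc z. Proof. exact: normcN. Qed.
Lemma ncB z w : nc (z - w) <= nc z + nc w. Proof. by rewrite -(ncN w) ncD. Qed.
Lemma ncC z w : nc (z - w) = nc (w - z). Proof. by rewrite -ncN opprB. Qed.
Lemma ncV z : nc z^-1 = (nc z)^-1. Proof. exact: Normc.normcV. Qed.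
Lemma nc0 : nc (0 : R[i]) = 0. Proof. exact: Normc.normc0. Qed.
Lemma nc1 : nc (1 : R[i]) = 1. Proof. exact: Normc.normc1. Qed.
Lemma nc_real x : nc x%:C = `|x|.
Proof. by rewrite /= expr0n addr0 sqrtr_sqr. Qed.
Lemma nc_nat n : nc (n%:R : R[i]) = n%:R.
Proof. by rewrite -real_natC nc_real ger0_norm. Qed.
Lemma ncX z n : nc (z ^+ n) = nc z ^+ n.
Proof. by elim: n => [|n IHn]; rewrite ?expr0 ?nc1// !exprS ncM IHn. Qed.
Lemma nc_eq0 z : (nc z == 0) = (z == 0).
Proof. by apply/eqP/eqP => [/Normc.eq0_normc//|->]; exact: nc0. Qed.
Lemma nc_gt0 z : (0 < nc z) = (z != 0).
Proof. by rewrite lt0r nc_ge0 andbT nc_eq0. Qed.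
Lemma nc_ReIm z : nc z <= `|Re z| + `|Im z|.
Proof.
rewrite -(@ler_pXn2r _ 2)// ?nnegrE ?nc_ge0 ?addr_ge0// nc_sqr sqrrD.
by rewrite !real_normK ?num_real// lerD// lerDl mulrn_wge0// mulr_ge0.
Qed.
Lemma ncB_ge z w : nc z - nc w <= nc (z - w).
Proof. by rewrite lerBlDr -{1}(subrK w z) ncD. Qed.
Lemma ncD_ge z w : nc z - nc w <= nc (z + w).
Proof. by have := ncB_ge z (- w); rewrite ncN opprK. Qed.

Lemma nc_sum I (r : seq I) (P : pred I) (F : I -> R[i]) :
  nc (\sum_(i <- r | P i) F i) <= \sum_(i <- r | P i) nc (F i).
Proof.
elim/big_rec2: _ => [|i y1 y2 _ h]; first by rewrite nc0.
by rewrite (le_trans (ncD _ _))// lerD2l.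
Qed.

Lemma cexpE z : cexp z = (expR (Re z) * cos (Im z)) +i* (expR (Re z) * sin (Im z)).
Proof. by case: z. Qed.

Lemma cexpD z w : cexp (z + w) = cexp z * cexp w.
Proof.
case: z w => [a b] [c d]; apply: complexP; rewrite /= expRD ?cosD ?sinD; ring.
Qed.

Lemma cexp0 : cexp (0 : R[i]) = 1.
Proof. by apply: complexP; rewrite /= expR0 ?cos0 ?sin0 ?mulr1 ?mulr0. Qed.

Lemma nc_cexp z : nc (cexp z) = expR (Re z).
Proof.
case: z => a b /=; rewrite !exprMn -mulrDr cos2Dsin2 mulr1.
by rewrite sqrtr_sqr ger0_norm// expR_ge0.
Qed.

Lemma cexp_neq0 z : cexp z != 0.
Proof. by rewrite -nc_eq0 nc_cexp expR_eq0. Qed.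

Lemma cexpN z : cexp (- z) = (cexp z)^-1.
Proof.
by apply: (mulfI (cexp_neq0 z)); rewrite -cexpD subrr cexp0 divff// cexp_neq0.
Qed.

Lemma cexpB z w : cexp (z - w) = cexp z / cexp w.
Proof. by rewrite cexpD cexpN. Qed.

Lemma cexpMn z n : cexp (z *+ n) = cexp z ^+ n.
Proof. by elim: n => [|n IHn]; rewrite ?mulr0n ?expr0 ?cexp0// mulrS cexpD IHn exprS. Qed.

Lemma cexpM_nat z n : cexp (n%:R * z) = cexp z ^+ n.
Proof. by rewrite mulr_natl cexpMn. Qed.

Lemma cexp_sum I (r : seq I) (P : pred I) (F : I -> R[i]) :
  cexp (\sum_(i <- r | P i) F i) = \prod_(i <- r | P i) cexp (F i).
Proof. by elim/big_rec2: _ => [|i y1 y2 _ <-]; [exact: cexp0|rewrite cexpD]. Qed.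

(** Convergence by components, so that real limit theorems apply directly; [cvgC_lim] relates it to
    the limit in [R[i]^o] used by [Li3]. *)
Definition cvgC (u : nat -> R[i]) (l : R[i]) : Prop :=
  (Re (u n) @[n --> \oo] --> Re l) /\ (Im (u n) @[n --> \oo] --> Im l).

Lemma cvgC_cst l : cvgC (fun=> l) l.
Proof. by split; exact: cvg_cst. Qed.

Lemma cvgCD u v l m : cvgC u l -> cvgC v m -> cvgC (fun n => u n + v n) (l + m).
Proof.
move=> [r1 i1] [r2 i2]; split.
  by rewrite ReD; under eq_fun do rewrite ReD; exact: cvgD.
by rewrite ImD; under eq_fun do rewrite ImD; exact: cvgD.
Qed.

Lemma cvgCN u l : cvgC u l -> cvgC (fun n => - u n) (- l).
Proof.
move=> [r1 i1]; split.
  by rewrite ReN; under eq_fun do rewrite ReN; exact: cvgN.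
by rewrite ImN; under eq_fun do rewrite ImN; exact: cvgN.
Qed.

Lemma cvgCB u v l m : cvgC u l -> cvgC v m -> cvgC (fun n => u n - v n) (l - m).
Proof. by move=> ul vm; apply: cvgCD => //; exact: cvgCN. Qed.

Lemma cvgCM u v l m : cvgC u l -> cvgC v m -> cvgC (fun n => u n * v n) (l * m).
Proof.
move=> [r1 i1] [r2 i2]; split.
  by rewrite ReM; under eq_fun do rewrite ReM; apply: cvgB; exact: cvgM.
by rewrite ImM; under eq_fun do rewrite ImM; apply: cvgD; exact: cvgM.
Qed.

Lemma cvgC_cexp u l : cvgC u l -> cvgC (fun n => cexp (u n)) (cexp l).
Proof.
move=> [r1 i1].
have e : expR (Re (u n)) @[n --> \oo] --> expR (Re l).
  by apply: continuous_cvg => //; exact: continuous_expR.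
split; rewrite cexpE /=.
  under eq_fun do rewrite cexpE /=; apply: cvgM => //.
  by apply: (continuous_cvg _ _ i1); exact: continuous_cos.
under eq_fun do rewrite cexpE /=; apply: cvgM => //.
by apply: (continuous_cvg _ _ i1); exact: continuous_sin.
Qed.

Lemma cvgC_nc u l : cvgC u l -> nc (u n) @[n --> \oo] --> nc l.
Proof.
move=> [r1 i1].
have E z : nc z = Num.sqrt (Re z ^+ 2 + Im z ^+ 2) by case: z.
rewrite E; under eq_fun do rewrite E.
apply: continuous_cvg; first exact: sqrt_continuous.
by apply: cvgD; apply: cvgM.
Qed.

Lemma cvgC_normP u l : cvgC u l <-> (nc (u n - l) @[n --> \oo] --> (0 : R)).
Proof.
split=> [ul|ul].
  have := cvgC_nc (cvgCB ul (cvgC_cst l)); by rewrite subrr nc0.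
have sq (f : nat -> R) (a : R) : (forall n, `|f n - a| <= nc (u n - l)) ->
    f n @[n --> \oo] --> a.
  move=> fa; apply/subr_cvg0; apply: norm_cvg0.
  apply: (@squeeze_cvgr _ _ _ _ (cst 0) _ _ _ _ _ ul); last exact: cvg_cst.
  by apply: nearW => n /=; rewrite normr_ge0 fa.
by split; apply: sq => n; rewrite -?ReB -?ImB ?normr_Re ?normr_Im.
Qed.

Lemma cvgC_le u l M : cvgC u l -> (\forall n \near \oo, nc (u n) <= M) -> nc l <= M.
Proof.
move=> /cvgC_nc ul uM; rewrite -(cvg_lim (@Rhausdorff R) ul).
by apply: limr_le => //; apply/cvg_ex; exists (nc l).
Qed.

Lemma cvgC_shift u l : cvgC (fun n => u n.+1) l <-> cvgC u l.
Proof.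
by split=> -[r i]; split; [rewrite -cvg_shiftS|rewrite -cvg_shiftS|
  rewrite (cvg_shiftS (fun n => Re (u n)))|rewrite (cvg_shiftS (fun n => Im (u n)))].
Qed.

Definition csum (u : nat -> R[i]) : R[i] :=
  limn (fun n => \sum_(k < n) Re (u k)) +i* limn (fun n => \sum_(k < n) Im (u k)).

Lemma csum_cvg u (v : nat -> R) M : (forall k, nc (u k) <= v k) ->
  (forall n, \sum_(k < n) v k <= M) -> cvgC (fun n => \sum_(k < n) u k) (csum u).
Proof.
move=> uv vM.
have v0 k : 0 <= v k by exact: le_trans (nc_ge0 _) (uv k).
have cv : cvgn (series v).
  apply: nondecreasing_is_cvgn.
    apply/nondecreasing_seqP => n; rewrite /series /= big_nat_recr//=.
    by rewrite lerDl.
  by exists M => _ [n _ <-]; rewrite /series /= big_mkord.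
have cf (f : nat -> R) : (forall k, `|f k| <= v k) ->
    \sum_(k < n) f k @[n --> \oo] --> limn (fun n => \sum_(k < n) f k).
  move=> fv; have : cvgn (series f).
    by apply: normed_cvg; apply: (series_le_cvg _ v0 fv cv) => k; exact: normr_ge0.
  suff -> : (fun n => \sum_(k < n) f k) = series f by [].
  by apply/funext => n; rewrite /series /= big_mkord.
split; rewrite /csum /=.
  under eq_fun do rewrite Re_sum; apply: (cf (fun k => Re (u k))) => k.
  exact: le_trans (normr_Re _) (uv k).
under eq_fun do rewrite Im_sum; apply: (cf (fun k => Im (u k))) => k.
exact: le_trans (normr_Im _) (uv k).
Qed.

Lemma csum_le u (v : nat -> R) M : (forall k, nc (u k) <= v k) ->
  (forall n, \sum_(k < n) v k <= M) -> nc (csum u) <= M.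
Proof.
move=> uv vM; apply: (cvgC_le (csum_cvg uv vM)); apply: nearW => n.
by apply: le_trans (nc_sum _ _ _) _; apply: le_trans (vM n); exact: ler_sum.
Qed.

End ComplexBasics.

(** * The logarithm series up to the unit circle *)

Section LogSeries.
Context {R : realType}.
Implicit Types (z w : R[i]) (x y : R).

(** The mean value theorem applied to [G - f] and to [G + f]. *)
Lemma norm_diff_le (f df G dG : R -> R) a b : a <= b ->
  (forall x, a <= x <= b -> is_derive x 1 f (df x)) ->
  (forall x, a <= x <= b -> is_derive x 1 G (dG x)) ->
  (forall x, a <= x <= b -> `|df x| <= dG x) ->
  `|f b - f a| <= G b - G a.
Proof.
rewrite le_eqVlt => /predU1P[->|ab] Df DG dfG; first by rewrite !subrr normr0.
have oc x : x \in `]a, b[ -> a <= x <= b.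
  by rewrite in_itv /= => /andP[/ltW -> /ltW ->].
have key (s : R) : s = 1 \/ s = -1 -> s * (f b - f a) <= G b - G a.
  move=> s1.
  have Dh x : a <= x <= b -> is_derive x 1 (fun x => G x - s * f x) (dG x - s * df x).
    move=> xab; have ? := Df x xab; have ? := DG x xab; apply: is_derive_eq.
    by rewrite /GRing.scale /=.
  have [||c /oc cab E] := @MVT R (fun x => G x - s * f x) (fun x => dG x - s * df x) a b ab.
  - by move=> x /oc; exact: Dh.
  - apply: derivable_within_continuous => x; rewrite in_itv /= => xab.
    by have [] := Dh x xab.
  have : 0 <= (dG c - s * df c) * (b - a).
    apply: mulr_ge0; last by rewrite subr_ge0 ltW.
    have := dfG c cab; rewrite ler_norml subr_ge0 => /andP[? ?].
    by case: s1 => ->; lra.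
  by rewrite -E; lra.
rewrite ler_norml; have := key 1 (or_introl erefl); have := key (-1) (or_intror erefl).
by rewrite mulN1r mul1r => ? ?; apply/andP; split; lra.
Qed.

Definition derivC (f : R -> R[i]) (x : R) (d : R[i]) : Prop :=
  is_derive x 1 (fun r => Re (f r)) (Re d) /\ is_derive x 1 (fun r => Im (f r)) (Im d).

(** The factor 2 comes from bounding the real and imaginary parts separately. *)
Lemma nc_diff_le (f df : R -> R[i]) (G dG : R -> R) a b : a <= b ->
  (forall x, a <= x <= b -> derivC f x (df x)) ->
  (forall x, a <= x <= b -> is_derive x 1 G (dG x)) ->
  (forall x, a <= x <= b -> nc (df x) <= dG x) ->
  nc (f b - f a) <= 2 * (G b - G a).
Proof.
move=> ab Df DG dfG; apply: (le_trans (nc_ReIm _)); rewrite mulr2n mulrDl !mul1r.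
rewrite ReB ImB; apply: lerD.
  apply: (@norm_diff_le (fun r => Re (f r)) (fun r => Re (df r)) G dG a b ab) => // x xab.
    by have [] := Df x xab.
  exact: le_trans (normr_Re _) (dfG x xab).
apply: (@norm_diff_le (fun r => Im (f r)) (fun r => Im (df r)) G dG a b ab) => // x xab.
  by have [] := Df x xab.
exact: le_trans (normr_Im _) (dfG x xab).
Qed.

Lemma derivCD f g x d e : derivC f x d -> derivC g x e ->
  derivC (fun r => f r + g r) x (d + e).
Proof.
move=> [? ?] [? ?]; split; rewrite ?ReD ?ImD.
  by under eq_fun do rewrite ReD; exact: is_deriveD.
by under eq_fun do rewrite ImD; exact: is_deriveD.
Qed.

Lemma derivC_sum f d x n : (forall k, (k < n)%N -> derivC (f k) x (d k)) ->
  derivC (fun r => \sum_(k < n) f k r) x (\sum_(k < n) d k).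
Proof.
elim: n => [|n IHn] D.
  by under eq_fun do rewrite big_ord0; rewrite big_ord0; split; exact: is_derive_cst.
under eq_fun do rewrite big_ord_recr /=; rewrite big_ord_recr /=.
by apply: derivCD; [apply: IHn => k kn; apply: D; exact: ltnW|exact: D].
Qed.

Lemma derivC_real (f : R -> R) df x z : is_derive x 1 f df ->
  derivC (fun r => (f r)%:C * z) x (df%:C * z).
Proof.
move=> D; split; rewrite ?ReZ ?ImZ.
  by under eq_fun do rewrite ReZ mulrC; apply: is_derive_eq; rewrite mulrC.
by under eq_fun do rewrite ImZ mulrC; apply: is_derive_eq; rewrite mulrC.
Qed.

Lemma derivC_cexp z x : derivC (fun r => cexp (r%:C * z)) x (z * cexp (x%:C * z)).
Proof.
split; rewrite ?ReM ?ImM cexpE /= !(ReZ, ImZ).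
  under eq_fun do rewrite cexpE /= ReZ ImZ.
  apply: is_derive_eq; rewrite /GRing.scale /=; ring.
under eq_fun do rewrite cexpE /= ReZ ImZ.
apply: is_derive_eq; rewrite /GRing.scale /=; ring.
Qed.

Lemma is_derive_mulr c x : is_derive x 1 (fun r : R => r * c) c.
Proof.
have D := is_deriveM (is_derive_id x 1) (is_derive_cst c x 1).
by apply: (is_derive_eq D); rewrite /GRing.scale /= mulr1 mulr0 add0r.
Qed.

Lemma is_derive_pow c k x :
  is_derive x 1 (fun r : R => c * (r ^+ k.+1 / k.+1%:R)) (c * x ^+ k).
Proof.
have D : is_derive x 1 (fun r : R => r ^+ k.+1) (k.+1%:R * x ^+ k).
  have -> : (fun r : R => r ^+ k.+1) = (id : R -> R) ^+ k.+1.
    by apply/funext => t; rewrite exprfctE.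
  by apply: is_derive_eq; rewrite /GRing.scale /= mulr1.
have D2 := is_deriveZ (c / k.+1%:R) D.
have -> : (fun r : R => c * (r ^+ k.+1 / k.+1%:R)) =
    (fun r => (c / k.+1%:R) *: (r ^+ k.+1)).
  by apply/funext => t; rewrite /GRing.scale /=; ring.
apply: (is_derive_eq D2); rewrite /GRing.scale /=.
by field; rewrite addrC natr1 pnatr_eq0.
Qed.

Lemma nc_cexp_sub1 z : Re z <= 0 -> nc (cexp z - 1) <= 2 * nc z.
Proof.
move=> z0; have := @nc_diff_le (fun r => cexp (r%:C * z)) (fun r => z * cexp (r%:C * z))
  (fun r => r * nc z) (fun r => nc z) 0 1 ler01.
rewrite !mul1r mul0r cexp0 mul0r subr0; apply.
- by move=> x _; exact: derivC_cexp.
- by move=> x _; exact: is_derive_mulr.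
- move=> x /andP[x0 _]; rewrite ncM nc_cexp ReZ ler_piMr ?nc_ge0//.
  by rewrite expR_le1 mulr_ge0_le0.
Qed.

Lemma nc_cexp_sub2 z : Re z <= 0 -> nc (cexp z - 1 - z) <= 4 * nc z ^+ 2.
Proof.
move=> z0.
have -> : 4 * nc z ^+ 2 = 2 * (1 * (2 * nc z ^+ 2) - 0 * (2 * nc z ^+ 2)) by ring.
have -> : cexp z - 1 - z =
    cexp (1%:C * z) + (- 1)%:C * z - (cexp (0%:C * z) + (- 0)%:C * z).
  by rewrite oppr0 !mul0r cexp0 mul1r rmorphN; ring.
apply: (@nc_diff_le (fun r => cexp (r%:C * z) + (- r)%:C * z)
  (fun r => z * cexp (r%:C * z) + (-1)%:C * z)
  (fun r => r * (2 * nc z ^+ 2)) (fun r => 2 * nc z ^+ 2) 0 1 ler01).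
- move=> x _; apply: derivCD; first exact: derivC_cexp.
  by apply: derivC_real; apply: is_derive_eq.
- by move=> x _; exact: is_derive_mulr.
- move=> x /andP[x0 x1].
  have -> : z * cexp (x%:C * z) + (-1)%:C * z = z * (cexp (x%:C * z) - 1).
    by rewrite rmorphN; ring.
  rewrite ncM expr2 mulrCA.
  rewrite ler_wpM2l ?nc_ge0//; apply: le_trans (nc_cexp_sub1 _) _.
    by rewrite ReZ mulr_ge0_le0.
  by rewrite ler_wpM2l// ncM nc_real ger0_norm// ler_piMl ?nc_ge0.
Qed.

Lemma clogE z : z != 0 -> Re z = nc z * cos (carg z) /\ Im z = nc z * sin (carg z).
Proof.
move=> z0; have := clogK z0; rewrite /clog cexpE /= lnK ?posrE ?nc_gt0// => E.
by split; rewrite -{1}E.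
Qed.

Lemma carg_atan z : 0 < Re z -> carg z = atan (Im z / Re z).
Proof.
move=> rz; have z0 : z != 0 by apply: contraTneq rz => ->; rewrite ltxx.
have [ReE ImE] := clogE z0; have /andP[a1 a2] := carg_itv z.
have nz : 0 < nc z by rewrite nc_gt0.
have c0 : 0 < cos (carg z) by move: rz; rewrite ReE pmulr_rgt0.
have bd : carg z \in `](- (pi / 2)), (pi / 2)[.
  have H (t : R) : 0 <= t <= pi -> 0 < cos t -> t < pi / 2.
    move=> tpi ct; have p0 := pi_gt0 R.
    rewrite -ltr_cos ?cos_pihalf//; rewrite in_itv /= ?tpi//.
    by apply/andP; split; lra.
  rewrite in_itv /=; have [c|c] := leP 0 (carg z).
    by rewrite H ?c//; have p0 := pi_gt0 R; rewrite andbT; lra.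
  rewrite ltrNl H ?cosN//; last by apply/andP; split; lra.
  by have p0 := pi_gt0 R; lra.
rewrite -[LHS](tanK bd); congr atan; rewrite /tan ReE ImE.
by rewrite -mulf_div divff ?mul1r// gt_eqF.
Qed.

(** In the right half-plane the principal argument is an arctangent, so both components have
    elementary derivatives. *)
Lemma derivC_clog z x : 0 < Re (1 - x%:C * z) ->
  derivC (fun r => clog (1 - r%:C * z)) x (- z / (1 - x%:C * z)).
Proof.
case: z => a b; set w := 1 - _ => rw.
have wE r : 1 - r%:C * (a +i* b) = (1 - r * a) +i* (- (r * b)).
  by apply: complexP; rewrite /= ?mul0r ?subr0 ?addr0 ?sub0r ?add0r; ring.
have {rw}rw : 0 < 1 - x * a by move: rw; rewrite /w wE.
have s0 : 0 < (1 - x * a) ^+ 2 + (x * b) ^+ 2 by rewrite ltr_wpDr ?sqr_ge0// exprn_gt0.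
have near_pos : \forall r \near x, 0 < 1 - r * a.
  have : 1 - r * a @[r --> x] --> 1 - x * a.
    by apply: cvgB; [exact: cvg_cst|apply: cvgM; [exact: cvg_id|exact: cvg_cst]].
  by move/cvgr_gt; exact.
have near_s r : 0 < 1 - r * a -> 0 < (1 - r * a) ^+ 2 + (r * b) ^+ 2.
  by move=> ra; rewrite ltr_wpDr ?sqr_ge0// exprn_gt0.
have Da : is_derive x 1 (fun r : R => 1 - r * a) (- a).
  have D := is_deriveB (is_derive_cst (1 : R) x 1) (is_derive_mulr a x).
  by apply: (is_derive_eq D); rewrite sub0r.
have Db := is_derive_mulr b x.
split.
  have D : is_derive x 1 (fun r => 2^-1 * ln ((1 - r * a) ^+ 2 + (r * b) ^+ 2))
      (Re (- (a +i* b) / w)).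
    have Ds : is_derive x 1 (fun r => (1 - r * a) ^+ 2 + (r * b) ^+ 2)
        ((2 * (1 - x * a)) * (- a) + (2 * (x * b)) * b).
      by apply: is_derive_eq; rewrite /GRing.scale /=; ring.
    have Dl := @is_derive1_comp R (@ln R) _ x _ _ (is_derive1_ln s0) Ds.
    have D := is_deriveZ 2^-1 Dl.
    apply: (is_derive_eq D); rewrite /w wE ReM ReV ImV /GRing.scale /=; field.
    by rewrite sqrrN gt_eqF.
  apply: near_eq_is_derive D.
  near=> r; rewrite wE /clog /= sqrrN -powR12_sqrt; last first.
    by rewrite addr_ge0 ?sqr_ge0.
  by rewrite ln_powR.
have D : is_derive x 1 (fun r => atan (- (r * b) / (1 - r * a))) (Im (- (a +i* b) / w)).
  have DV := @is_deriveV R (fun r => 1 - r * a) x _ _ (lt0r_neq0 rw) Da.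
  have Dq := is_deriveM (is_deriveN Db) DV.
  have Dat := @is_derive1_comp R (@atan R) _ x _ _ (is_derive1_atan (- (x * b) / (1 - x * a))) Dq.
  apply: (is_derive_eq Dat); rewrite /w wE ImM ReV ImV /GRing.scale /=.
  rewrite [(- _ : R -> R) x](_ : _ = - (x * b))//; field.
  by rewrite sqrrN !gt_eqF// addrC.
apply: near_eq_is_derive D.
near=> r; rewrite wE /clog /= carg_atan//=.
by near: r.
Unshelve. all: by end_near.
Qed.

(** Along the segment from 0 to z the error has the derivative -r^K z^(K+1) / (1 - r z), a single
    term; its bound M r^K integrates to M / (K+1). This stays valid on the unit circle, where the
    series need not converge absolutely. *)
Lemma nc_log_series (z : R[i]) M K : nc z <= 1 -> z != 1 ->
  (forall r : R, 0 <= r <= 1 -> 1 <= M * nc (1 - r%:C * z)) ->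
  nc (clog (1 - z) + \sum_(k < K) z ^+ k.+1 / k.+1%:R) <= 2 * (M / K.+1%:R).
Proof.
move=> z1 zn1 HM.
have pos r : 0 <= r <= 1 -> 0 < Re (1 - r%:C * z).
  move=> /andP[r0 r1]; rewrite ReB ReZ /= subr_gt0.
  have [rz|rz] := leP (Re z) 0; first by rewrite (le_lt_trans _ ltr01)// mulr_ge0_le0.
  have Rz1 : Re z <= 1 by exact: le_trans (Re_le z) z1.
  have [r1'|r1'] := ltP r 1.
    by rewrite (le_lt_trans _ r1')// ler_piMr.
  have -> : r = 1 by apply/eqP; rewrite eq_le r1 r1'.
  rewrite mul1r lt_neqAle Rz1 andbT; apply: contraNneq zn1 => Rz.
  have : nc z ^+ 2 <= 1 by rewrite exprn_ile1// nc_ge0.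
  rewrite nc_sqr Rz expr1n gerDl => /(conj (sqr_ge0 (Im z)))/andP.
  rewrite -eq_le eq_sym sqrf_eq0 => /eqP Iz.
  by apply/eqP; apply: complexP.
pose f (r : R) := clog (1 - r%:C * z) + \sum_(k < K) (r ^+ k.+1 / k.+1%:R)%:C * z ^+ k.+1.
pose df (r : R) := - z / (1 - r%:C * z) + \sum_(k < K) (r ^+ k)%:C * z ^+ k.+1.
have Df r : 0 <= r <= 1 -> derivC f r (df r).
  move=> r01; apply: derivCD; first exact/derivC_clog/pos.
  apply: (@derivC_sum (fun k r => (r ^+ k.+1 / k.+1%:R)%:C * z ^+ k.+1)
    (fun k => (r ^+ k)%:C * z ^+ k.+1)) => k _.
  apply: derivC_real.
  have := is_derive_pow 1 k r; rewrite mul1r.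
  by under eq_fun do rewrite mul1r.
have dfE r : 0 <= r <= 1 -> df r = - (r ^+ K)%:C * z ^+ K.+1 / (1 - r%:C * z).
  move=> r01; have w0 : 1 - r%:C * z != 0.
    by apply: contraTneq (pos r r01) => ->; rewrite ltxx.
  rewrite /df; elim: K {f df Df} => [|K IHK].
    by rewrite big_ord0 addr0 expr0 expr1 rmorph1 mulN1r.
  rewrite big_ord_recr /= addrA IHK !exprS !rmorphM /=; field.
  exact: w0.
have := @nc_diff_le f df (fun r => M * (r ^+ K.+1 / K.+1%:R)) (fun r => M * r ^+ K) 0 1 ler01 Df.
have -> : f 1 = clog (1 - z) + \sum_(k < K) z ^+ k.+1 / k.+1%:R.
  rewrite /f mul1r; congr (_ + _); apply: eq_bigr => k _.
  by rewrite expr1n mul1r mulrC -real_natC -fmorphV.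
have -> : f 0 = 0.
  rewrite /f mul0r subr0 big1 ?addr0 => [|k _]; last by rewrite expr0n /= mul0r mul0r.
  rewrite /clog nc1 ln1 carg_atan ?ltr01//=.
  by rewrite mul0r atan0.
rewrite expr1n expr0n /= mul0r mulr0 !subr0 mul1r; apply.
  by move=> r _; exact: is_derive_pow.
move=> r r01; have /andP[r0 r1] := r01.
rewrite dfE// !ncM ncN ncV nc_real ncX ger0_norm ?exprn_ge0//.
rewrite ler_pdivrMr ?nc_gt0; last first.
  by apply: contraTneq (pos r r01) => ->; rewrite ltxx.
have zK : nc z ^+ K.+1 <= 1 by rewrite exprn_ile1// nc_ge0.
rewrite mulrAC (le_trans (_ : _ <= r ^+ K))//; first by rewrite ler_piMr// exprn_ge0.
by rewrite ler_peMl ?exprn_ge0// HM.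
Qed.

Lemma log_series_cst z : nc z <= 1 -> z != 1 ->
  exists2 M : R, 0 < M & forall r : R, 0 <= r <= 1 -> 1 <= M * nc (1 - r%:C * z).
Proof.
move=> z1 zn1.
pose d := 1 - Re z; have d0 : 0 < d.
  rewrite subr_gt0 lt_neqAle (le_trans (Re_le z) z1) andbT.
  apply: contraNneq zn1 => Rz.
  have : nc z ^+ 2 <= 1 by rewrite exprn_ile1// nc_ge0.
  rewrite nc_sqr Rz expr1n gerDl => /(conj (sqr_ge0 (Im z)))/andP.
  rewrite -eq_le eq_sym sqrf_eq0 => /eqP Iz.
  by apply/eqP; apply: complexP.
have d2 : d <= 2.
  have := normr_Re z; rewrite ler_norml => /andP[h _]; rewrite /d; lra.
(* For r <= 1/2 the modulus of 1 - r z is at least 1/2; for larger r its real part is at least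
   d/2. *)
pose m := Num.min (d / 2) (1 / 2).
have m0 : 0 < m by rewrite lt_min divr_gt0//= divr_gt0.
exists m^-1; first by rewrite invr_gt0.
move=> r /andP[r0 r1]; rewrite mulrC ler_pdivlMr// mul1r.
have [rh|rh] := leP r (1 / 2).
  apply: (@le_trans _ _ (1 / 2)); first by rewrite /m ge_min lexx orbT.
  have := ncB_ge 1 (r%:C * z); rewrite nc1 ncM nc_real ger0_norm// => h.
  have : r * nc z <= r by rewrite ler_piMr.
  lra.
apply: (@le_trans _ _ (d / 2)); first by rewrite /m ge_min lexx.
apply: le_trans (Re_le _); rewrite ReB ReZ /=.
have := Re_le z; rewrite /d; nra.
Qed.

End LogSeries.

(** * The logarithm of the generating function near a real point *)

Section Kernel.
Context {R : realType}.
Implicit Types (z w x y : R[i]) (r : R).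

Lemma cvgCV (u : nat -> R[i]) l : l != 0 -> cvgC u l -> cvgC (fun n => (u n)^-1) l^-1.
Proof.
move=> l0 [r i].
have s0 : Re l ^+ 2 + Im l ^+ 2 != 0 by rewrite -nc_sqr sqrf_eq0 nc_eq0.
have cs : (Re (u n) ^+ 2 + Im (u n) ^+ 2)^-1 @[n --> \oo] --> (Re l ^+ 2 + Im l ^+ 2)^-1.
  by apply: cvgV => //; apply: cvgD; apply: cvgM.
split; first by rewrite ReV; under eq_fun do rewrite ReV; exact: cvgM.
by rewrite ImV; under eq_fun do rewrite ImV; apply: cvgN; exact: cvgM.
Qed.

Lemma cvgC_squeeze (u : nat -> R[i]) l (e : nat -> R) :
  (forall n, nc (u n - l) <= e n) -> e n @[n --> \oo] --> (0 : R) -> cvgC u l.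
Proof.
move=> ue e0; apply/cvgC_normP.
apply: (@squeeze_cvgr _ _ _ _ (cst 0) _ _ _ _ _ e0); last exact: cvg_cst.
by apply: nearW => n /=; rewrite nc_ge0 ue.
Qed.

(** The sum of m e^{-m x} over m >= 1, so that the logarithm of the product is the sum of z^k/k h(k
    x) over k >= 1. *)
Definition hkern x : R[i] := cexp (- x) / (1 - cexp (- x)) ^+ 2.

(** The defect in the relation [hkern_double], where it is taken at w = e^{-x/2}. *)
Definition pkern w : R[i] := w / (1 + w) ^+ 2.

Definition in_cone (C : R) x := 0 <= Re x /\ `|Im x| <= C * Re x.

Lemma in_coneZ C x r : 0 <= r -> in_cone C x -> in_cone C (r%:C * x).
Proof.
move=> r0 [x0 x1]; split; rewrite ReZ ?ImZ ?mulr_ge0// normrM ger0_norm//.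
by rewrite mulrCA ler_wpM2l.
Qed.

(** The zeros of 1 + e^{-x} are the odd multiples of i pi and lie outside the cone: either |Im x| <=
    pi/2 and the cosine is nonnegative, or Re x > pi/(2C) and the exponential has modulus at most
    [e]. *)
Lemma cone_lower C : 0 < C ->
  exists2 c : R, 0 < c & forall x, in_cone C x -> c <= nc (1 + cexp (- x)).
Proof.
move=> C0; pose e : R := expR (- (pi / 2 / C)).
have p0 := pi_gt0 R.
have e1 : e < 1 by rewrite expR_lt1 oppr_lt0 !divr_gt0.
exists (1 - e); first by rewrite subr_gt0.
move=> x [x0 xC]; have [small|large] := leP `|Im x| (pi / 2).
  apply: le_trans (Re_le _); rewrite ReD cexpE /= ReN ImN cosN.
  have c0 : 0 <= cos (Im x).
    by apply: cos_ge0_pihalf; move: small; rewrite ler_norml.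
  have := mulr_ge0 (expR_ge0 (- Re x)) c0; have := expR_ge0 (- (pi / 2 / C)).
  rewrite /e; lra.
have := ncD_ge 1 (cexp (- x)); rewrite nc1 nc_cexp ReN; apply: le_trans.
rewrite lerD2l lerN2 ler_expR lerN2 ler_pdivrMr// mulrC.
by move: large xC; rewrite mulrC [C * _]mulrC => h1 h2; exact: ltW (lt_le_trans h1 h2).
Qed.

Lemma pkern_diff c w w' : 0 < c -> c <= nc (1 + w) -> c <= nc (1 + w') ->
  nc w <= 1 -> nc w' <= 1 ->
  nc (pkern w - pkern w') <= 2 / c ^+ 4 * nc (w - w').
Proof.
move=> c0 cw cw' w1 w1'.
have p0 := lt_le_trans c0 cw; have p0' := lt_le_trans c0 cw'.
have n0 : 1 + w != 0 by rewrite -nc_gt0.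
have n0' : 1 + w' != 0 by rewrite -nc_gt0.
have -> : pkern w - pkern w' =
    (w - w') * (1 - w * w') / ((1 + w) ^+ 2 * (1 + w') ^+ 2).
  by rewrite /pkern; field; rewrite n0 n0'.
rewrite !ncM ncV ncM !ncX [leRHS]mulrC -mulrA ler_wpM2l ?nc_ge0//.
apply: ler_pM; rewrite ?nc_ge0 ?invr_ge0 ?mulr_ge0 ?exprn_ge0 ?nc_ge0//.
  apply: le_trans (ncB _ _) _; rewrite nc1 ncM.
  by have : nc w * nc w' <= 1 by [rewrite mulr_ile1 ?nc_ge0//]; lra.
rewrite lef_pV2 ?posrE ?mulr_gt0 ?exprn_gt0//.
rewrite (_ : c ^+ 4 = c ^+ 2 * c ^+ 2); last by ring.
by apply: ler_pM; rewrite ?exprn_ge0 ?(ltW c0)// lerXn2r ?nnegrE ?nc_ge0 ?(ltW c0).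
Qed.

Lemma pkern_le c w : 0 < c -> c <= nc (1 + w) -> nc w <= 1 -> nc (pkern w) <= 1 / c ^+ 2.
Proof.
move=> c0 cw w1; have p0 := lt_le_trans c0 cw; rewrite /pkern ncM ncV ncX; apply: ler_pM; rewrite ?nc_ge0 ?invr_ge0 ?exprn_ge0 ?nc_ge0//.
rewrite lef_pV2 ?posrE ?exprn_gt0//.
by rewrite lerXn2r ?nnegrE ?nc_ge0 ?(ltW c0).
Qed.

Lemma sum_geo (q : R) J : (1 - q) * \sum_(j < J) q ^+ j.+1 = q - q ^+ J.+1.
Proof.
elim: J => [|J IHJ]; first by rewrite big_ord0 mulr0 expr1 subrr.
by rewrite big_ord_recr /= mulrDr IHJ [q ^+ J.+2]exprS; ring.
Qed.

Lemma sum_geo_le (q : R) J : 0 <= q <= 1 / 2 -> \sum_(j < J) q ^+ j.+1 <= 1.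
Proof.
move=> /andP[q0 q1]; have := sum_geo q J; have := exprn_ge0 J.+1 q0.
have : 0 <= \sum_(j < J) q ^+ j.+1 by apply: sumr_ge0 => j _; exact: exprn_ge0.
nra.
Qed.

(** Partial sums of the series obtained by iterating [hkern_double]; they converge to [gkern], and
    the bounds on [gkern] are limits of bounds on them that are uniform in [J]. *)
Definition gpart (J : nat) x : R[i] :=
  - \sum_(j < J) ((1 / 4) ^+ j.+1)%:C * pkern (cexp (- (((1 / 2) ^+ j.+1)%:C * x))).

Lemma nc_cexp_cone C x : in_cone C x -> nc (cexp (- x)) <= 1.
Proof. by move=> [x0 _]; rewrite nc_cexp ReN expR_le1 oppr_le0. Qed.

Lemma gpart_le C c J x : 0 < c -> (forall x, in_cone C x -> c <= nc (1 + cexp (- x))) ->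
  in_cone C x -> nc (gpart J x) <= 1 / c ^+ 2.
Proof.
move=> c0 Hc xC; rewrite /gpart ncN; apply: le_trans (nc_sum _ _ _) _.
apply: (@le_trans _ _ (\sum_(j < J) (1 / 4) ^+ j.+1 * (1 / c ^+ 2))).
  apply: ler_sum => j _.
  have xj : in_cone C (((1 / 2) ^+ j.+1)%:C * x) by apply: in_coneZ => //; exact: exprn_ge0.
  rewrite ncM nc_real ger0_norm ?exprn_ge0//.
  by rewrite ler_wpM2l ?exprn_ge0// pkern_le//; [exact: Hc|exact: nc_cexp_cone xj].
rewrite -mulr_suml ler_piMl ?divr_ge0 ?exprn_ge0 ?(ltW c0)// sum_geo_le//; lra.
Qed.

Lemma nc_cexp_diff x y : Re y <= Re x ->
  nc (cexp (- x) - cexp (- y)) <= 2 * nc (x - y) * expR (- Re y).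
Proof.
move=> yx; have -> : cexp (- x) - cexp (- y) = (cexp (- (x - y)) - 1) * cexp (- y).
  by rewrite mulrBl mul1r -cexpD; congr (cexp _ - _); ring.
rewrite ncM nc_cexp ReN ler_wpM2r ?expR_ge0// -(ncN (x - y)) nc_cexp_sub1//.
by rewrite ReN ReB oppr_le0 subr_ge0.
Qed.

(** The second bound, a decay in Re y, comes from s e^{-s} <= 1 with s = Re y / 2^(j+1).
    [Tsum_major] uses the first for the early differences and the second for the tail. *)
Lemma gpart_diff C c J x y : 0 < c -> (forall x, in_cone C x -> c <= nc (1 + cexp (- x))) ->
  in_cone C x -> in_cone C y -> Re y <= Re x ->
  nc (gpart J x - gpart J y) <= 4 / c ^+ 4 * nc (x - y) /\
  Re y * nc (gpart J x - gpart J y) <= 4 / c ^+ 4 * nc (x - y).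
Proof.
move=> c0 Hc xC yC yx.
have h0 j : 0 <= (1 / 2 : R) ^+ j by rewrite exprn_ge0.
have q0 j : 0 <= (1 / 4 : R) ^+ j by rewrite exprn_ge0.
have D0 : 0 <= 4 / c ^+ 4 * nc (x - y) by rewrite mulr_ge0 ?nc_ge0// divr_ge0// exprn_ge0// ltW.
have step : nc (gpart J x - gpart J y) <= \sum_(j < J) (4 / c ^+ 4 * nc (x - y)) *
    ((1 / 4) ^+ j.+1 * ((1 / 2) ^+ j.+1 * expR (- ((1 / 2) ^+ j.+1 * Re y)))).
  rewrite /gpart opprK addrC -sumrB; apply: le_trans (nc_sum _ _ _) _.
  apply: ler_sum => j _; rewrite -mulrBr ncM nc_real ger0_norm// mulrCA ler_wpM2l// [leLHS]ncC.
  have xj := in_coneZ (h0 j.+1) xC; have yj := in_coneZ (h0 j.+1) yC.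
  apply: le_trans (pkern_diff c0 (Hc _ xj) (Hc _ yj) (nc_cexp_cone xj) (nc_cexp_cone yj)) _.
  have := @nc_cexp_diff (((1 / 2) ^+ j.+1)%:C * x) (((1 / 2) ^+ j.+1)%:C * y).
  rewrite !ReZ ler_wpM2l// => /(_ isT).
  rewrite -mulrBr ncM nc_real ger0_norm// => H.
  apply: (@le_trans _ _ (2 / c ^+ 4 * (2 * ((1 / 2) ^+ j.+1 * nc (x - y)) * expR (- ((1 / 2) ^+ j.+1 * Re y))))).
    by rewrite ler_wpM2l// divr_ge0// exprn_ge0// ltW.
  by rewrite le_eqVlt; apply/orP; left; apply/eqP; ring.
split.
  apply: le_trans step _; rewrite -mulr_sumr ler_piMr//.
  apply: (@le_trans _ _ (\sum_(j < J) (1 / 4) ^+ j.+1)); last by apply: sum_geo_le; lra.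
  apply: ler_sum => j _; rewrite ler_piMr// mulr_ile1 ?expR_ge0//.
    by rewrite exprn_ile1//; lra.
  by rewrite expR_le1 oppr_le0 mulr_ge0//; case: yC.
have Ry : 0 <= Re y by case: yC.
apply: le_trans (ler_wpM2l Ry step) _.
rewrite -mulr_sumr mulrCA ler_piMr// mulr_sumr.
apply: (@le_trans _ _ (\sum_(j < J) (1 / 4) ^+ j.+1)); last by apply: sum_geo_le; lra.
apply: ler_sum => j _; rewrite mulrCA ler_piMr// mulrA [Re y * _]mulrC.
have := expR_gt1Dx; have := expR_ge1Dx ((1 / 2) ^+ j.+1 * Re y).
rewrite expRN => H _; rewrite ler_pdivrMr ?expR_gt0//.
by move: H; rewrite div1r; lra.
Qed.

Lemma half_C : (1 / 2 : R)%:C = 2^-1 :> R[i].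
Proof. by rewrite mul1r -(real_natC 2) -fmorphV. Qed.

Lemma quarter_C : (1 / 4 : R)%:C = 4^-1 :> R[i].
Proof. by rewrite mul1r -(real_natC 4) -fmorphV. Qed.

Lemma hkern_double x : 0 < Re x ->
  hkern x = (1 / 4)%:C * (hkern ((1 / 2)%:C * x) - pkern (cexp (- ((1 / 2)%:C * x)))).
Proof.
move=> x0; set w := cexp (- ((1 / 2)%:C * x)).
have wE : cexp (- x) = w ^+ 2.
  by rewrite /w -cexpMn; congr cexp; rewrite half_C; field.
have w1 : nc w < 1.
  by rewrite /w nc_cexp ReN ReZ expR_lt1 oppr_lt0 mulr_gt0.
rewrite /hkern /pkern wE -/w.
have n1 : 1 - w != 0.
  by rewrite subr_eq0; apply: contraTneq w1 => <-; rewrite nc1 ltxx.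
have n2 : 1 + w != 0.
  by rewrite addrC addr_eq0; apply: contraTneq w1 => ->; rewrite ncN nc1 ltxx.
have n3 : 1 - w ^+ 2 != 0.
  by rewrite -{1}(expr1n _ 2) subr_sqr mulf_neq0.
by rewrite quarter_C; field; rewrite n1 n2 n3.
Qed.

Lemma hkern_iter J x : 0 < Re x ->
  hkern x = ((1 / 4) ^+ J)%:C * hkern (((1 / 2) ^+ J)%:C * x) + gpart J x.
Proof.
move=> x0; elim: J => [|J IHJ].
  by rewrite /gpart big_ord0 oppr0 addr0 !expr0 !mul1r.
have xJ : 0 < Re (((1 / 2) ^+ J)%:C * x) by rewrite ReZ mulr_gt0// exprn_gt0// divr_gt0.
have E4 : ((1 / 4) ^+ J.+1)%:C = ((1 / 4) ^+ J)%:C * (1 / 4)%:C :> R[i].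
  by rewrite -rmorphM exprSr.
have E2 : (1 / 2)%:C * (((1 / 2) ^+ J)%:C * x) = ((1 / 2) ^+ J.+1)%:C * x.
  by rewrite mulrA -rmorphM exprS.
by rewrite {1}IHJ (hkern_double xJ) E2 /gpart big_ord_recr /= E4; ring.
Qed.

Definition gkern x := hkern x - (x ^+ 2)^-1.

(** As y tends to 0, y^2 h(y) tends to 1, so the remaining term 4^{-J} h(x / 2^J) of [hkern_iter]
    tends to 1/x^2. *)
Lemma cvgC_gpart x : 0 < Re x -> cvgC (fun J => gpart J x) (gkern x).
Proof.
move=> x0; have xn : x != 0 by apply: contraTneq x0 => ->; rewrite ltxx.
pose y J : R[i] := ((1 / 2) ^+ J)%:C * x.
have yE J : nc (y J) = (1 / 2) ^+ J * nc x.
  by rewrite ncM nc_real ger0_norm// exprn_ge0.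
have Ry J : 0 < Re (y J) by rewrite ReZ mulr_gt0// exprn_gt0// divr_gt0.
have yn J : y J != 0 by apply: contraTneq (Ry J) => ->; rewrite ltxx.
have y0 a : a * nc (y J) @[J --> \oo] --> (0 : R).
  rewrite -(mulr0 a); apply: cvgM; first exact: cvg_cst.
  under eq_fun do rewrite yE; rewrite -(mul0r (nc x)); apply: cvgM; last exact: cvg_cst.
  by apply: cvg_expr; rewrite ger0_norm; lra.
have c1 : cvgC (fun J => cexp (- y J)) 1.
  apply: (cvgC_squeeze _ (y0 2)) => J; rewrite -(ncN (y J)).
  by apply: nc_cexp_sub1; rewrite ReN oppr_le0 ltW.
have c2 : cvgC (fun J => (1 - cexp (- y J)) / y J) 1.
  apply: (cvgC_squeeze _ (y0 4)) => J.
  have -> : (1 - cexp (- y J)) / y J - 1 = - (cexp (- y J) - 1 - - y J) / y J.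
    by field.
  rewrite ncM ncN ncV ler_pdivrMr ?nc_gt0// -mulrA -expr2 -(ncN (y J)).
  by apply: nc_cexp_sub2; rewrite ReN oppr_le0 ltW.
have c3 : cvgC (fun J => ((1 / 4) ^+ J)%:C * hkern (y J)) (x ^+ 2)^-1.
  have E J : ((1 / 4) ^+ J)%:C * hkern (y J) =
     (x ^+ 2)^-1 * (cexp (- y J) * ((1 - cexp (- y J)) / y J)^-1 * ((1 - cexp (- y J)) / y J)^-1).
    have -> : ((1 / 4) ^+ J)%:C = ((1 / 2) ^+ J)%:C ^+ 2 :> R[i].
      rewrite -rmorphXn /= -exprM mulnC exprM; congr ((_ ^+ J)%:C); by field.
    have en : 1 - cexp (- y J) != 0.
      rewrite subr_eq0; apply/eqP => e; have := nc_cexp (- y J); rewrite -e nc1 ReN => /esym/eqP.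
      by rewrite lt_eqF// expR_lt1 oppr_lt0.
    have hn : ((1 / 2) ^+ J)%:C != 0 :> R[i].
      by rewrite -nc_gt0 nc_real normr_gt0 expf_neq0//; lra.
    rewrite /hkern; move: en; set e := cexp (- y J); move: e => e en.
    by rewrite /y; field; rewrite en xn hn.
  rewrite -[X in cvgC _ X]mulr1; under eq_fun do rewrite E.
  apply: cvgCM; first exact: cvgC_cst.
  have := cvgCM (cvgCM c1 (cvgCV (oner_neq0 _) c2)) (cvgCV (oner_neq0 _) c2).
  by rewrite invr1 !mulr1.
have -> : (fun J => gpart J x) = (fun J => hkern x - ((1 / 4) ^+ J)%:C * hkern (y J)).
  by apply/funext => J; rewrite (hkern_iter J x0) addrC addKr.
by apply: cvgCB => //; exact: cvgC_cst.
Qed.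

Lemma gpart0 J : gpart J 0 = (- (\sum_(j < J) (1 / 4) ^+ j.+1) / 4)%:C.
Proof.
rewrite /gpart mulNr rmorphN mulr_suml rmorph_sum; congr (- _); apply: eq_bigr => j _.
rewrite mulr0 oppr0 cexp0 /pkern rmorphM; congr (_ * _).
transitivity (4^-1 : R[i]); first by rewrite mul1r; congr (_^-1); ring.
by rewrite -quarter_C div1r.
Qed.

(** Here [pkern 1] is 1/4 and the positive powers of 1/4 sum to 1/3; this is the origin of the
    exponent 1/12 in the theorem. *)
Lemma cvgC_gpart0 : cvgC (fun J => gpart J 0) (- (1 / 12)%:C).
Proof.
have E J : gpart J 0 = - ((1 - (1 / 4) ^+ J) / 12)%:C.
  rewrite gpart0 mulNr rmorphN; congr (- _%:C).
  by have := sum_geo (1 / 4 : R) J; rewrite exprS; lra.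
under eq_fun do rewrite E; apply: cvgCN; split => /=; last exact: cvg_cst.
apply: cvgM; last exact: cvg_cst.
rewrite -[X in _ --> X](subr0 1); apply: cvgB; first exact: cvg_cst.
by apply: cvg_expr; rewrite ger0_norm; lra.
Qed.

Lemma gkern_bounds C : 0 < C -> exists2 D : R, 0 < D &
  [/\ forall x, 0 < Re x -> in_cone C x -> nc (gkern x) <= D,
      forall x, 0 < Re x -> in_cone C x -> nc (gkern x + (1 / 12)%:C) <= D * nc x &
      forall x y, 0 < Re y -> Re y <= Re x -> in_cone C x -> in_cone C y ->
        nc (gkern x - gkern y) <= D * nc (x - y) /\
        Re y * nc (gkern x - gkern y) <= D * nc (x - y)].
Proof.
move=> C0; have [c c0 Hc] := cone_lower C0.
have c20 : 0 < 1 / c ^+ 2 by rewrite divr_gt0// exprn_gt0.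
have c40 : 0 < 4 / c ^+ 4 by rewrite divr_gt0// exprn_gt0.
have m1 : 1 / c ^+ 2 <= 1 / c ^+ 2 + 4 / c ^+ 4 by rewrite lerDl ltW.
have m2 : 4 / c ^+ 4 <= 1 / c ^+ 2 + 4 / c ^+ 4 by rewrite lerDr ltW.
exists (1 / c ^+ 2 + 4 / c ^+ 4); first by rewrite addr_gt0.
split.
- move=> x x0 xC; apply: (cvgC_le (cvgC_gpart x0)); apply: nearW => J.
  exact: le_trans (gpart_le J c0 Hc xC) m1.
- move=> x x0 xC; rewrite -(opprK (1 / 12)%:C).
  apply: (cvgC_le (cvgCB (cvgC_gpart x0) cvgC_gpart0)); apply: nearW => J.
  have C0' : in_cone C 0 by split; rewrite //= mulr0 normr0.
  have [h _] := gpart_diff J c0 Hc xC C0' (ltW x0).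
  rewrite subr0 in h; apply: le_trans h _; by rewrite ler_wpM2r ?nc_ge0.
- move=> x y y0 yx xC yC; have cv := cvgCB (cvgC_gpart (lt_le_trans y0 yx)) (cvgC_gpart y0).
  split.
    apply: (cvgC_le cv); apply: nearW => J.
    have [h _] := gpart_diff J c0 Hc xC yC yx.
    by apply: le_trans h _; rewrite ler_wpM2r ?nc_ge0.
  rewrite mulrC -ler_pdivlMr//; apply: (cvgC_le cv); apply: nearW => J.
  rewrite ler_pdivlMr// mulrC; have [_ h] := gpart_diff J c0 Hc xC yC yx.
  by apply: le_trans h _; rewrite ler_wpM2r ?nc_ge0.
Qed.

End Kernel.

(** * The logarithm as a series, and its size away from the real axis *)

Section LogGeneratingFunction.
Context {R : realType}.
Implicit Types (z w x y : R[i]) (r : R).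

(** After division by e^{-r} this is the inequality r <= 2 sinh(r/2), squared. *)
Lemma sqr_expRN_le r : 0 <= r -> r ^+ 2 * expR (- r) <= (1 - expR (- r)) ^+ 2.
Proof.
move=> r0; pose h := r / 2; have h0 : 0 <= h by rewrite divr_ge0.
have e2 : expR (- r) = expR (- h) ^+ 2.
  by rewrite -expRM_natl; congr expR; rewrite /h; field.
have sh : 2 * h <= expR h - expR (- h).
  have := @norm_diff_le R (fun r => r * 2) (fun=> 2) (fun r => expR r - expR (- r))
    (fun r => expR r + expR (- r)) 0 h h0.
  rewrite mul0r subr0 oppr0 subrr subr0 mulrC => H.
  apply: le_trans (ler_norm _) (H _ _ _) => x _.
  - exact: is_derive_mulr.
  - by apply: is_derive_eq; rewrite /GRing.scale /=; ring.
  - rewrite ger0_norm// expRN; have e0 := expR_gt0 x.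
    rewrite -subr_ge0 -(pmulr_lge0 _ e0).
    have -> : (expR x + (expR x)^-1 - 2) * expR x = (expR x - 1) ^+ 2.
      by field; rewrite gt_eqF.
    exact: sqr_ge0.
have e0 := expR_gt0 (- h).
have E : expR h * expR (- h) = 1 by rewrite -expRD subrr expR0.
have -> : 1 - expR (- r) = expR (- h) * (expR h - expR (- h)) by rewrite e2 -E; ring.
rewrite e2 exprMn mulrC ler_wpM2l ?sqr_ge0// lerXn2r ?nnegrE//.
  by apply: le_trans sh; rewrite mulr_ge0.
by apply: le_trans sh; rewrite /h mulrCA divff// mulr1.
Qed.

Lemma hkern_le x : 0 < Re x -> nc (hkern x) <= 1 / Re x ^+ 2.
Proof.
move=> x0; rewrite /hkern ncM nc_cexp ncV ncX ReN.
have e1 : expR (- Re x) < 1 by rewrite expR_lt1 oppr_lt0.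
have n1 : 1 - expR (- Re x) <= nc (1 - cexp (- x)).
  by have := ncB_ge 1 (cexp (- x)); rewrite nc1 nc_cexp ReN.
have p1 : 0 < 1 - expR (- Re x) by rewrite subr_gt0.
rewrite ler_pdivrMr ?exprn_gt0 ?(lt_le_trans p1 n1)//.
rewrite mulrAC ler_pdivlMr ?exprn_gt0// mulrC mul1r.
apply: le_trans (sqr_expRN_le (ltW x0)) _.
by rewrite lerXn2r ?nnegrE ?nc_ge0 ?(ltW p1).
Qed.

(** Comparison of 1/k^3 with the telescoping 1/((k-1)k(k+1)) for k >= 2. The part 1/4 beyond the
    first term is the threshold that the growth rate must exceed. *)
Lemma sum_invn3_le n : \sum_(k < n) (1 / (k.+1%:R ^+ 3) : R) <= 5 / 4.
Proof.
suff H : \sum_(k < n.+1) (1 / (k.+1%:R ^+ 3) : R) <= 5 / 4 - 1 / (2 * n.+1%:R * n.+2%:R).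
  apply: (@le_trans _ _ (\sum_(k < n.+1) (1 / (k.+1%:R ^+ 3) : R))).
    by rewrite big_ord_recr /= lerDl divr_ge0// exprn_ge0.
  by apply: le_trans H _; rewrite gerBl divr_ge0.
elim: n => [|n IHn]; first by rewrite big_ord1 expr1n !divr1; lra.
rewrite big_ord_recr /=; apply: le_trans (lerD IHn (lexx _)) _.
have m0 : 0 < n.+1%:R :> R by [].
rewrite -(natr1 n.+2) -(natr1 n.+1); move: (n.+1%:R : R) m0 => m m0.
have m1 : 0 < m + 1 by lra.
have m2 : 0 < m + 1 + 1 by lra.
rewrite -subr_ge0.
have -> : 5 / 4 - 1 / (2 * (m + 1) * (m + 1 + 1)) -
    (5 / 4 - 1 / (2 * m * (m + 1)) + 1 / (m + 1) ^+ 3) =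
    1 / (m * (m + 1) ^+ 3 * (m + 1 + 1)).
  by field; rewrite !gt_eqF.
by rewrite divr_ge0// !mulr_ge0 ?exprn_ge0// ltW.
Qed.

Definition Tterm z x (k : nat) : R[i] := z ^+ k.+1 / k.+1%:R * hkern (k.+1%:R * x).

(** The logarithm, at q = e^{-x}, of the infinite product of the (1 - z q^m)^(-m). *)
Definition Tsum z x : R[i] := csum (Tterm z x).

Lemma Re_natM k x : Re (k%:R * x) = k%:R * Re x.
Proof. by rewrite -real_natC ReZ. Qed.

Lemma nc_expr_le1 z k : nc z <= 1 -> nc (z ^+ k) <= 1.
Proof. by move=> z1; rewrite ncX exprn_ile1// nc_ge0. Qed.

Lemma Tterm_le z x k : nc z <= 1 -> 0 < Re x ->
  nc (Tterm z x k) <= 1 / Re x ^+ 2 * (1 / k.+1%:R ^+ 3).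
Proof.
move=> z1 x0; rewrite /Tterm ncM [nc (_ / _)]ncM ncV nc_nat.
have k0 : 0 < k.+1%:R :> R by [].
have := @hkern_le (k.+1%:R * x); rewrite Re_natM pmulr_rgt0// => /(_ x0) H.
apply: (@le_trans _ _ (1 / k.+1%:R * (1 / (k.+1%:R * Re x) ^+ 2))).
  apply: ler_pM H; rewrite ?mulr_ge0 ?nc_ge0 ?invr_ge0//.
  by rewrite ler_wpM2r ?invr_ge0//; exact: nc_expr_le1.
rewrite le_eqVlt; apply/orP; left; apply/eqP; field.
by rewrite !gt_eqF.
Qed.

Lemma Tterm_sum_le x n : 0 < Re x ->
  \sum_(k < n) 1 / Re x ^+ 2 * (1 / k.+1%:R ^+ 3) <= 1 / Re x ^+ 2 * (5 / 4).
Proof.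
move=> x0; rewrite -mulr_sumr ler_wpM2l ?divr_ge0 ?exprn_ge0 ?(ltW x0)//.
exact: sum_invn3_le.
Qed.

Lemma Tsum_cvg z x : nc z <= 1 -> 0 < Re x ->
  cvgC (fun n => \sum_(k < n) Tterm z x k) (Tsum z x).
Proof.
move=> z1 x0; apply: (csum_cvg _ (fun n => Tterm_sum_le n x0)) => k.
exact: Tterm_le.
Qed.

Lemma Tsum_le z x : nc z <= 1 -> 0 < Re x -> nc (Tsum z x) <= 1 / Re x ^+ 2 * (5 / 4).
Proof.
move=> z1 x0; apply: (csum_le _ (fun n => Tterm_sum_le n x0)) => k.
exact: Tterm_le.
Qed.

(** Only the first term keeps its true size; the others are replaced by the bound 1/(k^3 (Re x)^2),
    and these add up to at most 1/4 of 1/(Re x)^2. *)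
Lemma Tsum_minor z x : nc z <= 1 -> 0 < Re x ->
  nc (Tsum z x) <= nc (hkern x) + 1 / Re x ^+ 2 * (1 / 4).
Proof.
move=> z1 x0.
apply: (csum_le (v := fun k => if k is k'.+1 then 1 / Re x ^+ 2 * (1 / k.+1%:R ^+ 3) else nc (hkern x))).
  case=> [|k]; last exact: Tterm_le.
  by rewrite /Tterm expr1 divr1 mul1r ncM ler_piMl ?nc_ge0.
case=> [|n].
  by rewrite big_ord0 addr_ge0 ?nc_ge0// mulr_ge0 ?divr_ge0 ?exprn_ge0 ?(ltW x0).
rewrite big_ord_recl lerD2l /= -mulr_sumr ler_wpM2l ?divr_ge0 ?exprn_ge0 ?(ltW x0)//.
have := sum_invn3_le n.+1; rewrite big_ord_recl /= expr1n divr1.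
under eq_bigr do rewrite /bump /= add1n; lra.
Qed.

Lemma sin_lower : exists2 c : R, 0 < c & forall x : R, 0 <= x <= pi / 2 -> c * x <= sin x.
Proof.
have c1 := @cos1_gt0 R; have s1 : 0 < sin (1 : R) by apply: sin2_gt0; rewrite ltr01 ltr1n.
(* Up to 1 the slope is at least cos 1; beyond 1, sin x >= sin 1 while x < 2. *)
pose c := Num.min (cos (1 : R)) (sin 1 / 2).
exists c; first by rewrite lt_min c1 divr_gt0.
move=> x /andP[x0 x2]; have p2 := @pihalf_lt2 R.
have [x1|x1] := leP x 1.
  move: x0; rewrite le_eqVlt => /predU1P[<-|x0]; first by rewrite mulr0 sin0.
  have [|u uI] := @MVT R sin cos 0 x x0 (fun r _ => is_derive_sin r).
    by apply: continuous_subspaceT; exact: continuous_sin.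
  rewrite sin0 !subr0 => ->; rewrite ler_pM2r//.
  apply: (@le_trans _ _ (cos 1)); first by rewrite /c ge_min lexx.
  move: uI; rewrite in_itv /= => /andP[u0 ux]; rewrite leNgt ltr_cos ?in_itv /=.
  - by rewrite -leNgt (le_trans (ltW ux)).
  - by rewrite ler01 /= ; have := @pihalf_ge1 R; have := pi_gt0 R; lra.
  - by rewrite (ltW u0) /=; have := pi_gt0 R; lra.
apply: (@le_trans _ _ (sin 1)).
  have : c <= sin 1 / 2 by rewrite /c ge_min lexx orbT.
  nra.
rewrite leNgt ltr_sin ?in_itv /=.
- by rewrite -leNgt ltW.
- by apply/andP; split; lra.
- by have := @pihalf_ge1 R; move=> ?; apply/andP; split; lra.
Qed.

(** With e = e^{-Re x} one has |1 - e^{-x}|^2 = (1 - e)^2 + 2e(1 - cos(Im x)); the factor e cancels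
    against the numerator, and on [-pi, pi] the function 1 - cos has a quadratic lower bound. *)
Lemma hkern_minor : exists2 c : R, 0 < c & forall x, 0 < Re x -> `|Im x| <= pi -> Im x != 0 ->
  nc (hkern x) <= 1 / (c * Im x ^+ 2).
Proof.
have [c c0 Hc] := sin_lower.
exists (c ^+ 2); first by rewrite exprn_gt0.
move=> x x0 xpi xn0.
have s2 : c ^+ 2 * Im x ^+ 2 <= 2 * (1 - cos (Im x)).
  have -> : 1 - cos (Im x) = 2 * sin (`|Im x| / 2) ^+ 2.
    have E : `|Im x| / 2 *+ 2 = `|Im x| by rewrite -mulr_natr divfK.
    by have := cos_mulr2n (`|Im x| / 2); rewrite E cos_norm cos2sin2 => ->; ring.
  rewrite -(real_normK (num_real (Im x))) -exprMn.
  have : c * (`|Im x| / 2) <= sin (`|Im x| / 2).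
    by apply: Hc; rewrite divr_ge0//= ler_pM2r.
  have : 0 <= c * (`|Im x| / 2) by rewrite mulr_ge0 ?divr_ge0// ltW.
  nra.
have i2 : 0 < c ^+ 2 * Im x ^+ 2 by apply: mulr_gt0; [exact: exprn_gt0|rewrite exprn_even_gt0].
rewrite /hkern ncM nc_cexp ncV ncX ReN nc_sqr ReB ImB cexpE /= ReN ImN cosN sinN.
set e := expR (- Re x); have e0 : 0 < e by exact: expR_gt0.
have E : (1 - e * cos (Im x)) ^+ 2 + (0 - e * - sin (Im x)) ^+ 2 =
    (1 - e) ^+ 2 + e * (2 * (1 - cos (Im x))).
  have := cos2Dsin2 (Im x) => H.
  have -> : (0 - e * - sin (Im x)) ^+ 2 = e ^+ 2 * (1 - cos (Im x) ^+ 2) by rewrite -H; ring.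
  ring.
rewrite E ler_pdivrMr; last first.
  by rewrite ltr_wpDl ?sqr_ge0// mulr_gt0// (lt_le_trans i2).
rewrite mulrAC ler_pdivlMr// mul1r.
by have := sqr_ge0 (1 - e); nra.
Qed.

End LogGeneratingFunction.

(** * The expansion inside a cone *)

Section MajorArc.
Context {R : realType}.
Implicit Types (z w x : R[i]) (r : R).

Lemma normC_nc z : `|z| = (nc z)%:C.
Proof. by case: z => a b; rewrite normc_def. Qed.

Lemma cvgC_lim (u : nat -> R[i]) l : cvgC u l -> limn (u : nat -> R[i]^o) = l.
Proof.
move=> /cvgC_normP ul; apply: cvg_lim; first exact: norm_hausdorff.
apply/cvgrPdist_lt => -[e1 e2]; rewrite ltcE /= => /andP[/eqP -> e0].
move/cvgr0_norm_lt: ul => /(_ _ e0).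
apply: filterS => n; rewrite ger0_norm ?nc_ge0// => h.
by rewrite distrC normC_nc ltcE /= eqxx.
Qed.

Definition Li3term z k : R[i] := z ^+ k.+1 / k.+1%:R ^+ 3.

Lemma Li3term_le z k : nc z <= 1 -> nc (Li3term z k) <= 1 / k.+1%:R ^+ 3.
Proof.
move=> z1; rewrite /Li3term ncM ncV [nc (_%:R ^+ 3)]ncX nc_nat.
by rewrite ler_wpM2r ?invr_ge0 ?exprn_ge0// nc_expr_le1.
Qed.

Lemma Li3_csum z : nc z <= 1 -> cvgC (fun n => \sum_(k < n) Li3term z k) (csum (Li3term z)).
Proof.
move=> z1; apply: (csum_cvg _ (sum_invn3_le (R := R))) => k; exact: Li3term_le.
Qed.

Lemma Li3E z : nc z <= 1 -> Li3 z = csum (Li3term z).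
Proof.
move=> z1; apply: cvgC_lim; apply/cvgC_shift.
under eq_fun do rewrite big_add1 big_mkord.
exact: Li3_csum.
Qed.

Lemma Li3_cvg z : nc z <= 1 -> cvgC (fun n => \sum_(k < n) Li3term z k) (Li3 z).
Proof. by move=> z1; rewrite Li3E//; exact: Li3_csum. Qed.

(** The shape of the majorant in [Tsum_major]: a uniform bound for the first [m] terms, a
    telescoping one for the rest. *)
Lemma sum_truncated (X Y : R) m n : 0 <= X -> 0 <= Y ->
  \sum_(k < n) (if (k < m)%N then X else Y * (1 / k.+1%:R - 1 / k.+2%:R)) <=
  m%:R * X + Y / m.+1%:R.
Proof.
move=> X0 Y0.
have [nm|mn] := leqP n m.
  apply: (@le_trans _ _ (\sum_(k < n) X)).
    by apply: ler_sum => k _; rewrite (leq_trans (ltn_ord k) nm).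
  rewrite sumr_const card_ord -[X *+ n]mulr_natl; apply: (@le_trans _ _ (m%:R * X)).
    by rewrite ler_wpM2r// ler_nat.
  by rewrite lerDl divr_ge0.
suff : \sum_(k < n) (if (k < m)%N then X else Y * (1 / k.+1%:R - 1 / k.+2%:R)) =
    m%:R * X + Y * (1 / m.+1%:R - 1 / n.+1%:R).
  move=> ->; rewrite lerD2l mulrBr mul1r gerBl mulr_ge0// divr_ge0//.
rewrite -(subnK (ltnW mn)) addnC; elim: (n - m)%N => [|d IHd].
  rewrite addn0 subrr mulr0 addr0.
  transitivity (\sum_(k < m) X); first by apply: eq_bigr => k _; rewrite ltn_ord.
  by rewrite sumr_const card_ord mulr_natl.
by rewrite addnS big_ord_recr /= IHd ltnNge leq_addr /=; ring.
Qed.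

(** The identity holds for every [S]; when [S] is the sum of the series of the [a k], the
    differences with the partial sums are its tails. *)
Lemma abel_sum (S : R[i]) (a g : nat -> R[i]) n :
  \sum_(k < n.+1) a k * g k = S * g 0%N +
   (\sum_(k < n) (S - \sum_(j < k.+1) a j) * (g k.+1 - g k) -
   (S - \sum_(j < n.+1) a j) * g n).
Proof.
elim: n => [|n IHn]; first by rewrite big_ord1 big_ord0 big_ord1; ring.
by rewrite big_ord_recr IHn /= [in RHS]big_ord_recr /= (big_ord_recr n.+1) /=; ring.
Qed.

(** Subtracting Li3(z)/x^2 turns h(kx) into g(kx) = h(kx) - 1/(kx)^2. Summation by parts with S =
    -log(1 - z) leaves S g(x), close to log(1 - z)/12, and a sum of tails O(1/k) times differences
    of g, which are both O(|x|) and O(1/k). *)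
Lemma Tsum_major z (C e : R) : nc z <= 1 -> z != 1 -> 0 < C -> 0 < e ->
  exists2 d : R, 0 < d & forall x, 0 < Re x -> Re x <= d -> in_cone C x ->
    nc (Tsum z x - Li3 z / x ^+ 2 - (1 / 12)%:C * clog (1 - z)) <= e.
Proof.
move=> z1 zn1 C0 e0.
have [M M0 HM] := log_series_cst z1 zn1.
have [D D0 [gD gz gL]] := gkern_bounds C0.
pose K := 2 * M; have K0 : 0 < K by rewrite mulr_gt0.
pose Y := K * D * (1 + C).
have Y0 : 0 < Y by rewrite !mulr_gt0// addr_gt0.
(* The index [m] makes the telescoping tail small independently of [x]; then [d] makes the first [m]
   terms small. *)
have [m Hm] : exists m : nat, Y / m.+1%:R <= e / 4.
  exists (Num.truncn (Y / (e / 4))); rewrite ler_pdivrMr// [leRHS]mulrC -ler_pdivrMr ?divr_gt0//.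
  by apply: ltW; apply: truncnS_gt.
pose d := e / 4 / (K * D * (m.+1%:R) * (1 + C)).
have d0 : 0 < d by rewrite !divr_gt0// !mulr_gt0// addr_gt0.
exists d => // x x0 xd xC.
have nx : nc x <= (1 + C) * Re x.
  apply: le_trans (nc_ReIm _) _; case: xC => _ h.
  by rewrite (ger0_norm (ltW x0)) mulrDl mul1r lerD2l.
pose S := - clog (1 - z).
pose a k : R[i] := z ^+ k.+1 / k.+1%:R.
pose g k : R[i] := gkern (k.+1%:R * x).
have SaE n : nc (S - \sum_(k < n) a k) <= K / n.+1%:R.
  rewrite -ncN opprB /S opprK addrC; apply: le_trans (nc_log_series n z1 zn1 HM) _.
  by rewrite /K mulrA.
have Rk k : Re (k.+1%:R * x) = k.+1%:R * Re x by exact: Re_natM.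
have Rk0 k : 0 < Re (k.+1%:R * x) by rewrite Rk mulr_gt0.
have kC k : in_cone C (k.+1%:R * x).
  by rewrite -real_natC; apply: in_coneZ.
have dg k : nc (g k.+1 - g k) <= D * nc x /\ k.+1%:R * nc (g k.+1 - g k) <= D * (1 + C).
  have [|h1 h2] := gL _ _ (Rk0 k) _ (kC k.+1) (kC k).
    by rewrite !Rk ler_wpM2r ?(ltW x0)// ler_nat.
  have E : k.+2%:R * x - k.+1%:R * x = x by rewrite -(natr1 k.+1); ring.
  rewrite E in h1 h2; split=> //.
  rewrite -(ler_pM2l x0) mulrA [Re x * _]mulrC -Rk; apply: le_trans h2 _.
  by rewrite mulrCA ler_pM2l// mulrC.
have key n : nc (\sum_(k < n.+1) a k * g k - (1 / 12)%:C * clog (1 - z)) <=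
    3 / 4 * e + K * D / n.+2%:R.
  rewrite (abel_sum S).
  have -> : S * g 0%N + (\sum_(k < n) (S - \sum_(j < k.+1) a j) * (g k.+1 - g k) -
      (S - \sum_(j < n.+1) a j) * g n) - (1 / 12)%:C * clog (1 - z) =
      S * (g 0%N + (1 / 12)%:C) + \sum_(k < n) (S - \sum_(j < k.+1) a j) * (g k.+1 - g k) -
      (S - \sum_(j < n.+1) a j) * g n by rewrite /S; ring.
  have p1 : nc (S * (g 0%N + (1 / 12)%:C)) <= e / 4.
    have := SaE 0%N; rewrite big_ord0 subr0 divr1 => SK.
    have := gz _ (Rk0 0%N) (kC 0%N); rewrite (mul1r x) => h.
    rewrite ncM; apply: (@le_trans _ _ (K * (D * ((1 + C) * d)))).
      apply: ler_pM; rewrite ?nc_ge0// /g (mul1r x); apply: le_trans h _.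
      rewrite ler_pM2l//; apply: le_trans nx _.
      by rewrite ler_pM2l// addr_gt0.
    have -> : K * (D * ((1 + C) * d)) = e / 4 / m.+1%:R.
      by rewrite /d; field; rewrite addrC natr1 !gt_eqF// addr_gt0.
    by rewrite ler_pdivrMr// ler_peMr ?divr_ge0 ?(ltW e0)// ler1n.
  have p2 : nc (\sum_(k < n) (S - \sum_(j < k.+1) a j) * (g k.+1 - g k)) <= e / 2.
    apply: le_trans (nc_sum _ _ _) _.
    apply: (@le_trans _ _ (\sum_(k < n) (if (k < m)%N then K * (D * ((1 + C) * d))
        else Y * (1 / k.+1%:R - 1 / k.+2%:R)))).
      apply: ler_sum => k _; rewrite ncM; have [h1 h2] := dg k.
      have kS := SaE k.+1; have n2 : 0 < k.+2%:R :> R by [].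
      have n1 : 0 < k.+1%:R :> R by [].
      case: ifP => km.
        apply: ler_pM; rewrite ?nc_ge0//.
          by apply: le_trans kS _; rewrite ler_pdivrMr// ler_peMr ?(ltW K0)// ler1n.
        apply: le_trans h1 _; rewrite ler_pM2l//; apply: le_trans nx _.
        by rewrite ler_pM2l// addr_gt0.
      apply: (@le_trans _ _ (K / k.+2%:R * (D * (1 + C) / k.+1%:R))).
        by apply: ler_pM; rewrite ?nc_ge0// ler_pdivlMr// mulrC.
      rewrite le_eqVlt; apply/orP; left; apply/eqP; rewrite /Y -(natr1 k.+1).
      by field; rewrite !gt_eqF// addr_gt0.
    have X0 : 0 <= K * (D * ((1 + C) * d)).
      apply: mulr_ge0; first exact: ltW.
      apply: mulr_ge0; first exact: ltW.
      by apply: mulr_ge0; [rewrite addr_ge0// ltW|exact: ltW].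
    apply: le_trans (sum_truncated m n X0 (ltW Y0)) _.
    have -> : K * (D * ((1 + C) * d)) = e / 4 / m.+1%:R.
      by rewrite /d; field; rewrite addrC natr1 !gt_eqF// addr_gt0.
    have : m%:R * (e / 4 / m.+1%:R) <= e / 4.
      rewrite mulrA ler_pdivrMr// mulrC ler_wpM2l ?divr_ge0 ?(ltW e0)// ler_nat//.
    move: Hm; set A := Y / _; set A' := m%:R * _ => hA hA'.
    by apply: le_trans (lerD hA' hA) _; rewrite le_eqVlt; apply/orP; left; apply/eqP; field.
  have p3 : nc ((S - \sum_(j < n.+1) a j) * g n) <= K * D / n.+2%:R.
    rewrite ncM mulrAC; apply: ler_pM; rewrite ?nc_ge0//; exact: gD.
  apply: le_trans (ncB _ _) _; apply: lerD p3.
  apply: le_trans (ncD _ _) _; lra.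
have cv : cvgC (fun n => \sum_(k < n.+1) a k * g k - (1 / 12)%:C * clog (1 - z))
   (Tsum z x - Li3 z / x ^+ 2 - (1 / 12)%:C * clog (1 - z)).
  apply: cvgCB; last exact: cvgC_cst.
  have E n : \sum_(k < n) a k * g k =
      \sum_(k < n) Tterm z x k - (\sum_(k < n) Li3term z k) / x ^+ 2.
    rewrite mulr_suml -sumrB; apply: eq_bigr => k _.
    rewrite /a /g /gkern /Tterm /Li3term mulrBr; congr (_ - _).
    have xn : x != 0 by apply: contraTneq x0 => ->; rewrite ltxx.
    by field; rewrite xn addrC natr1 pnatr_eq0.
  apply/(@cvgC_shift _ (fun n => \sum_(k < n) a k * g k)); under eq_fun do rewrite E.
  by apply: cvgCB; [exact: Tsum_cvg|apply: cvgCM; [exact: Li3_cvg|exact: cvgC_cst]].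
apply: (cvgC_le cv).
have [n0 Hn0] : exists n : nat, K * D / n.+1%:R <= e / 4.
  exists (Num.truncn (K * D / (e / 4))); rewrite ler_pdivrMr// [leRHS]mulrC -ler_pdivrMr ?divr_gt0//.
  by apply: ltW; apply: truncnS_gt.
exists n0 => // n /= n0n; apply: le_trans (key n) _.
have : K * D / n.+2%:R <= K * D / n0.+1%:R.
  rewrite ler_pM2l ?mulr_gt0// lef_pV2 ?posrE// ler_nat; lia.
move: Hn0; set A := K * D / n0.+1%:R; set A' := K * D / n.+2%:R; lra.
Qed.

End MajorArc.

(** * Polynomials approximating the infinite product *)

Section ProductApproximation.
Context {R : realType}.
Implicit Types (z w x q : R[i]) (r t : R).

Definition box_poly z (N K : nat) : {poly R[i]} :=
  \prod_(ij : 'I_N * 'I_N) \sum_(k < K) z ^+ k *: 'X^(k * (ij.1 + ij.2).+1).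

Lemma horner_box_poly z N K q :
  (box_poly z N K).[q] =
  \prod_(ij : 'I_N * 'I_N) \sum_(k < K) (z * q ^+ (ij.1 + ij.2).+1) ^+ k.
Proof.
rewrite horner_prod; apply: eq_bigr => ij _; rewrite horner_sum.
apply: eq_bigr => k _; rewrite hornerZ hornerXn exprMn -exprM mulnC //.
Qed.

Lemma nc_prod_sub1 (I : finType) (u : I -> R[i]) (rho : R) : (forall i, nc (u i) <= rho) ->
  nc (\prod_i (1 + u i) - 1) <= (1 + rho) ^+ #|I| - 1.
Proof.
move=> ur; rewrite -[#|I|]sum1_card.
suff [//] : nc (\prod_i (1 + u i) - 1) <= (1 + rho) ^+ (\sum_(i : I) 1)%N - 1 /\
   1 <= (1 + rho) ^+ (\sum_(i : I) 1)%N.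
apply: (big_ind2 (fun (a : R[i]) n => nc (a - 1) <= (1 + rho) ^+ n - 1 /\ 1 <= (1 + rho) ^+ n)).
- by rewrite subrr nc0 expr0 subrr.
- move=> a n b m [ha hn] [hb hm]; rewrite exprD; split; last by rewrite mulr_ege1.
  have -> : a * b - 1 = (a - 1) * (b - 1) + (a - 1) + (b - 1) by ring.
  apply: le_trans (ncD _ _) _; apply: le_trans (lerD (ncD _ _) (lexx _)) _.
  rewrite ncM; have := nc_ge0 (a - 1); have := nc_ge0 (b - 1); nra.
- move=> i _; rewrite expr1 [1 + rho]addrC addrK [1 + u i]addrC addrK lerDr; split=> //.
  exact: le_trans (nc_ge0 _) (ur i).
Qed.

Lemma nc_cexp_small x : nc x <= 1 -> nc (cexp x - 1) <= 2 * expR 1 * nc x.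
Proof.
move=> x1; have e1 : 1 <= expR 1 :> R by rewrite -expR0 ler_expR.
have [x0|x0] := leP (Re x) 0.
  apply: le_trans (nc_cexp_sub1 x0) _; rewrite ler_wpM2r ?nc_ge0//; lra.
have -> : cexp x - 1 = - (cexp x * (cexp (- x) - 1)).
  by rewrite mulrBr -cexpD subrr cexp0; ring.
rewrite ncN ncM nc_cexp [2 * _]mulrC -mulrA; apply: ler_pM; rewrite ?nc_ge0 ?expR_ge0//.
  by rewrite ler_expR (le_trans (Re_le _)).
by rewrite -(ncN x); apply: nc_cexp_sub1; rewrite ReN oppr_le0 ltW.
Qed.

Lemma nc_box_arg z q m : nc z <= 1 -> nc q <= 1 -> nc (z * q ^+ m.+1) <= nc q.
Proof.
move=> z1 q1; rewrite ncM ncX exprS mulrCA ler_piMr ?nc_ge0//.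
by rewrite mulr_ile1 ?nc_ge0 ?exprn_ge0 ?exprn_ile1 ?nc_ge0.
Qed.

Definition box_log z (N : nat) q : R[i] :=
  - \sum_(ij : 'I_N * 'I_N) clog (1 - z * q ^+ (ij.1 + ij.2).+1).

Lemma box_log_series z N q : nc z <= 1 -> nc q < 1 ->
  cvgC (fun K => \sum_(k < K) z ^+ k.+1 / k.+1%:R *
    \sum_(ij : 'I_N * 'I_N) (q ^+ k.+1) ^+ (ij.1 + ij.2).+1) (box_log z N q).
Proof.
move=> z1 q1.
have q0 := nc_ge0 q.
have u0 : 0 < 1 - nc q by rewrite subr_gt0.
pose M := (1 - nc q)^-1.
have xq (m : nat) : nc (z * q ^+ m.+1) <= nc q.
  by apply: nc_box_arg => //; exact: ltW.
have HM (m : nat) r : 0 <= r <= 1 -> 1 <= M * nc (1 - r%:C * (z * q ^+ m.+1)).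
  move=> /andP[r0 r1]; rewrite mulrC ler_pdivlMr// mul1r.
  have := ncB_ge 1 (r%:C * (z * q ^+ m.+1)); rewrite nc1 => h.
  apply: le_trans h; rewrite lerD2l lerN2 ncM nc_real ger0_norm//.
  by rewrite (le_trans _ (xq m))// ler_piMl// nc_ge0.
apply: (@cvgC_squeeze _ _ _ (fun K => #|{: 'I_N * 'I_N}|%:R * (2 * (M / K.+1%:R)))); last first.
  rewrite -(mulr0 (#|{: 'I_N * 'I_N}|%:R * (2 * M))).
  have -> : (fun K => #|{: 'I_N * 'I_N}|%:R * (2 * (M / K.+1%:R))) =
     (fun K => #|{: 'I_N * 'I_N}|%:R * (2 * M) * harmonic K).
    by apply/funext => K; rewrite /harmonic /= !mulrA.
  by apply: cvgM; [exact: cvg_cst|exact: cvg_harmonic].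
move=> K.
have -> : \sum_(k < K) z ^+ k.+1 / k.+1%:R *
    \sum_(ij : 'I_N * 'I_N) (q ^+ k.+1) ^+ (ij.1 + ij.2).+1 =
    \sum_(ij : 'I_N * 'I_N) \sum_(k < K) (z * q ^+ (ij.1 + ij.2).+1) ^+ k.+1 / k.+1%:R.
  rewrite exchange_big; apply: eq_bigr => k _; rewrite mulr_sumr; apply: eq_bigr => ij _.
  by rewrite exprMn mulrAC -!exprM mulnC.
rewrite /box_log opprK -big_split /=; apply: le_trans (nc_sum _ _ _) _.
rewrite -[#|_|]sum1_card natr_sum mulr_suml; apply: ler_sum => ij _; rewrite mul1r addrC.
apply: nc_log_series (HM _).
  by apply: le_trans (xq _) _; exact: ltW.
by apply: contraTneq (xq (ij.1 + ij.2)%N) => ->; rewrite nc1 -ltNge.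
Qed.

Lemma geometric_square N q : 1 - q != 0 ->
  \sum_(ij : 'I_N * 'I_N) q ^+ (ij.1 + ij.2).+1 = q / (1 - q) ^+ 2 * (1 - q ^+ N) ^+ 2.
Proof.
move=> q1.
have E : \sum_(i < N) q ^+ i = (1 - q ^+ N) / (1 - q).
  by apply: (mulIf q1); rewrite divfK// mulrC -opprB mulNr -subrX1 opprB.
have -> : \sum_(ij : 'I_N * 'I_N) q ^+ (ij.1 + ij.2).+1 =
    q * ((\sum_(i < N) q ^+ i) * (\sum_(i < N) q ^+ i)).
  rewrite mulr_suml mulr_sumr -(pair_bigA _ (fun i j : 'I_N => q ^+ (i + j).+1)) /=.
  apply: eq_bigr => i _; rewrite !mulr_sumr; apply: eq_bigr => j _.
  by rewrite exprS exprD.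
by rewrite E; field.
Qed.

(** On an N by N box the kernel h(kx) acquires the factor (1 - p)^2 with p = e^{-N k x}. Since (1 -
    p)^2 - 1 = p(p - 2), the constant 3 bounds |p - 2|. *)
Lemma box_log_Tsum z N x : nc z <= 1 -> 0 < Re x ->
  nc (box_log z N (cexp (- x)) - Tsum z x) <= 3 * expR (- (N%:R * Re x)) * (1 / Re x ^+ 2 * (5 / 4)).
Proof.
move=> z1 x0; have q1 : nc (cexp (- x)) < 1 by rewrite nc_cexp ReN expR_lt1 oppr_lt0.
apply: (cvgC_le (cvgCB (box_log_series N z1 q1) (Tsum_cvg z1 x0))); apply: nearW => K.
rewrite -sumrB; apply: le_trans (nc_sum _ _ _) _.
apply: le_trans (ler_wpM2l _ (Tterm_sum_le K x0)); last by rewrite mulr_ge0 ?expR_ge0.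
rewrite mulr_sumr; apply: ler_sum => k _.
have kx : 0 < Re (k.+1%:R * x) by rewrite Re_natM mulr_gt0.
have qk : cexp (- x) ^+ k.+1 = cexp (- (k.+1%:R * x)) by rewrite -cexpM_nat mulrN.
have n1 : nc (cexp (- (k.+1%:R * x))) < 1 by rewrite nc_cexp ReN expR_lt1 oppr_lt0.
rewrite geometric_square qk; last first.
  by rewrite subr_eq0; apply: contraTneq n1 => <-; rewrite nc1 ltxx.
rewrite -/(hkern (k.+1%:R * x)) mulrA -/(Tterm z x k) -{2}(mulr1 (Tterm z x k)) -mulrBr.
rewrite ncM mulrC; apply: ler_pM; rewrite ?nc_ge0 ?Tterm_le//.
set p := cexp (- (k.+1%:R * x)) ^+ N.
have pe : nc p <= expR (- (N%:R * Re x)).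
  rewrite /p ncX nc_cexp ReN Re_natM -expRM_natl ler_expR mulrN lerN2.
  rewrite ler_wpM2l// ler_peMl ?(ltW x0)// ler1n//.
have p1 : nc p <= 1 by rewrite /p ncX exprn_ile1 ?nc_ge0// ltW.
have -> : (1 - p) ^+ 2 - 1 = p * (p - 2%:R) by ring.
rewrite ncM mulrC; apply: ler_pM; rewrite ?nc_ge0//.
apply: le_trans (ncB _ _) _; rewrite nc_nat; lra.
Qed.

Lemma horner_box_log z N K q : nc z <= 1 -> nc q < 1 ->
  (box_poly z N K).[q] = cexp (box_log z N q) *
    \prod_(ij : 'I_N * 'I_N) (1 + - (z * q ^+ (ij.1 + ij.2).+1) ^+ K).
Proof.
move=> z1 q1; rewrite horner_box_poly /box_log -sumrN cexp_sum -big_split.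
apply: eq_bigr => ij _; set w := z * _.
have w1 : nc w < 1 := le_lt_trans (nc_box_arg _ z1 (ltW q1)) q1.
have w0 : 1 - w != 0 by rewrite subr_eq0; apply: contraTneq w1 => <-; rewrite nc1 ltxx.
rewrite cexpN clogK//; apply: (mulfI w0); rewrite mulVKf//.
by rewrite -opprB mulNr -subrX1 opprB.
Qed.

(** [N] is chosen first, to bring the logarithm of the box close to [Tsum]; [K] comes next, because
    the N^2 factors 1 - w^K left by the truncated geometric sums have to be controlled together. The
    estimate is uniform on the line Re x = t. *)
Lemma box_poly_approx z t n (e : R) : nc z <= 1 -> 0 < t -> 0 < e ->
  exists N K : nat, [/\ (n <= N)%N, (n < K)%N &
    forall x, Re x = t -> nc ((box_poly z N K).[cexp (- x)] - cexp (Tsum z x)) <= e].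
Proof.
move=> z1 t0 e0.
pose B := expR (1 / t ^+ 2 * (5 / 4)); have B0 : 0 < B by exact: expR_gt0.
have [d d0 [d1 Hd]] : exists2 d : R, 0 < d & d <= 1 /\ 
    forall u v : R[i], nc u <= d -> nc v <= d -> B * nc (cexp u * (1 + v) - 1) <= e.
  pose d := Num.min 1 (e / (B * (4 * expR 1 + 1))).
  have c0 : 0 < B * (4 * expR 1 + 1) by rewrite mulr_gt0// addr_gt0// mulr_gt0// expR_gt0.
  have d0 : 0 < d by rewrite lt_min ltr01 divr_gt0.
  have d1 : d <= 1 by rewrite ge_min lexx.
  have dE : d <= e / (B * (4 * expR 1 + 1)) by rewrite ge_min lexx orbT.
  exists d => //; split=> // u v ud vd.
  have -> : cexp u * (1 + v) - 1 = (cexp u - 1) * (1 + v) + v by ring.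
  have h1 := nc_cexp_small (le_trans ud d1).
  have h2 : nc (1 + v) <= 2 by apply: le_trans (ncD _ _) _; rewrite nc1; lra.
  have h3 : nc ((cexp u - 1) * (1 + v) + v) <= d * (4 * expR 1 + 1).
    apply: le_trans (ncD _ _) _; rewrite ncM.
    have := expR_gt0 (1 : R); have := nc_ge0 (cexp u - 1); have := nc_ge0 u.
    have : nc (cexp u - 1) * nc (1 + v) <= (2 * expR 1 * d) * 2.
      apply: ler_pM; rewrite ?nc_ge0//; apply: le_trans h1 _.
      by rewrite ler_wpM2l// mulr_ge0// expR_ge0.
    lra.
  apply: le_trans (ler_wpM2l (ltW B0) h3) _.
  by move: dE; rewrite ler_pdivlMr// => dE; rewrite mulrCA.
have [N nN HN] : exists2 N : nat, (n <= N)%N & 3 * expR (- (N%:R * t)) * (1 / t ^+ 2 * (5 / 4)) <= d.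
  have : 3 * expR (- t) ^+ N * (1 / t ^+ 2 * (5 / 4)) @[N --> \oo] --> (3 * 0 * (1 / t ^+ 2 * (5 / 4)) : R).
    apply: cvgM; last exact: cvg_cst.
    apply: cvgM; first exact: cvg_cst.
    by apply: cvg_expr; rewrite ger0_norm ?expR_ge0// expR_lt1 oppr_lt0.
  rewrite mulr0 mul0r => /cvgr_lt/(_ _ d0) [m _ Hm].
  exists (maxn n m); first exact: leq_maxl.
  rewrite -mulrN expRM_natl; apply: ltW; apply: Hm => /=; exact: leq_maxr.
pose r := expR (- t).
have r1 : r < 1 by rewrite expR_lt1 oppr_lt0.
have [K nK HK] : exists2 K : nat, (n < K)%N & (1 + r ^+ K) ^+ #|{: 'I_N * 'I_N}| - 1 <= d.
  have : (1 + r ^+ K) ^+ #|{: 'I_N * 'I_N}| - 1 @[K --> \oo] --> ((1 + 0) ^+ #|{: 'I_N * 'I_N}| - 1 : R).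
    apply: cvgB; last exact: cvg_cst.
    apply: (cvg_comp _ (fun s : R => s ^+ #|{: 'I_N * 'I_N}|)); last exact: exprn_continuous.
    apply: cvgD; first exact: cvg_cst.
    by apply: cvg_expr; rewrite ger0_norm ?expR_ge0.
  rewrite addr0 expr1n subrr => /cvgr_lt/(_ _ d0) [m _ Hm].
  exists (maxn n.+1 m); first exact: leq_maxl.
  by apply: ltW; apply: Hm => /=; exact: leq_maxr.
exists N, K; split=> // x xt.
have x0 : 0 < Re x by rewrite xt.
have q1 : nc (cexp (- x)) < 1 by rewrite nc_cexp ReN expR_lt1 oppr_lt0.
rewrite horner_box_log//; set P := \prod_ij _.
pose u := box_log z N (cexp (- x)) - Tsum z x.
have -> : cexp (box_log z N (cexp (- x))) = cexp (Tsum z x) * cexp u.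
  by rewrite -cexpD /u addrC subrK.
rewrite -mulrA -{2}(mulr1 (cexp (Tsum z x))) -mulrBr ncM.
have -> : P = 1 + (P - 1) by rewrite addrC subrK.
apply: le_trans (Hd u (P - 1) _ _).
- rewrite ler_wpM2r ?nc_ge0// nc_cexp ler_expR -xt.
  exact: le_trans (Re_le _) (Tsum_le z1 x0).
- by apply: le_trans (box_log_Tsum N z1 x0) _; rewrite xt.
- apply: le_trans HK; apply: nc_prod_sub1 => ij.
  rewrite ncN ncX lerXn2r ?nnegrE ?nc_ge0 ?expR_ge0//.
  have -> : r = nc (cexp (- x)) by rewrite nc_cexp ReN xt.
  by apply: nc_box_arg => //; exact: ltW.
Qed.

End ProductApproximation.

(** * Gaussian integrals and the saddle point method *)

Section Integrals.
Context {R : realType}.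
Implicit Types (a b x y : R).

Lemma oneDsqr_ge0 x : 0 <= oneDsqr x.
Proof. exact: le_trans ler01 (oneDsqr_ge1 x). Qed.

Lemma integrable_oneDsqrV : mu.-integrable setT (EFin \o (fun x => (oneDsqr x)^-1)).
Proof.
apply/integrableP; split.
  by apply/measurable_EFinP; apply: continuous_measurable_fun; exact: continuous_oneDsqrV.
under eq_integral do rewrite /= ger0_norm ?invr_ge0 ?oneDsqr_ge0//.
rewrite (@ge0_symfun_integralT R (fun x => (oneDsqr x)^-1)).
- rewrite (_ : [set x | _] = `[0, +oo[%classic); last first.
    by apply/seteqP; split => x/=; rewrite in_itv/= andbT.
  by rewrite integral0y_oneDsqr -EFinM ltry.
- by move=> x; rewrite invr_ge0 oneDsqr_ge0.
- exact: continuous_oneDsqrV.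
- by move=> x /=; rewrite /oneDsqr sqrrN.
Qed.

Lemma integrable_le_oneDsqrV (f : R -> R) M : measurable_fun setT f ->
  (forall x, `|f x| <= M * (oneDsqr x)^-1) -> mu.-integrable setT (EFin \o f).
Proof.
move=> mf fM.
have iM : mu.-integrable setT (EFin \o (fun x => M * (oneDsqr x)^-1)).
  under [X in _.-integrable _ X]eq_fun do rewrite /= EFinM.
  by apply: integrableZl => //; exact: integrable_oneDsqrV.
apply: (le_integrable _ _ _ iM) => //; first exact/measurable_EFinP.
by move=> x _ /=; rewrite lee_fin (le_trans (fM x))// ler_norm.
Qed.

(** The integrands need a majorant only on their own windows, since they are extended by zero
    outside. All majorants below are multiples of 1/(1 + x^2). *)
Lemma dominated_itv (f_ : nat -> R -> R) (f : R -> R) (a_ b_ : nat -> R) M :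
  (forall n, continuous (f_ n)) -> measurable_fun setT f ->
  (forall n x, a_ n <= x <= b_ n -> `|f_ n x| <= M * (oneDsqr x)^-1) ->
  (forall x, \forall n \near \oo, a_ n <= x <= b_ n) ->
  (forall x, f_ n x @[n --> \oo] --> f x) ->
  mu.-integrable setT (EFin \o f) /\
  \int[mu]_(x in `[a_ n, b_ n]) f_ n x @[n --> \oo] --> \int[mu]_x f x.
Proof.
move=> cf mf fM ab ff.
have M0 : 0 <= M.
  have [n _ /(_ n (leqnn n)) /= h] := ab 0; have := fM n 0 h.
  by rewrite /oneDsqr expr0n addr0 invr1 mulr1; exact: le_trans.
have iM : mu.-integrable setT (EFin \o (fun x => M * (oneDsqr x)^-1)).
  under [X in _.-integrable _ X]eq_fun do rewrite /= EFinM.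
  by apply: integrableZl => //; exact: integrable_oneDsqrV.
pose g_ n x : R := (f_ n \_ `[a_ n, b_ n]) x.
have g_E n x : a_ n <= x <= b_ n -> g_ n x = f_ n x.
  by move=> h; rewrite /g_ patchE mem_set//= in_itv.
have g_0 n x : ~~ (a_ n <= x <= b_ n) -> g_ n x = 0.
  by move=> h; rewrite /g_ patchE memNset//= in_itv; exact/negP.
have [||||i1 _ i3] := @dominated_convergence _ _ R mu setT measurableT
    (fun n x => (g_ n x)%:E) (fun x => (f x)%:E) (fun x => (M * (oneDsqr x)^-1)%:E) _ _ _ iM _.
- move=> n; apply/measurable_EFinP; apply/(measurable_restrictT _ _).1 => //.
  by apply: measurable_funTS; exact: continuous_measurable_fun.
- exact/measurable_EFinP.
- apply: aeW => x _; apply: cvg_EFin; first exact: nearW.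
  apply: cvg_trans (ff x); apply: near_eq_cvg.
  by near=> n; rewrite /= g_E//; near: n; exact: ab.
- apply: aeW => x n _; rewrite lee_fin.
  have [h|h] := boolP (a_ n <= x <= b_ n); first by rewrite g_E// fM.
  by rewrite g_0// normr0 mulr_ge0// invr_ge0 oneDsqr_ge0.
split=> //.
have -> : (fun n => \int[mu]_(x in `[a_ n, b_ n]) f_ n x) = (fun n => fine (\int[mu]_x (g_ n x)%:E)).
  by apply/funext => n; rewrite Rintegral_mkcond.
apply: fine_cvg; rewrite fineK//; exact: integrable_fin_num.
Unshelve. all: by end_near. Qed.

Lemma FTC_le (f F : R -> R) a b : a < b -> (forall x, is_derive x 1 F (f x)) -> continuous f ->
  \int[mu]_(x in `[a, b]) f x = F b - F a.
Proof.
move=> ab DF cf; rewrite /Rintegral (@continuous_FTC2 _ f F)//.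
- by apply: continuous_subspaceT.
- have cF x : {for x, continuous F}.
    by apply: differentiable_continuous; apply/derivable1_diffP; have [] := DF x.
  split=> [x _||]; first by have [] := DF x.
    by apply: cvg_at_right_filter; exact: cF.
  by apply: cvg_at_left_filter; exact: cF.
- by move=> x _; rewrite derive1E; have [_ ->] := DF x.
Qed.

Lemma derivC_continuous (f : R -> R[i]) df : (forall x, derivC f x (df x)) ->
  continuous (fun x => Re (f x)) /\ continuous (fun x => Im (f x)).
Proof.
move=> D; split=> x; apply: differentiable_continuous; apply/derivable1_diffP.
  by have [[]] := D x.
by have [_ []] := D x.
Qed.

Lemma derivCM (f g : R -> R[i]) x d e : derivC f x d -> derivC g x e ->
  derivC (fun r => f r * g r) x (d * g x + f x * e).
Proof.
move=> [D1 D2] [E1 E2]; split.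
  under eq_fun do rewrite ReM.
  apply: (is_derive_eq (is_deriveB (is_deriveM D1 E1) (is_deriveM D2 E2))).
  by rewrite ReD !ReM /GRing.scale /=; ring.
under eq_fun do rewrite ImM.
apply: (is_derive_eq (is_deriveD (is_deriveM D1 E2) (is_deriveM D2 E1))).
by rewrite ImD !ImM /GRing.scale /=; ring.
Qed.

Lemma derivC_cst (z : R[i]) x : derivC (fun=> z) x 0.
Proof. by split; exact: is_derive_cst. Qed.

Lemma derivCZ (f : R -> R[i]) x d (z : R[i]) : derivC f x d -> derivC (fun r => z * f r) x (z * d).
Proof.
by move=> D; have := derivCM (derivC_cst z x) D; rewrite mul0r add0r.
Qed.

Lemma derivC_cexp_affine (z w : R[i]) x :
  derivC (fun r => cexp (z + r%:C * w)) x (w * cexp (z + x%:C * w)).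
Proof.
under eq_fun do rewrite cexpD; rewrite cexpD mulrCA.
by apply: derivCZ; exact: derivC_cexp.
Qed.

End Integrals.

(** * Gaussian integrals with a complex parameter *)

Section ComplexGauss.
Context {R : realType}.
Implicit Types (a b x y : R).

Definition cint (f : R -> R[i]) : R[i] :=
  (\int[mu]_x Re (f x)) +i* (\int[mu]_x Im (f x)).

Definition cintegrable (f : R -> R[i]) : Prop :=
  mu.-integrable setT (EFin \o (fun x => Re (f x))) /\
  mu.-integrable setT (EFin \o (fun x => Im (f x))).

Lemma cintD f g : cintegrable f -> cintegrable g ->
  cint (fun x => f x + g x) = cint f + cint g.
Proof.
move=> [f1 f2] [g1 g2]; apply: complexP; rewrite /cint /=.
  by under eq_Rintegral do rewrite ReD; rewrite RintegralD.
by under eq_Rintegral do rewrite ImD; rewrite RintegralD.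
Qed.

Lemma cintZ (z : R[i]) f : cintegrable f -> cint (fun x => z * f x) = z * cint f.
Proof.
have iZ (r : R) g : mu.-integrable setT (EFin \o g) -> mu.-integrable setT (EFin \o (fun x => r * g x)).
  move=> ig; under [X in _.-integrable _ X]eq_fun do rewrite /= EFinM.
  exact: integrableZl.
move=> [f1 f2]; apply: complexP; rewrite /cint ?ReM ?ImM /=.
  under eq_Rintegral do rewrite ReM.
  by rewrite RintegralB//; [rewrite !RintegralZl|exact: iZ|exact: iZ].
under eq_Rintegral do rewrite ImM.
by rewrite RintegralD//; [rewrite !RintegralZl|exact: iZ|exact: iZ].
Qed.

Definition cgauss a y : R[i] := cexp ((y ^+ 2)%:C * (-1 +i* a)).

Lemma cgaussE a y :
  cgauss a y = (expR (- y ^+ 2) * cos (a * y ^+ 2)) +i* (expR (- y ^+ 2) * sin (a * y ^+ 2)).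
Proof. by rewrite /cgauss cexpE ReZ ImZ /= mulrN1 [a * _]mulrC. Qed.

Lemma nc_cgauss a y : nc (cgauss a y) = expR (- y ^+ 2).
Proof. by rewrite /cgauss nc_cexp ReZ /= mulrN1. Qed.

Lemma expRN_decay x : 0 <= x -> expR (- x) <= 4 / (1 + x) /\ x * expR (- x) <= 4 / (1 + x).
Proof.
move=> x0; have p1 : 0 < 1 + x by rewrite ltr_wpDr.
have h := expR_ge1Dxn 1 x0; have e0 := expR_gt0 x.
rewrite expRN; split.
  rewrite -[X in X <= _]mul1r ler_pdivrMr// mulrAC ler_pdivlMr//.
  by have := expR_ge1Dx x; move: h; rewrite (_ : 2`!%:R = 2)//; nra.
rewrite ler_pdivrMr// mulrAC ler_pdivlMr//.
by move: h; rewrite (_ : 2`!%:R = 2)//; nra.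
Qed.

Lemma derivC_cgauss a y :
  derivC (cgauss a) y ((2 * y)%:C * (-1 +i* a) * cgauss a y).
Proof.
have D2 : is_derive y 1 (fun y : R => y ^+ 2) (2 * y).
  have -> : (fun y : R => y ^+ 2) = (id : R -> R) ^+ 2.
    by apply/funext => t; rewrite exprfctE.
  by apply: is_derive_eq; rewrite /GRing.scale /= mulr1 expr1.
have D : is_derive y 1 (fun y : R => - y ^+ 2) (- (2 * y)) by exact: is_deriveN.
have Da : is_derive y 1 (fun y : R => a * y ^+ 2) (a * (2 * y)) by exact: is_deriveZ.
have De := @is_derive1_comp R expR _ y _ _ (is_derive_expR (- y ^+ 2)) D.
have Dc := @is_derive1_comp R cos _ y _ _ (is_derive_cos (a * y ^+ 2)) Da.
have Ds := @is_derive1_comp R sin _ y _ _ (is_derive_sin (a * y ^+ 2)) Da.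
rewrite cgaussE.
have -> : cgauss a = fun y =>
    (expR (- y ^+ 2) * cos (a * y ^+ 2)) +i* (expR (- y ^+ 2) * sin (a * y ^+ 2)).
  by apply/funext => t; exact: cgaussE.
split; rewrite -mulrA ?ReZ ?ImZ ?ReM ?ImM /=.
  by apply: (is_derive_eq (is_deriveM De Dc)); rewrite /GRing.scale /=; ring.
by apply: (is_derive_eq (is_deriveM De Ds)); rewrite /GRing.scale /=; ring.
Qed.

Lemma cintegrable_le (f : R -> R[i]) M :
  continuous (fun x => Re (f x)) -> continuous (fun x => Im (f x)) ->
  (forall x, nc (f x) <= M * (oneDsqr x)^-1) -> cintegrable f.
Proof.
move=> c1 c2 fM; split; apply: (@integrable_le_oneDsqrV _ _ M).
- exact: continuous_measurable_fun.
- by move=> x; apply: le_trans (normr_Re _) (fM x).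
- exact: continuous_measurable_fun.
- by move=> x; apply: le_trans (normr_Im _) (fM x).
Qed.

Lemma cgauss_le a y : nc (cgauss a y) <= 4 * (oneDsqr y)^-1.
Proof. by rewrite nc_cgauss; have [] := expRN_decay (sqr_ge0 y). Qed.

Lemma cgauss_sqr_le a y : nc ((y ^+ 2)%:C * cgauss a y) <= 4 * (oneDsqr y)^-1.
Proof.
by rewrite ncM nc_real ger0_norm ?sqr_ge0// nc_cgauss; have [] := expRN_decay (sqr_ge0 y).
Qed.

Lemma cintegrable_cgauss a : cintegrable (cgauss a).
Proof.
have [? ?] := derivC_continuous (derivC_cgauss a).
by apply: cintegrable_le (cgauss_le a).
Qed.

Lemma derivC_sqr y : derivC (fun y => (y ^+ 2)%:C) y (2 * y)%:C.
Proof.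
have D2 : is_derive y 1 (fun y : R => y ^+ 2) (2 * y).
  have -> : (fun y : R => y ^+ 2) = (id : R -> R) ^+ 2.
    by apply/funext => t; rewrite exprfctE.
  by apply: is_derive_eq; rewrite /GRing.scale /= mulr1 expr1.
by split => //=; exact: is_derive_cst.
Qed.

Lemma cintegrable_cgauss_sqr a : cintegrable (fun y => (y ^+ 2)%:C * cgauss a y).
Proof.
have [? ?] := derivC_continuous (fun y => derivCM (derivC_sqr y) (derivC_cgauss a y)).
by apply: cintegrable_le (cgauss_sqr_le a).
Qed.

(** The combined integrand is the derivative of y times [cgauss a y], which tends to 0 at both
    ends. *)
Lemma cgauss_parts a :
  cint (cgauss a) + 2 * (-1 +i* a) * cint (fun y => (y ^+ 2)%:C * cgauss a y) = 0.
Proof.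
rewrite -cintZ; last exact: cintegrable_cgauss_sqr.
rewrite -cintD; [|exact: cintegrable_cgauss|]; last first.
  have [D1 D2] := derivC_continuous (fun y => derivCZ (2 * (-1 +i* a))
    (derivCM (derivC_sqr y) (derivC_cgauss a y))).
  apply: (cintegrable_le D1 D2 (M := nc (2 * (-1 +i* a)) * 4)) => x.
  by rewrite ncM -mulrA ler_wpM2l ?nc_ge0// cgauss_sqr_le.
pose F y : R[i] := y%:C * cgauss a y.
pose f y : R[i] := cgauss a y + 2 * (-1 +i* a) * ((y ^+ 2)%:C * cgauss a y).
have Dy y : derivC (fun y : R => y%:C) y 1.
  by split => /=; [exact: is_derive_id|exact: is_derive_cst].
have DF y : derivC F y (f y).
  have := derivCM (Dy y) (derivC_cgauss a y); rewrite mul1r.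
  congr derivC; rewrite /f; congr (_ + _); rewrite rmorphXn rmorphM /=.
  by rewrite (real_natC 2); ring.
have [cf1 cf2] := derivC_continuous (fun y => derivCD (derivC_cgauss a y) (derivCZ (2 * (-1 +i* a))
    (derivCM (derivC_sqr y) (derivC_cgauss a y)))).
pose M := 4 + nc (2 * (-1 +i* a)) * 4.
have fM y : nc (f y) <= M * (oneDsqr y)^-1.
  apply: le_trans (ncD _ _) _; rewrite /M [leRHS]mulrDl; apply: lerD; first exact: cgauss_le.
  rewrite ncM -mulrA.
  by rewrite ler_wpM2l ?nc_ge0// cgauss_sqr_le.
have Fn : (fun n : nat => nc (F n%:R) + nc (F (- n%:R))) @ \oo --> (0 : R).
  have H8 : 8 * harmonic n @[n --> \oo] --> (0 : R).
    by rewrite -(mulr0 8); apply: cvgM; [exact: cvg_cst|exact: cvg_harmonic].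
  apply: (@squeeze_cvgr _ _ _ _ (cst 0) _ _ _ _ _ H8); last exact: cvg_cst.
  apply: nearW => n; apply/andP; split; first by rewrite addr_ge0 ?nc_ge0.
  have H : n%:R * expR (- n%:R ^+ 2) <= 4 * n.+1%:R^-1 :> R.
    have n2 : (n%:R : R) <= n%:R ^+ 2 by rewrite -natrX ler_nat -mulnn; case: (n) => // m; rewrite leq_pmulr.
    apply: (@le_trans _ _ (n%:R ^+ 2 * expR (- n%:R ^+ 2))).
      by rewrite ler_wpM2r// expR_ge0.
    have [_ h] := expRN_decay (sqr_ge0 (n%:R : R)).
    have p1 : 0 < 1 + n%:R ^+ 2 :> R by rewrite ltr_wpDr ?sqr_ge0.
    by apply: le_trans h _; rewrite ler_wpM2l// lef_pV2 ?posrE// -natr1 addrC lerD2l.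
  rewrite /F !ncM !nc_real !nc_cgauss normrN sqrrN ger0_norm//.
  apply: le_trans (lerD H H) _; rewrite -mulrDl /harmonic /= le_eqVlt.
  by apply/orP; left; apply/eqP; congr (_ * _); ring.
have lim0 (g G : R -> R) : continuous g -> (forall y, is_derive y 1 G (g y)) ->
    (forall y, `|g y| <= M * (oneDsqr y)^-1) ->
    (forall y, `|G y| <= nc (F y)) -> \int[mu]_x g x = 0.
  move=> cg DG gM GF.
  have [|_ L] := @dominated_itv R (fun=> g) g (fun n => - n.+1%:R) (fun n => n.+1%:R) M
    (fun=> cg) (continuous_measurable_fun cg) (fun _ x _ => gM x) _ (fun x => cvg_cst (g x)).
    move=> x; exists (Num.truncn `|x|) => // n /= h.
    rewrite -ler_norml; apply: ltW; apply: lt_le_trans (truncnS_gt _) _.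
    by rewrite ler_nat.
  have {}L : (fun n : nat => G n.+1%:R - G (- n.+1%:R)) @ \oo --> \int[mu]_x g x.
    have -> : (fun n : nat => G n.+1%:R - G (- n.+1%:R)) =
       (fun n => \int[mu]_(x in `[- n.+1%:R, n.+1%:R]) g x).
      by apply/funext => n; rewrite (FTC_le _ DG cg)// gtrN.
    exact: L.
  rewrite -(cvg_lim (@Rhausdorff R) L); apply: cvg_lim => //.
  apply: norm_cvg0.
  have Fn' : (fun n : nat => nc (F n.+1%:R) + nc (F (- n.+1%:R))) @ \oo --> (0 : R).
    by rewrite (cvg_shiftS (fun n : nat => nc (F n%:R) + nc (F (- n%:R)))).
  apply: (@squeeze_cvgr _ _ _ _ (cst 0) _ _ _ _ _ Fn'); last exact: cvg_cst.
  apply: nearW => n /=; rewrite normr_ge0 /=.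
  by apply: le_trans (ler_normB _ _) _; rewrite lerD.
apply: complexP; rewrite /cint /=.
  apply: (lim0 (fun y => Re (f y)) (fun y => Re (F y)) cf1) => y.
  - by have [] := DF y.
  - exact: le_trans (normr_Re _) (fM y).
  - exact: normr_Re.
apply: (lim0 (fun y => Im (f y)) (fun y => Im (F y)) cf2) => y.
- by have [] := DF y.
- exact: le_trans (normr_Im _) (fM y).
- exact: normr_Im.
Qed.

Lemma derivC_cint_cgauss a :
  derivC (fun a => cint (cgauss a)) a ('i * cint (fun y => (y ^+ 2)%:C * cgauss a y)).
Proof.
have key (f df : R -> R -> R) :
    (forall x, mu.-integrable setT (EFin \o f x)) ->
    (forall x y, is_derive x 1 (f ^~ y) (df x y)) ->
    (forall x y, `|df x y| <= 4 * (oneDsqr y)^-1) ->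
    is_derive a 1 (fun x => \int[mu]_y f x y) (\int[mu]_y df a y).
  move=> If Df dfM.
  have Ia : `]a - 1, a + 1[%classic a by rewrite /= in_itv /=; apply/andP; split; lra.
  have D1 x y : derivable (f ^~ y) x 1 by have [] := Df x y.
  have D2 x y : partial1of2 f x y = df x y by rewrite partial1of2E; have [_ ->] := Df x y.
  have G0 y : 0 <= 4 * (oneDsqr y)^-1 :> R by rewrite mulr_ge0// invr_ge0 oneDsqr_ge0.
  have IG : mu.-integrable setT (EFin \o (fun x => 4 * (oneDsqr x)^-1 : R)).
    under [X in _.-integrable _ X]eq_fun do rewrite /= EFinM.
    by apply: integrableZl => //; exact: integrable_oneDsqrV.
  have GU x y : `]a - 1, a + 1[%classic x -> [set: R] y -> `|partial1of2 f x y| <= 4 * (oneDsqr y)^-1.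
    by rewrite D2.
  apply: DeriveDef.
    exact: (@derivable_under_integral R _ _ mu f setT measurableT a (a - 1) (a + 1) Ia
     (fun x _ => If x) (fun x y _ _ => D1 x y) _ G0 IG GU).
  rewrite -derive1E (@differentiation_under_integral R _ _ mu f setT measurableT a (a - 1) (a + 1) Ia
     (fun x _ => If x) (fun x y _ _ => D1 x y) _ G0 IG GU).
  by apply: eq_Rintegral => y _; rewrite D2.
have Dcg x y : derivC (fun a => cgauss a y) x ('i * ((y ^+ 2)%:C * cgauss x y)).
  have -> : (fun a => cgauss a y) = (fun a => cexp ((- y ^+ 2)%:C + a%:C * ('i * (y ^+ 2)%:C))).
    apply/funext => b; congr cexp; apply: complexP; rewrite /= ; ring.
  have -> : cgauss x y = cexp ((- y ^+ 2)%:C + x%:C * ('i * (y ^+ 2)%:C)).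
    by congr cexp; apply: complexP; rewrite /=; ring.
  by rewrite mulrA; exact: derivC_cexp_affine.
have bd x y : nc ('i * ((y ^+ 2)%:C * cgauss x y)) <= 4 * (oneDsqr y)^-1.
  rewrite ncM (_ : nc 'i = 1) ?mul1r ?cgauss_sqr_le//.
  by rewrite /= expr0n expr1n add0r sqrtr1.
rewrite -cintZ; last exact: cintegrable_cgauss_sqr.
split; rewrite /cint /=.
  apply: (key (fun x y => Re (cgauss x y)) (fun x y => Re ('i * ((y ^+ 2)%:C * cgauss x y)))) => x.
  - by have [] := cintegrable_cgauss x.
  - by move=> y; have [] := Dcg x y.
  - by move=> y; apply: le_trans (normr_Re _) (bd x y).
apply: (key (fun x y => Im (cgauss x y)) (fun x y => Im ('i * ((y ^+ 2)%:C * cgauss x y)))) => x.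
- by have [] := cintegrable_cgauss x.
- by move=> y; have [] := Dcg x y.
- by move=> y; apply: le_trans (normr_Im _) (bd x y).
Qed.

Lemma cint_cgauss0 : cint (cgauss 0) = (Num.sqrt pi)%:C.
Proof.
transitivity ((Num.sqrt pi) +i* 0 : R[i]) => //; congr (_ +i* _).
  under eq_Rintegral do rewrite cgaussE /= mul0r cos0 mulr1.
  by rewrite /Rintegral integralT_gauss.
under eq_Rintegral do rewrite cgaussE /= mul0r sin0 mulr0.
by rewrite /Rintegral integral0.
Qed.

(** Differentiation under the integral gives J' = i M with M the second moment, and integration by
    parts gives J = 2(1 - i a)M; hence (1 - i a)J^2 has derivative zero in [a], and its value at 0
    is the classical integral. *)
Lemma cint_cgauss_sqr a : (1 -i* a) * cint (cgauss a) ^+ 2 = pi%:C.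
Proof.
have D b : derivC (fun a => (1 -i* a) * cint (cgauss a) ^+ 2) b 0.
  have D1 : derivC (fun a => 1 -i* a) b (- 'i).
    split => /=; first by rewrite oppr0; exact: is_derive_cst.
    exact: is_deriveN.
  have J := derivC_cint_cgauss b.
  have := derivCM D1 (derivCM J J); congr derivC.
  have E : cint (cgauss b) = 2 * (1 -i* b) * cint (fun y => (y ^+ 2)%:C * cgauss b y).
    have -> : (1 -i* b) = - (-1 +i* b) :> R[i] by apply: complexP; rewrite /= ?opprK.
    by apply/eqP; rewrite mulrN mulNr -addr_eq0 cgauss_parts.
  rewrite E; ring.
have -> : pi%:C = (1 -i* 0) * cint (cgauss 0) ^+ 2 :> R[i].
  by rewrite cint_cgauss0 oppr0 mul1r -rmorphXn /= sqr_sqrtr// pi_ge0.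
apply: complexP.
  exact: (@is_derive_0_is_cst R (fun a => Re ((1 -i* a) * cint (cgauss a) ^+ 2)) a 0
    (fun b => proj1 (D b))).
exact: (@is_derive_0_is_cst R (fun a => Im ((1 -i* a) * cint (cgauss a) ^+ 2)) a 0
    (fun b => proj2 (D b))).
Qed.

(** This selects the branch of the square root. A purely imaginary J would give (1 - i a)J^2 a
    nonpositive real part instead of pi, so Re J never vanishes; it is continuous in [a] and
    positive at 0. *)
Lemma Re_cint_cgauss_gt0 a : 0 < Re (cint (cgauss a)).
Proof.
have n0 b : Re (cint (cgauss b)) != 0.
  apply/eqP => J0; have := cint_cgauss_sqr b; have := pi_gt0 R.
  move: J0; case: (cint (cgauss b)) => u v /= -> p0 [E1 _].
  by have := sqr_ge0 v; nra.
have [c1 _] := derivC_continuous derivC_cint_cgauss.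
have J0 : 0 < Re (cint (cgauss 0)) by rewrite cint_cgauss0 /= sqrtr_gt0 pi_gt0.
rewrite ltNge; apply/negP => Ja.
have cw x y : {within `[x, y], continuous (fun a => Re (cint (cgauss a)))}.
  by apply: continuous_subspaceT => z; exact: c1.
have [a0|a0] := leP a 0.
  have [|c _ /eqP] := @IVT R _ a 0 0 a0 (cw _ _); last by rewrite (negbTE (n0 c)).
  by rewrite ge_min Ja /= le_max (ltW J0) orbT.
have [|c _ /eqP] := @IVT R _ 0 a 0 (ltW a0) (cw _ _); last by rewrite (negbTE (n0 c)).
by rewrite ge_min Ja orbT /= le_max (ltW J0).
Qed.

End ComplexGauss.

(** * Coefficients of a polynomial as integrals *)

Section CoefficientIntegral.
Context {R : realType}.
Implicit Types (x y a k : R).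

Lemma cexp_2pi_i (m : nat) : cexp ((m%:R * (2 * pi))*i) = 1 :> R[i].
Proof.
have -> : (m%:R * (2 * pi))*i = m%:R * (2 * pi)*i :> R[i].
  by rewrite -real_natC; apply: complexP; rewrite /= ?mul0r ?mulr0 ?subr0 ?addr0.
rewrite cexpM_nat cexpE /= expR0 !mul1r.
by rewrite mulr_natl cos2pi sin2pi expr1n.
Qed.

Lemma coef_integrand_continuous (Q : {poly R[i]}) (t c : R[i]) k n :
  continuous (fun y => Re (Q.[cexp (- (t + (k * y)*i))] * cexp (n%:R * (t + (k * y)*i)) * c)).
Proof.
pose d (m : nat) : R[i] := n%:R - m%:R.
pose u (m : nat) y : R[i] := cexp (d m * t + y%:C * (d m * k*i)).
have fE y : Q.[cexp (- (t + (k * y)*i))] * cexp (n%:R * (t + (k * y)*i)) * c =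
    \sum_(m < size Q) Q`_m * c * u m y.
  have -> : (k * y)*i = y%:C * k*i by apply: complexP => /=; ring.
  rewrite horner_coef !mulr_suml; apply: eq_bigr => m _.
  have <- : cexp (- (t + y%:C * k*i)) ^+ m * cexp (n%:R * (t + y%:C * k*i)) = u m y.
    by rewrite -cexpM_nat -cexpD /u /d; congr cexp; ring.
  by ring.
have -> : (fun y => Re (Q.[cexp (- (t + (k * y)*i))] * cexp (n%:R * (t + (k * y)*i)) * c)) =
    (fun y => Re (\sum_(m < size Q) Q`_m * c * u m y)).
  by apply/funext => y; rewrite fE.
have [] // := derivC_continuous (fun y =>
   @derivC_sum R (fun m y => Q`_m * c * u m y) (fun m => Q`_m * c * (d m * k*i * u m y)) y (size Q)
     (fun m _ => derivCZ (Q`_m * c) (derivC_cexp_affine _ _ y))).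
Qed.

(** Cauchy's formula over one full period with an arbitrary starting point. The constant [c] gives
    access to either component of the coefficient through a real integral. *)
Lemma coef_integral (Q : {poly R[i]}) (t c : R[i]) k a n : 0 < k ->
  \int[mu]_(y in `[a, a + 2 * pi / k])
     Re (Q.[cexp (- (t + (k * y)*i))] * cexp (n%:R * (t + (k * y)*i)) * c) =
  2 * pi / k * Re (Q`_n * c).
Proof.
move=> k0; have p0 := pi_gt0 R.
have ab : a < a + 2 * pi / k by rewrite ltrDl !mulr_gt0// invr_gt0.
pose d (m : nat) : R[i] := n%:R - m%:R.
pose u (m : nat) y : R[i] := cexp (d m * t + y%:C * (d m * k*i)).
have tE y : t + (k * y)*i = t + y%:C * k*i.
  by congr (_ + _); apply: complexP; rewrite /= ?mul0r ?mulr0 ?subrr ?addr0// mulrC.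
have uE m y : cexp (- (t + (k * y)*i)) ^+ m * cexp (n%:R * (t + (k * y)*i)) = u m y.
  by rewrite -cexpM_nat -cexpD /u tE /d; congr cexp; ring.
have fE y : Q.[cexp (- (t + (k * y)*i))] * cexp (n%:R * (t + (k * y)*i)) * c =
    \sum_(m < size Q) Q`_m * c * u m y.
  rewrite horner_coef !mulr_suml; apply: eq_bigr => m _.
  by rewrite -uE; ring.
under eq_Rintegral do rewrite fE.
(* The exponential of index [n] is constant, so its antiderivative is linear; those of the others
   are periodic and cancel. *)
pose U (m : nat) y : R[i] := if m == n then y%:C else u m y / (d m * k*i).
pose F y : R[i] := \sum_(m < size Q) Q`_m * c * U m y.
have dk m : m != n -> d m * k*i != 0.
  move=> mn; rewrite mulf_neq0//.
    by rewrite /d subr_eq0 eqr_nat eq_sym.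
  by rewrite eq_complex /= eqxx /= gt_eqF.
have Du m y : derivC (u m) y (d m * k*i * u m y) by exact: derivC_cexp_affine.
have DU m y : derivC (U m) y (u m y).
  rewrite /U; case: (m =P n) => [->|/eqP mn].
    have -> : u n y = 1 by rewrite /u /d subrr !mul0r mulr0 addr0 cexp0.
    by split => /=; [exact: is_derive_id|exact: is_derive_cst].
  have := derivCZ (d m * k*i)^-1 (Du m y); rewrite mulKf ?dk//.
  by under eq_fun do rewrite mulrC.
have DF y : derivC F y (\sum_(m < size Q) Q`_m * c * u m y).
  apply: (@derivC_sum R (fun m y => Q`_m * c * U m y) (fun m => Q`_m * c * u m y)) => m _.
  exact: derivCZ.
have cf : continuous (fun y => Re (\sum_(m < size Q) Q`_m * c * u m y)).
  by have := @coef_integrand_continuous Q t c k n; under [X in continuous X]eq_fun do rewrite fE.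
rewrite (FTC_le ab (fun y => proj1 (DF y)) cf) -ReB -ReZ; congr Re.
rewrite /F -sumrB.
have UE m : U m (a + 2 * pi / k) - U m a = if m == n then (2 * pi / k)%:C else 0.
  rewrite /U; case: (m =P n) => [_|/eqP mn].
    by rewrite -rmorphB addrC addKr.
  suff -> : u m (a + 2 * pi / k) = u m a by rewrite subrr.
  have -> : u m (a + 2 * pi / k) = u m a * cexp ((2 * pi / k)%:C * (d m * k*i)).
    by rewrite /u -cexpD -addrA -mulrDl -rmorphD.
  rewrite -[RHS]mulr1; congr (_ * _).
  have -> : (2 * pi / k)%:C * (d m * k*i) = (n%:R * (2 * pi))*i - (m%:R * (2 * pi))*i.
    rewrite /d -!real_natC -rmorphB; by apply: complexP => /=; field; rewrite gt_eqF.
  by rewrite cexpB !cexp_2pi_i divr1.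
under eq_bigr => m _ do rewrite -mulrBr UE.
have [nQ|Qn] := ltnP n (size Q).
  rewrite (bigD1 (Ordinal nQ))//= eqxx big1 ?addr0 1?mulrC// => m mn.
  by rewrite ifF ?mulr0//; apply/negbTE; apply: contra mn => /eqP mn; apply/eqP/val_inj.
rewrite nth_default// mul0r mulr0 big1// => m _.
by rewrite ifF ?mulr0//; apply/negbTE; rewrite neq_ltn (leq_trans (ltn_ord m)).
Qed.

End CoefficientIntegral.

(** * The saddle point method for one root of unity *)

Section SaddlePoint.
Context {R : realType}.
Implicit Types (y t : R).

Variables (z : R[i]) (l a : R) (H : nat -> R[i]) (t : nat -> R).
Hypotheses (z1 : nc z <= 1) (zn1 : z != 1) (l0 : 0 < l) (a3 : a ^+ 2 < 3)
  (Li3z : Li3 z = (l%:C * (1 +i* a)) ^+ 3) (l4 : 1 / 4 < l ^+ 3)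
  (HE : forall n N K, (n <= N)%N -> (n < K)%N -> (box_poly z N K)`_n = H n)
  (t0 : forall n, 0 < t n) (tn : forall n, n.+1%:R * t n ^+ 3 = 2 * l ^+ 3 :> R)
  (tlim : t n @[n --> \oo] --> (0 : R)).

Let c : R[i] := 1 +i* a.
(** The saddle point is [(t n)%:C * c], with exponent 3Nc. Relative to this value the exponent is -3
    l^3 g^2 y^2 / c to second order; [g] turns it into -(1 - i a)y^2, the exponent of [cgauss a]. *)
Let g : R := Num.sqrt ((1 + a ^+ 2) / (3 * l ^+ 3)).
Let k n : R := g * t n ^+ 2.
Let v n y : R := a + g * t n * y.
Let s n y : R[i] := 1 +i* v n y.
Let tau n y : R[i] := (t n)%:C * c + (k n * y)*i.
Let N n : R := l ^+ 3 / t n ^+ 2.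
Let W : R[i] := cexp ((1 / 12)%:C * clog (1 - z)).

Let l30 : 0 < l ^+ 3. Proof. exact: exprn_gt0. Qed.

Let g0 : 0 < g.
Proof. by rewrite sqrtr_gt0 divr_gt0 ?mulr_gt0// ltr_wpDr ?sqr_ge0. Qed.

Let g2 : l ^+ 3 * g ^+ 2 = (1 + a ^+ 2) / 3.
Proof.
rewrite sqr_sqrtr; last by rewrite divr_ge0 ?addr_ge0 ?sqr_ge0// mulr_ge0// ltW.
by field; rewrite gt_eqF.
Qed.

Let tauE n y : tau n y = (t n)%:C * s n y.
Proof. by apply: complexP; rewrite /tau /s /v /k /=; ring. Qed.

Let Re_tau n y : Re (tau n y) = t n.
Proof. by rewrite tauE ReZ /= mulr1. Qed.

Let Im_tau n y : Im (tau n y) = t n * v n y.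
Proof. by rewrite tauE ImZ. Qed.

Let k0 n : 0 < k n. Proof. by rewrite mulr_gt0// exprn_gt0. Qed.

Let s_neq0 n y : s n y != 0.
Proof. by rewrite eq_complex /= oner_eq0. Qed.

Let t_neq0 n : (t n)%:C != 0 :> R[i].
Proof. by rewrite -nc_gt0 nc_real normr_gt0 gt_eqF. Qed.

Let nt n : n.+1%:R * t n = 2 * N n.
Proof. by rewrite /N mulrA -(tn n); field; rewrite gt_eqF. Qed.

Let NE n y : R[i] := - (((1 + a ^+ 2) / 3 * y ^+ 2)%:C * (2 * s n y + c) / s n y ^+ 2).

(* With [s] on the line [Re s = 1] and [c = 1 +i* a], one has
   [c^3 / s^2 + 2 s - 3 c = (s - c)^2 (2 s + c) / s^2]. *)
Let exponentE n y :
  Li3 z / tau n y ^+ 2 + n.+1%:R * tau n y - (3 * N n)%:C * c = NE n y.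
Proof.
have Nt : n.+1%:R * tau n y = 2 * (N n)%:C * s n y.
  by rewrite tauE mulrA -!real_natC -!rmorphM nt.
have sc : s n y - c = (g * t n * y)*i by apply: complexP; rewrite /s /v /=; ring.
have sc2 : (s n y - c) ^+ 2 = - ((g * t n * y) ^+ 2)%:C.
  by rewrite sc; apply: complexP => /=; ring.
have -> : NE n y = (N n)%:C * ((s n y - c) ^+ 2 * (2 * s n y + c) / s n y ^+ 2).
  rewrite sc2 /NE -g2 /N !mulNr mulrN; congr (- _); rewrite !mulrA; congr (_ * _ / _).
  rewrite -rmorphM; congr (_%:C); field; by rewrite gt_eqF.
have N2 : (N n)%:C = l%:C ^+ 3 / (t n)%:C ^+ 2 by rewrite /N rmorphM fmorphV !rmorphXn.
have N3 : (3 * N n)%:C = 3 * (N n)%:C :> R[i] by rewrite -(real_natC 3) -rmorphM.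
rewrite Nt Li3z -/c tauE N3 N2.
by field; rewrite s_neq0 t_neq0.
Qed.

(** The numerator is (v + a)^2 + (3 - a^2), so [a3] yields Gaussian decay in [y] as long as v stays
    bounded. *)
Let Re_NE n y : Re (NE n y) =
  - ((1 + a ^+ 2) / 3 * y ^+ 2 * ((v n y ^+ 2 + 2 * a * v n y + 3) / (1 + v n y ^+ 2) ^+ 2)).
Proof.
rewrite /NE ReN -mulrA ReZ; congr (- (_ * _)).
have q0 : 0 < 1 + v n y ^+ 2 by rewrite ltr_wpDr ?sqr_ge0.
have -> : (2 * s n y + c) / s n y ^+ 2 =
   ((1 + v n y ^+ 2)^-1 ^+ 2)%:C * ((2 * s n y + c) * (1 -i* v n y) ^+ 2).
  have sE : s n y * (1 -i* v n y) = (1 + v n y ^+ 2)%:C.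
    by apply: complexP; rewrite /s /=; ring.
  have w0 : (1 + v n y ^+ 2)%:C != 0 :> R[i] by rewrite -nc_gt0 nc_real normr_gt0 gt_eqF.
  have n0 : (1 -i* v n y) != 0 :> R[i] by rewrite eq_complex /= oner_eq0.
  have -> : ((1 + v n y ^+ 2)^-1 ^+ 2)%:C = (1 + v n y ^+ 2)%:C^-1 ^+ 2 :> R[i].
    by rewrite rmorphXn; congr (_ ^+ 2); exact: fmorphV.
  by rewrite -sE; field; rewrite n0 s_neq0.
rewrite ReZ mulrC; congr (_ * _); last by rewrite exprVn.
by rewrite /s /c /=; ring.
Qed.

Let tlim_lt (d : R) : 0 < d -> \forall n \near \oo, t n < d.
Proof. by move=> d0; have := tlim; move=> /cvgr_lt/(_ _ d0). Qed.

Let Phi (Q : nat -> {poly R[i]}) n y : R[i] :=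
  (Q n).[cexp (- tau n y)] * cexp (n.+1%:R * tau n y) * cexp (- ((3 * N n)%:C * c)).

(** The exponents are 2N and -3N: an additive error 1 in the polynomial contributes e^{-N}, which
    tends to 0. *)
Let nc_factor n y : nc (cexp (n.+1%:R * tau n y) * cexp (- ((3 * N n)%:C * c))) = expR (- N n).
Proof.
rewrite -cexpD nc_cexp ReD ReN ReZ Re_natM Re_tau nt /c /=; congr expR; ring.
Qed.

Let nc_factorT n y : nc (cexp (Tsum z (tau n y)) *
    (cexp (n.+1%:R * tau n y) * cexp (- ((3 * N n)%:C * c)))) =
  expR (Re (Tsum z (tau n y)) - N n).
Proof. by rewrite ncM nc_factor nc_cexp -expRD. Qed.

Let factorE n y : cexp (Tsum z (tau n y)) *
    (cexp (n.+1%:R * tau n y) * cexp (- ((3 * N n)%:C * c))) =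
  W * cexp (Tsum z (tau n y) - Li3 z / tau n y ^+ 2 - (1 / 12)%:C * clog (1 - z)) * cexp (NE n y).
Proof. by rewrite /W -!cexpD -exponentE; congr cexp; ring. Qed.

Let N_lim : expR (- N n) @[n --> \oo] --> (0 : R).
Proof.
have L : t n ^+ 2 / l ^+ 3 @[n --> \oo] --> (0 : R).
  rewrite -(mul0r (l ^+ 3)^-1); apply: cvgM; last exact: cvg_cst.
  by rewrite -(mul0r 0); under eq_fun do rewrite expr2; exact: cvgM.
apply: (@squeeze_cvgr _ _ _ _ (cst 0) _ _ _ _ _ L); last exact: cvg_cst.
apply: nearW => n; rewrite /cst expR_ge0 /=.
have N0 : 0 < N n by rewrite divr_gt0// exprn_gt0.
have -> : t n ^+ 2 / l ^+ 3 = (N n)^-1 by rewrite /N invf_div.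
rewrite expRN lef_pV2 ?posrE ?expR_gt0//.
by have := expR_ge1Dx (N n); lra.
Qed.

Let pointwise Q y : (forall n x, Re x = t n -> nc ((Q n).[cexp (- x)] - cexp (Tsum z x)) <= 1) ->
  cvgC (fun n => Phi Q n y) (W * cgauss a y).
Proof.
move=> HQ.
have vlim : v n y @[n --> \oo] --> a.
  rewrite /v -{2}(addr0 a); apply: cvgD; first exact: cvg_cst.
  rewrite -(mul0r y) -(mulr0 g); apply: cvgM; last exact: cvg_cst.
  by apply: cvgM => //; exact: cvg_cst.
have slim : cvgC (fun n => s n y) c by split => //=; exact: cvg_cst.
have c0 : c != 0 by rewrite eq_complex /= oner_eq0.
have NElim : cvgC (fun n => NE n y) ((y ^+ 2)%:C * (-1 +i* a)).
  have -> : (y ^+ 2)%:C * (-1 +i* a) = - (((1 + a ^+ 2) / 3 * y ^+ 2)%:C * (2 * c + c) / c ^+ 2).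
    have E : (1 + a ^+ 2)%:C = c * (1 -i* a) by apply: complexP; rewrite /c /=; ring.
    have E3 : ((1 + a ^+ 2) / 3 * y ^+ 2)%:C = (1 + a ^+ 2)%:C / 3 * (y ^+ 2)%:C :> R[i].
      rewrite (rmorphM _ (_ / _)); congr (_ * _); rewrite (rmorphM _ (1 + _)); congr (_ * _).
      by rewrite -(real_natC 3); exact: fmorphV.
    have Ea : (-1 +i* a) = - (1 -i* a) :> R[i] by apply: complexP; rewrite /= ?opprK.
    rewrite E3 E Ea; field; exact: c0.
  have cc0 : c * c != 0 by rewrite mulf_neq0.
  exact: (cvgCN (cvgCM (cvgCM (cvgC_cst ((1 + a ^+ 2) / 3 * y ^+ 2)%:C)
    (cvgCD (cvgCM (cvgC_cst 2) slim) (cvgC_cst c))) (cvgCV cc0 (cvgCM slim slim)))).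
have errlim : cvgC (fun n => Tsum z (tau n y) - Li3 z / tau n y ^+ 2 - (1 / 12)%:C * clog (1 - z)) 0.
  apply/cvgC_normP; apply/cvgrPdist_le => e e0.
  (* For fixed [y] the slope [v n y] tends to [a], so the cone of aperture |a| + 1 eventually
     contains [tau n y]. *)
  have C0 : 0 < `|a| + 1 by rewrite ltr_wpDl.
  have [d d0 Hd] := Tsum_major z1 zn1 C0 e0.
  have h1 : \forall n \near \oo, t n < d by exact: tlim_lt.
  have h2 : \forall n \near \oo, `|v n y| < `|a| + 1.
    apply: (cvgr_norm_lt _ vlim); by rewrite ltrDl.
  near=> n; rewrite sub0r normrN ger0_norm ?nc_ge0// subr0.
  apply: Hd; rewrite ?Re_tau//; first by apply: ltW; near: n.
  split; rewrite Re_tau ?Im_tau; first exact: ltW.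
  rewrite normrM (gtr0_norm (t0 n)) mulrC ler_pM2r//.
  by apply: ltW; near: n.
have main : cvgC (fun n => cexp (Tsum z (tau n y)) *
    (cexp (n.+1%:R * tau n y) * cexp (- ((3 * N n)%:C * c)))) (W * cgauss a y).
  under eq_fun do rewrite factorE.
  have := cvgCM (cvgCM (cvgC_cst W) (cvgC_cexp errlim)) (cvgC_cexp NElim).
  by rewrite cexp0 mulr1.
have rest : cvgC (fun n => ((Q n).[cexp (- tau n y)] - cexp (Tsum z (tau n y))) *
    (cexp (n.+1%:R * tau n y) * cexp (- ((3 * N n)%:C * c)))) 0.
  apply: (@cvgC_squeeze _ _ _ (fun n => expR (- N n))) => // n.
  rewrite subr0 ncM nc_factor ler_piMl ?expR_ge0// HQ//; exact: Re_tau.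
have L := cvgCD rest main; rewrite add0r in L.
suff E : (fun n => Phi Q n y) = (fun n => ((Q n).[cexp (- tau n y)] - cexp (Tsum z (tau n y))) *
    (cexp (n.+1%:R * tau n y) * cexp (- ((3 * N n)%:C * c))) + cexp (Tsum z (tau n y)) *
    (cexp (n.+1%:R * tau n y) * cexp (- ((3 * N n)%:C * c)))) by rewrite E.
by apply/funext => n; rewrite /Phi; ring.
Unshelve. all: by end_near. Qed.

Let lower n := (- pi - t n * a) / k n.

Let in_window n y : lower n <= y <= lower n + 2 * pi / k n -> `|Im (tau n y)| <= pi.
Proof.
rewrite /lower -mulrDl ler_pdivrMr// ler_pdivlMr// => /andP[h1 h2].
have -> : Im (tau n y) = t n * a + y * k n by rewrite Im_tau /v /k; ring.
rewrite ler_norml; apply/andP; split; lra.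
Qed.

(** There are two regimes. In the cone |v| <= C the expansion and [Re_NE] give Gaussian decay.
    Outside it [Tsum_minor] gives e^{-eta X} with X = 1/t^2, and the window confines |y| to a
    multiple of X, so this too is O(1/(1 + y^2)). *)
Let dominated Q : (forall n x, Re x = t n -> nc ((Q n).[cexp (- x)] - cexp (Tsum z x)) <= 1) ->
  exists M : R, \forall n \near \oo, forall y, `|Im (tau n y)| <= pi ->
    nc (Phi Q n y) <= M * (oneDsqr y)^-1.
Proof.
move=> HQ.
have [c0 c00 Hc0] := @hkern_minor R.
(* Half of the gap between l^3 and 1/4: by the choice of [C] the first term of the logarithm is at
   most eta X outside the cone, and the other half remains as decay. *)
pose eta := (l ^+ 3 - 1 / 4) / 2.
have eta0 : 0 < eta by rewrite divr_gt0// subr_gt0.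
pose C := 1 + 1 / (c0 * eta).
have ce0 : 0 < c0 * eta by rewrite mulr_gt0.
have C1 : 1 <= C by rewrite lerDl divr_ge0// ltW.
have C0 : 0 < C by rewrite (lt_le_trans ltr01).
have HC : 1 / (c0 * C ^+ 2) <= eta.
  rewrite ler_pdivrMr ?mulr_gt0 ?exprn_gt0//.
  have : 1 <= c0 * eta * C by rewrite /C mulrDr mulr1 mul1r divff ?gt_eqF// lerDr ltW.
  nra.
have [d d0 Hd] := Tsum_major z1 zn1 C0 ltr01.
pose rho := (1 + a ^+ 2) / 3 * ((3 - a ^+ 2) / (1 + C ^+ 2) ^+ 2).
have rho0 : 0 < rho.
  rewrite mulr_gt0 ?divr_gt0 ?exprn_gt0 ?subr_gt0//; last by rewrite ltr_wpDr ?sqr_ge0.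
  by rewrite ltr_wpDr ?sqr_ge0.
pose D := (pi + `|a|) / g.
pose M1 := nc W * expR 1 * (1 + 1 / rho).
pose M2 := 4 * (1 + D ^+ 2 / eta ^+ 2).
have M10 : 0 <= M1.
  by rewrite !mulr_ge0 ?nc_ge0 ?expR_ge0// addr_ge0// divr_ge0// ltW.
exists (M1 + M2).
near=> n => y ypi.
have td : t n <= d by apply: ltW; near: n; exact: tlim_lt.
have tl : t n <= 1 by apply: ltW; near: n; apply: tlim_lt.
have X0 : 0 < 1 / t n ^+ 2 by rewrite divr_gt0// exprn_gt0.
set X := 1 / t n ^+ 2 in X0.
have y2 : y ^+ 2 <= D ^+ 2 * X ^+ 2.
  have E : g * t n ^+ 2 * y = Im (tau n y) - t n * a by rewrite Im_tau /v; ring.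
  have h : `|g * t n ^+ 2 * y| <= pi + `|a|.
    rewrite E; apply: le_trans (ler_normB _ _) _; apply: lerD => //.
    by rewrite normrM (gtr0_norm (t0 n)) ler_piMl.
  have h' : `|y| <= D * X.
    move: h; rewrite normrM gtr0_norm ?mulr_gt0 ?exprn_gt0//.
    rewrite mulrC -ler_pdivlMr ?mulr_gt0 ?exprn_gt0// => h; apply: le_trans h _.
    by rewrite le_eqVlt /D /X; apply/orP; left; apply/eqP; field; rewrite !gt_eqF.
  by rewrite -exprMn -(real_normK (num_real y)) lerXn2r ?nnegrE// (le_trans _ h').
have osq : oneDsqr y = 1 + y ^+ 2 by [].
have o0 : 0 < 1 + y ^+ 2 by rewrite ltr_wpDr ?sqr_ge0.
(* [1 + x^2/2 <= expR x] *)
have tail u : 0 <= u -> eta * X <= u -> expR (- u) <= 2 * (1 + D ^+ 2 / eta ^+ 2) / (1 + y ^+ 2).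
  move=> u0 Xu; rewrite expRN -[X in X <= _]mul1r ler_pdivrMr ?expR_gt0//.
  rewrite mulrAC ler_pdivlMr// mul1r.
  have h := expR_ge1Dxn 1 u0; rewrite (_ : 2`!%:R = 2) in h; last by [].
  have X2 : (eta * X) ^+ 2 <= u ^+ 2 by rewrite lerXn2r// nnegrE// mulr_ge0// ltW.
  apply: (@le_trans _ _ (1 + D ^+ 2 * X ^+ 2)); first by rewrite lerD2l.
  have -> : D ^+ 2 * X ^+ 2 = D ^+ 2 / eta ^+ 2 * (eta * X) ^+ 2 by field; rewrite gt_eqF.
  have De : 0 <= D ^+ 2 / eta ^+ 2 by rewrite divr_ge0 ?sqr_ge0.
  set q := D ^+ 2 / eta ^+ 2 in De *; set e := expR u in h *.
  have : q * (eta * X) ^+ 2 <= q * u ^+ 2 by rewrite ler_wpM2l.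
  have : q * u ^+ 2 <= q * (2 * e) by rewrite ler_wpM2l//; lra.
  have : 1 <= e by have := sqr_ge0 u; lra.
  lra.
have NX : N n = l ^+ 3 * X by rewrite /N /X mul1r.
have etaN : eta * X <= N n.
  by rewrite NX ler_pM2r// /eta; have := l30; lra.
have p1 : nc (((Q n).[cexp (- tau n y)] - cexp (Tsum z (tau n y))) *
    (cexp (n.+1%:R * tau n y) * cexp (- ((3 * N n)%:C * c)))) <=
    2 * (1 + D ^+ 2 / eta ^+ 2) / (1 + y ^+ 2).
  rewrite ncM nc_factor; apply: le_trans (tail (N n) _ etaN).
    by rewrite ler_piMl ?expR_ge0// HQ//; exact: Re_tau.
  by rewrite NX mulr_ge0// ltW.
have p2 : nc (cexp (Tsum z (tau n y)) *
    (cexp (n.+1%:R * tau n y) * cexp (- ((3 * N n)%:C * c)))) <=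
    (M1 + 2 * (1 + D ^+ 2 / eta ^+ 2)) / (1 + y ^+ 2).
  have q0 : 0 <= 2 * (1 + D ^+ 2 / eta ^+ 2).
    by rewrite mulr_ge0// addr_ge0// divr_ge0 ?sqr_ge0.
  have [vC|vC] := leP `|v n y| C.
    rewrite factorE !ncM.
    have h1 : nc (cexp (Tsum z (tau n y) - Li3 z / tau n y ^+ 2 - (1 / 12)%:C * clog (1 - z))) <= expR 1.
      rewrite nc_cexp ler_expR; apply: le_trans (Re_le _) _; apply: Hd; rewrite ?Re_tau//.
      split; rewrite Re_tau ?Im_tau; first exact: ltW.
      by rewrite normrM (gtr0_norm (t0 n)) mulrC ler_pM2r.
    have h2 : nc (cexp (NE n y)) <= (1 + 1 / rho) / (1 + y ^+ 2).
      rewrite nc_cexp Re_NE; apply: (@le_trans _ _ (expR (- (rho * y ^+ 2)))).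
        have -> : rho * y ^+ 2 = (1 + a ^+ 2) / 3 * y ^+ 2 * ((3 - a ^+ 2) / (1 + C ^+ 2) ^+ 2).
          by rewrite /rho; ring.
        rewrite ler_expR lerN2 ler_wpM2l//.
          by rewrite mulr_ge0 ?sqr_ge0// divr_ge0// addr_ge0 ?sqr_ge0.
        apply: ler_pM; rewrite ?invr_ge0 ?exprn_ge0 ?subr_ge0 ?(ltW a3) ?addr_ge0 ?sqr_ge0//.
          by have := sqr_ge0 (v n y + a); lra.
        have v2 : v n y ^+ 2 <= C ^+ 2.
          by rewrite -(real_normK (num_real (v n y))) lerXn2r ?nnegrE// ltW.
        have v1 : 0 < 1 + v n y ^+ 2 by rewrite ltr_wpDr ?sqr_ge0.
        rewrite lef_pV2 ?posrE ?exprn_gt0//; last by rewrite ltr_wpDr ?sqr_ge0.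
        by rewrite lerXn2r ?nnegrE ?addr_ge0 ?sqr_ge0// lerD2l.
      have ry : 0 <= rho * y ^+ 2 by rewrite mulr_ge0 ?sqr_ge0// ltW.
      rewrite expRN -[X in X <= _]mul1r ler_pdivrMr ?expR_gt0// mulrAC ler_pdivlMr// [leLHS]mul1r.
      have h := expR_ge1Dx (rho * y ^+ 2).
      apply: (@le_trans _ _ ((1 + 1 / rho) * (1 + rho * y ^+ 2))); last first.
        by rewrite ler_wpM2l// addr_ge0// divr_ge0// ltW.
      have -> : (1 + 1 / rho) * (1 + rho * y ^+ 2) = 1 + y ^+ 2 + (1 / rho + rho * y ^+ 2).
        by field; rewrite gt_eqF.
      by rewrite lerDl addr_ge0// divr_ge0// ltW.
    apply: (@le_trans _ _ (nc W * expR 1 * ((1 + 1 / rho) / (1 + y ^+ 2)))).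
      apply: ler_pM; rewrite ?mulr_ge0 ?nc_ge0//.
      by rewrite ler_wpM2l ?nc_ge0.
    by rewrite mulrA ler_wpM2r ?invr_ge0 ?(ltW o0)// lerDl.
  have Imn : Im (tau n y) != 0.
    rewrite Im_tau mulf_neq0//; first by rewrite gt_eqF.
    apply: contraTneq vC => ->.
    by rewrite normr0 -leNgt ltW.
  have h1 : Re (Tsum z (tau n y)) <= (eta + 1 / 4) * X.
    apply: le_trans (Re_le _) _; apply: le_trans (Tsum_minor z1 _) _; rewrite Re_tau//.
    rewrite -/X mulrDl [1 / 4 * X]mulrC lerD2r; apply: le_trans (Hc0 _ _ ypi Imn) _.
      by rewrite Re_tau.
    apply: (@le_trans _ _ (1 / (c0 * C ^+ 2) * X)); last by rewrite ler_wpM2r// ltW.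
    have vv : C ^+ 2 <= v n y ^+ 2.
      rewrite -(real_normK (num_real (v n y))) lerXn2r ?nnegrE ?(ltW C0) ?(ltW vC)//.
    have -> : 1 / (c0 * C ^+ 2) * X = 1 / (c0 * (C ^+ 2 * t n ^+ 2)).
      by rewrite /X; field; rewrite !gt_eqF.
    have I2 : 0 < c0 * Im (tau n y) ^+ 2 by rewrite pmulr_rgt0// exprn_even_gt0.
    have C2 : 0 < c0 * (C ^+ 2 * t n ^+ 2) by rewrite !mulr_gt0 ?exprn_gt0.
    rewrite !div1r lef_pV2 ?posrE//.
    by rewrite ler_pM2l// Im_tau exprMn mulrC ler_pM2l ?exprn_gt0.
  rewrite nc_factorT.
  have h2 : Re (Tsum z (tau n y)) - N n <= - (eta * X).
    rewrite NX; have -> : l ^+ 3 = 2 * eta + 1 / 4 by rewrite /eta; field.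
    by move: h1; rewrite !mulrDl; lra.
  apply: (@le_trans _ _ (expR (- (eta * X)))); first by rewrite ler_expR.
  apply: le_trans (tail _ _ (lexx _)) _; first by rewrite mulr_ge0// ltW.
  by rewrite ler_wpM2r ?invr_ge0 ?(ltW o0)// lerDr.
have -> : Phi Q n y = ((Q n).[cexp (- tau n y)] - cexp (Tsum z (tau n y))) *
    (cexp (n.+1%:R * tau n y) * cexp (- ((3 * N n)%:C * c))) + cexp (Tsum z (tau n y)) *
    (cexp (n.+1%:R * tau n y) * cexp (- ((3 * N n)%:C * c))) by rewrite /Phi; ring.
apply: le_trans (ncD _ _) _; apply: le_trans (lerD p1 p2) _.
rewrite osq -mulrDl ler_wpM2r ?invr_ge0 ?(ltW o0)// /M2; lra.
Unshelve. all: by end_near. Qed.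

(** Dominated convergence in the rescaled variable [y]; the factor 2 pi / k n is the length of the
    window. *)
Lemma saddle_point :
  cvgC (fun n => (2 * pi / k n)%:C * H n.+1 * cexp (- ((3 * N n)%:C * c)))
       (W * cint (cgauss a)).
Proof.
have /choice[Q HQ] : forall n, exists P : {poly R[i]}, P`_n.+1 = H n.+1 /\
    forall x, Re x = t n -> nc (P.[cexp (- x)] - cexp (Tsum z x)) <= 1.
  move=> n; have [M [K [nM nK HP]]] := box_poly_approx n.+1 z1 (t0 n) ltr01.
  by exists (box_poly z M K); rewrite (HE nM nK).
have [M [n0 _ HM]] := dominated (fun n => (HQ n).2).
have M0 : 0 <= M.
  have h : `|Im (tau n0 (- (t n0 * a / k n0)))| <= pi.
    have -> : Im (tau n0 (- (t n0 * a / k n0))) = 0.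
      by rewrite /tau /=; field; rewrite gt_eqF.
    by rewrite normr0 pi_ge0.
  have := HM n0 (leqnn _) _ h => /(le_trans (nc_ge0 _)).
  by rewrite pmulr_lge0// invr_gt0 (lt_le_trans ltr01)// oneDsqr_ge1.
(* The choices 1 and -i of [u] give the real and the imaginary part. *)
have key (u : R[i]) : nc u <= 1 ->
    Re ((2 * pi / k n)%:C * H n.+1 * cexp (- ((3 * N n)%:C * c)) * u) @[n --> \oo] -->
    Re (W * cint (cgauss a) * u).
  move=> u1.
  (* The domination holds only from [n0] on; the shift makes it hold for every index. *)
  pose f n y : R := Re ((Q (n + n0)%N).[cexp (- tau (n + n0) y)] *
     cexp ((n + n0).+1%:R * tau (n + n0) y) * (cexp (- ((3 * N (n + n0))%:C * c)) * u)).
  have cf n : continuous (f n) by exact: coef_integrand_continuous.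
  have [cg _] := derivC_continuous (fun y => derivCZ (W * u) (derivC_cgauss a y)).
  have fPhi n y : f n y = Re (Phi Q (n + n0) y * u) by rewrite /f /Phi; congr Re; ring.
  have [|||_ L] := @dominated_itv R f (fun y => Re (W * u * cgauss a y))
      (fun n => lower (n + n0)) (fun n => lower (n + n0) + 2 * pi / k (n + n0)) M cf
      (continuous_measurable_fun cg).
  - move=> n y /in_window ypi; rewrite fPhi; apply: le_trans (normr_Re _) _.
    rewrite ncM; apply: le_trans (HM _ _ y ypi); first by rewrite ler_piMr ?nc_ge0.
    exact: leq_addl.
  - move=> y; have L : t n * a + k n * y @[n --> \oo] --> (0 : R).
      rewrite -(addr0 0) -{1}(mul0r a) -{2}(mul0r y); apply: cvgD.
        by apply: cvgM => //; exact: cvg_cst.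
      apply: cvgM; last exact: cvg_cst.
      rewrite /k -(mulr0 g); apply: cvgM; first exact: cvg_cst.
      by rewrite -(mulr0 0); under eq_fun do rewrite expr2; exact: cvgM.
    move/cvgr0_norm_lt : L => /(_ _ (pi_gt0 R)) [m _ Hm].
    exists m => // n /= mn; have := Hm (n + n0)%N (leq_trans mn (leq_addr _ _)).
    rewrite /= ltr_norml => /andP[h1 h2].
    rewrite /lower -mulrDl ler_pdivrMr// ler_pdivlMr//.
    by apply/andP; split; lra.
  - move=> y; under eq_fun do rewrite fPhi.
    have L : cvgC (fun n => Phi Q (n + n0) y * u) (W * u * cgauss a y).
      rewrite mulrAC; apply: cvgCM; last exact: cvgC_cst.
      have [r i] := pointwise y (fun n => (HQ n).2).
      split; first by rewrite (cvg_shiftn n0 (fun n => Re (Phi Q n y))).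
      by rewrite (cvg_shiftn n0 (fun n => Im (Phi Q n y))).
    by case: L.
  have E : \int[mu]_y Re (W * u * cgauss a y) = Re (W * cint (cgauss a) * u).
    by rewrite mulrAC -cintZ//; exact: cintegrable_cgauss.
  rewrite -E.
  rewrite -(cvg_shiftn n0 (fun n => Re ((2 * pi / k n)%:C * H n.+1 * cexp (- ((3 * N n)%:C * c)) * u))).
  suff -> : (fun n => Re ((2 * pi / k (n + n0))%:C * H (n + n0).+1 *
       cexp (- ((3 * N (n + n0))%:C * c)) * u)) =
     (fun n => \int[mu]_(y in `[lower (n + n0), lower (n + n0) + 2 * pi / k (n + n0)]) f n y) by [].
  by apply/funext => n; rewrite coef_integral// (HQ _).1 -ReZ; congr Re; ring.
split; first by have := key 1; rewrite nc1 => /(_ (lexx _)); under eq_fun do rewrite mulr1; rewrite mulr1.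
have ImE w : Im w = Re (w * - 'i) by case: w => ? ? /=; ring.
rewrite ImE; under eq_fun do rewrite ImE.
by apply: key; rewrite ncN /= expr0n expr1n add0r sqrtr1.
Qed.

End SaddlePoint.

(** * The trilogarithm on the unit circle *)

Section SineSums.
Context {R : realType}.
Implicit Types (x y b : R).

Lemma normr_sin_natM (n : nat) x : `|sin (n%:R * x)| <= n%:R * `|sin x|.
Proof.
elim: n => [|n IHn]; first by rewrite !mul0r sin0 normr0.
rewrite -natr1 !mulrDl !mul1r sinD; apply: le_trans (ler_normD _ _) _.
rewrite !normrM; apply: lerD; first by rewrite (le_trans _ IHn)// ler_piMr// cos_max.
by rewrite ler_piMl// cos_max.
Qed.

Lemma abel_sum_real (a s : nat -> R) n :
  \sum_(k < n) a k * s k =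
  \sum_(k < n) (a k - a k.+1) * (\sum_(j < k.+1) s j) + a n * \sum_(j < n) s j.
Proof.
elim: n => [|n IHn]; first by rewrite !big_ord0 mulr0 addr0.
by rewrite big_ord_recr IHn /= [in RHS]big_ord_recr /= (big_ord_recr n) /=; ring.
Qed.

(** The closed form 2(1 - cos x)S = (n+1) sin x - sin((n+1)x) reduces the claim to |sin(m x)| <= m
    |sin x|. *)
Lemma sine_fejer_ge0 x n : 0 < x < pi ->
  0 <= \sum_(k < n) \sum_(j < k.+1) sin (j.+1%:R * x).
Proof.
move=> /andP[x0 xpi]; have s0 : 0 < sin x by apply: sin_gt0_pi; rewrite x0.
have c1 : 0 < 1 - cos x.
  rewrite subr_gt0 lt_neqAle cos_le1 andbT; apply/negP => /eqP c1.
  by have := cos2Dsin2 x; have := exprn_gt0 2 s0; rewrite c1 expr1n; lra.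
have D k : 2 * (1 - cos x) * \sum_(j < k) sin (j.+1%:R * x) =
    sin x + sin (k%:R * x) - sin (k.+1%:R * x).
  elim: k => [|k IHk]; first by rewrite big_ord0 mulr0 mul0r sin0 mul1r addr0 subrr.
  rewrite big_ord_recr /= mulrDr IHk.
  have -> : sin (k.+2%:R * x) = sin (k.+1%:R * x) * cos x + cos (k.+1%:R * x) * sin x.
    by rewrite -sinD; congr sin; rewrite -(natr1 k.+1); ring.
  have -> : sin (k%:R * x) = sin (k.+1%:R * x) * cos x - cos (k.+1%:R * x) * sin x.
    by rewrite -sinB; congr sin; rewrite -(natr1 k); ring.
  ring.
have F : 2 * (1 - cos x) * \sum_(k < n) \sum_(j < k.+1) sin (j.+1%:R * x) =
    n.+1%:R * sin x - sin (n.+1%:R * x).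
  elim: n => [|n IHn]; first by rewrite big_ord0 mulr0 !mul1r subrr.
  by rewrite big_ord_recr /= mulrDr IHn D -(natr1 n.+1); ring.
have : 0 <= n.+1%:R * sin x - sin (n.+1%:R * x).
  rewrite subr_ge0; apply: le_trans (ler_norm _) _.
  by apply: le_trans (normr_sin_natM _ _) _; rewrite gtr0_norm.
by rewrite -F pmulr_rge0// mulr_gt0.
Qed.

(* Two summations by parts express the sum through the positive sums of the
   previous lemma. *)
Lemma convex_sine_sum (a : nat -> R) n x : 0 < x < pi ->
  (forall k, 0 <= a k - 2 * a k.+1 + a k.+2) -> a n.+1 = 0 -> a n.+2 = 0 ->
  (a 0%N - 2 * a 1%N + a 2%N) * sin x <= \sum_(k < n.+1) a k * sin (k.+1%:R * x).
Proof.
move=> x0pi a2 an1 an2.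
rewrite (abel_sum_real a (fun k => sin (k.+1%:R * x))) an1 mul0r addr0.
rewrite (abel_sum_real (fun k => a k - a k.+1) (fun k => \sum_(j < k.+1) sin (j.+1%:R * x))).
rewrite an1 an2 subrr mul0r addr0 big_ord_recl /= !big_ord1 mul1r.
have -> : a 0%N - a 1%N - (a 1%N - a 2%N) = a 0%N - 2 * a 1%N + a 2%N by ring.
rewrite lerDl; apply: sumr_ge0 => k _; apply: mulr_ge0; last exact: sine_fejer_ge0.
by have := a2 (lift ord0 k); congr (0 <= _); ring.
Qed.

(** The weights 1/(k+1)^2 are lowered by a constant so that they reach 0 at k = n: plain truncation
    would destroy convexity at the cut. *)
Definition sqw (n k : nat) : R :=
  if (k < n)%N then 1 / k.+1%:R ^+ 2 - 1 / n.+1%:R ^+ 2 else 0.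

Lemma sqw_convex n k : 0 <= sqw n k - 2 * sqw n k.+1 + sqw n k.+2.
Proof.
have dec (i j : nat) : (i <= j)%N -> 1 / (j.+1%:R ^+ 2) <= 1 / (i.+1%:R ^+ 2) :> R.
  move=> ij; rewrite !div1r lef_pV2 ?posrE ?exprn_gt0//.
  by rewrite lerXn2r ?nnegrE// ler_nat.
rewrite /sqw; have [k2|k2] := ltnP k.+2 n.
  rewrite (ltnW (ltnW k2)) (ltnW k2).
  have p0 : 0 < k.+1%:R :> R by [].
  rewrite -!(natr1 k.+2) -!(natr1 k.+1); move: (k.+1%:R : R) p0 => p p0.
  have -> : 1 / p ^+ 2 - 1 / n.+1%:R ^+ 2 - 2 * (1 / (p + 1) ^+ 2 - 1 / n.+1%:R ^+ 2) +
     (1 / (p + 1 + 1) ^+ 2 - 1 / n.+1%:R ^+ 2) = 1 / p ^+ 2 - 2 / (p + 1) ^+ 2 + 1 / (p + 1 + 1) ^+ 2 by ring.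
  have -> : 1 / p ^+ 2 - 2 / (p + 1) ^+ 2 + 1 / (p + 1 + 1) ^+ 2 =
     (6 * p ^+ 2 + 12 * p + 4) / (p ^+ 2 * (p + 1) ^+ 2 * (p + 1 + 1) ^+ 2).
    by field; rewrite !gt_eqF//; lra.
  apply: divr_ge0; first nra.
  by rewrite !mulr_ge0 ?exprn_ge0//; lra.
have [k1|k1] := ltnP k.+1 n.
  have -> : n = k.+2 by apply/eqP; rewrite eqn_leq k2.
  rewrite (ltnW (ltnSn _)).
  have p0 : 0 < k.+1%:R :> R by [].
  rewrite -!(natr1 k.+2) -!(natr1 k.+1); move: (k.+1%:R : R) p0 => p p0.
  have -> : 1 / p ^+ 2 - 1 / (p + 1 + 1) ^+ 2 - 2 * (1 / (p + 1) ^+ 2 - 1 / (p + 1 + 1) ^+ 2) + 0 =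
     (6 * p ^+ 2 + 12 * p + 4) / (p ^+ 2 * (p + 1) ^+ 2 * (p + 1 + 1) ^+ 2).
    by field; rewrite !gt_eqF//; lra.
  apply: divr_ge0; first nra.
  by rewrite !mulr_ge0 ?exprn_ge0//; lra.
rewrite mulr0 subr0 addr0; case: ifP => // kn.
by rewrite subr_ge0 dec// ltnW.
Qed.

(* [sin x * sin (k x - b) = sin (x - b) sin (k x) + sin b sin ((k - 1) x)] *)
Lemma shifted_sine_sum n b x : 0 <= b -> b <= x -> 0 < x < pi -> (3 <= n)%N ->
  13 / 144 * sin x <= \sum_(k < n.+1) sqw n.+1 k * sin (k.+1%:R * x - b).
Proof.
move=> b0 bx x0pi n3; have /andP[x0 xpi] := x0pi.
have s0 : 0 < sin x by apply: sin_gt0_pi.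
have sb : 0 <= sin b by apply: sin_ge0_pi; rewrite b0; lra.
have sxb : 0 <= sin (x - b) by apply: sin_ge0_pi; apply/andP; split; lra.
have S1 : 13 / 144 * sin x <= \sum_(k < n.+1) sqw n.+1 k * sin (k.+1%:R * x).
  apply: le_trans (convex_sine_sum x0pi (sqw_convex n.+1) _ _); last 2 first.
  - by rewrite /sqw ltnn.
  - by rewrite /sqw ltnNge leqnSn.
  rewrite ler_pM2r// /sqw; case: n n3 => [//|[//|[//|n]]] _ /=.
  apply: (@le_trans _ _ (11 / 18)); first lra.
  rewrite le_eqVlt; apply/orP; left; apply/eqP; set q := 1 / n.+4.+1%:R ^+ 2; by field.
(* The leading second differences are 1 - 2/4 + 1/9 = 11/18 in [S1] and 1/4 - 2/9 + 1/16 = 13/144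
   here; the smaller serves for both. By [n3] the weights involved lie on the first branch of [sqw],
   so its subtracted constant cancels. *)
have S0 : 13 / 144 * sin x <= \sum_(k < n.+1) sqw n.+1 k * sin (k%:R * x).
  rewrite big_ord_recl /= mul0r sin0 mulr0 add0r.
  case: n n3 {S1} => [//|n] n3.
  rewrite (eq_bigr (fun k : 'I_n.+1 => sqw n.+2 k.+1 * sin (k.+1%:R * x)))//.
  apply: le_trans (@convex_sine_sum (fun k => sqw n.+2 k.+1) n x x0pi (fun k => sqw_convex n.+2 k.+1) _ _); last 2 first.
  - by rewrite /sqw ltnn.
  - by rewrite /sqw ltnNge leqnSn.
  rewrite ler_pM2r// /sqw; case: n n3 => [//|[//|n]] _ /=.
  rewrite le_eqVlt; apply/orP; left; apply/eqP; set q := 1 / n.+4.+1%:R ^+ 2; by field.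
have E : sin x * \sum_(k < n.+1) sqw n.+1 k * sin (k.+1%:R * x - b) =
    sin (x - b) * (\sum_(k < n.+1) sqw n.+1 k * sin (k.+1%:R * x)) +
    sin b * \sum_(k < n.+1) sqw n.+1 k * sin (k%:R * x).
  rewrite !mulr_sumr -big_split; apply: eq_bigr => k _ /=.
  have -> : sin (k%:R * x) = sin (k.+1%:R * x) * cos x - cos (k.+1%:R * x) * sin x.
    by rewrite -sinB; congr sin; rewrite -(natr1 k); ring.
  rewrite !sinB; ring.
rewrite -(ler_pM2l s0) E.
apply: (@le_trans _ _ (sin (x - b) * (13 / 144 * sin x) + sin b * (13 / 144 * sin x))); last first.
  by apply: lerD; rewrite ler_wpM2l.
rewrite -mulrDl [leRHS]mulrC [leLHS]mulrC ler_wpM2l//; first by rewrite mulr_ge0// ltW.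
have half (y : R) : y / 2 *+ 2 = y by rewrite -mulr_natr divfK.
have sx2 (y : R) : sin y = 2 * (sin (y / 2) * cos (y / 2)).
  by have := sin_mulr2n (y / 2); rewrite half => ->; rewrite -mulr_natl; ring.
have cx2 (y : R) : cos y = 1 - 2 * sin (y / 2) ^+ 2.
  by have := cos_mulr2n (y / 2); rewrite half => ->; rewrite -mulr_natl cos2sin2; ring.
have h : 0 <= 4 * (sin (x / 2) * sin (b / 2) * sin (x / 2 - b / 2)).
  by rewrite !mulr_ge0//; apply: sin_ge0_pi; apply/andP; split; lra.
(* The product form shows sin(x - b) + sin b >= sin x, so the combination loses no factor. *)
have {}E : sin (x - b) + sin b - sin x = 4 * (sin (x / 2) * sin (b / 2) * sin (x / 2 - b / 2)).
  rewrite !sinB (sx2 x) (sx2 b) (cx2 x) (cx2 b); ring.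
by rewrite -subr_ge0 E.
Qed.

End SineSums.

Section Li3Circle.
Context {R : realType}.
Implicit Types (x y b d : R) (z w : R[i]).

Definition eit x : R[i] := cexp (x *i).

Lemma eitE x : eit x = cos x +i* sin x.
Proof. by rewrite /eit cexpE /= expR0 !mul1r. Qed.

Lemma nc_eit x : nc (eit x) = 1.
Proof. by rewrite /eit nc_cexp /= expR0. Qed.

Lemma eitD x y : eit (x + y) = eit x * eit y.
Proof. by rewrite /eit -cexpD; congr cexp; apply: complexP; rewrite /= ?addr0. Qed.

Lemma eitX x n : eit x ^+ n = eit (n%:R * x).
Proof.
rewrite /eit -cexpM_nat; congr cexp; rewrite -real_natC.
by apply: complexP => /=; ring.
Qed.

Lemma eit0 : eit 0 = 1. Proof. by rewrite eitE cos0 sin0. Qed.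

Lemma nc_eit_le1 x : nc (eit x) <= 1. Proof. by rewrite nc_eit. Qed.

Lemma Li3_rot x b :
  cvgC (fun n => \sum_(k < n) (1 / k.+1%:R ^+ 3)%:C * eit (k.+1%:R * x - b))
       (Li3 (eit x) * eit (- b)).
Proof.
have E n : \sum_(k < n) (1 / k.+1%:R ^+ 3)%:C * eit (k.+1%:R * x - b) =
    (\sum_(k < n) Li3term (eit x) k) * eit (- b).
  rewrite mulr_suml; apply: eq_bigr => k _; rewrite /Li3term eitX eitD.
  have -> : (1 / k.+1%:R ^+ 3)%:C = (k.+1%:R ^+ 3)^-1 :> R[i].
    by rewrite div1r -real_natC -(rmorphXn (real_complex R)); exact: fmorphV.
  by ring.
under eq_fun do rewrite E.
by apply: cvgCM; [exact: Li3_cvg (nc_eit_le1 x)|exact: cvgC_cst].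
Qed.

Lemma Re_Li3_rot x b : \sum_(k < n) (1 / k.+1%:R ^+ 3 * cos (k.+1%:R * x - b)) @[n --> \oo] -->
  Re (Li3 (eit x) * eit (- b)).
Proof.
have [h _] := Li3_rot x b; move: h; under eq_fun do rewrite Re_sum.
by under eq_fun do under eq_bigr do rewrite ReZ eitE /=.
Qed.

Lemma Im_Li3_rot x b : \sum_(k < n) (1 / k.+1%:R ^+ 3 * sin (k.+1%:R * x - b)) @[n --> \oo] -->
  Im (Li3 (eit x) * eit (- b)).
Proof.
have [_ h] := Li3_rot x b; move: h; under eq_fun do rewrite Im_sum.
by under eq_fun do under eq_bigr do rewrite ImZ eitE /=.
Qed.

Lemma cvg_ge (u : nat -> R) (l m : R) N : u n @[n --> \oo] --> l ->
  (forall n, (N <= n)%N -> m <= u n) -> m <= l.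
Proof.
move=> ul um; rewrite -(cvg_lim (@Rhausdorff R) ul); apply: limr_ge.
  by apply/cvg_ex; exists l.
by exists N.
Qed.

Lemma cvg_le (u : nat -> R) (l m : R) N : u n @[n --> \oo] --> l ->
  (forall n, (N <= n)%N -> u n <= m) -> l <= m.
Proof.
move=> ul um; rewrite -(cvg_lim (@Rhausdorff R) ul); apply: limr_le.
  by apply/cvg_ex; exists l.
by exists N.
Qed.

(** Comparison of 1/(p+1)^2 with 1/((p+1)^2 - 1/4), which telescopes. The values 2/3 and 2/5 at m =
    1, 2 feed the numerical margins below. *)
Lemma sum_sq_tail m n : \sum_(k < n) (1 / (k + m).+1%:R ^+ 2) <= 2 / (2 * m%:R + 1) :> R.
Proof.
suff H : \sum_(k < n) (1 / (k + m).+1%:R ^+ 2) <= 2 / (2 * m%:R + 1) - 2 / (2 * (n + m)%:R + 1) :> R.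
  by apply: le_trans H _; rewrite gerBl divr_ge0// addr_ge0// mulr_ge0.
elim: n => [|n IHn]; first by rewrite big_ord0 add0n subrr.
rewrite big_ord_recr /=; apply: le_trans (lerD IHn (lexx _)) _.
rewrite addSn -(natr1 (n + m)); have : 0 <= (n + m)%:R :> R by [].
move: ((n + m)%:R : R) => p p0; rewrite -subr_ge0.
set q := 2 / (2 * m%:R + 1).
have -> : q - 2 / (2 * (p + 1) + 1) - (q - 2 / (2 * p + 1) + 1 / (p + 1) ^+ 2) =
    1 / ((p + 1) ^+ 2 * (2 * p + 1) * (2 * (p + 1) + 1)).
  by field; rewrite !gt_eqF//; lra.
by rewrite divr_ge0// !mulr_ge0 ?exprn_ge0//; lra.
Qed.

Lemma sum_cube_tail n : \sum_(k < n) (1 / k.+2%:R ^+ 3) <= 1 / 4 :> R.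
Proof.
by have := sum_invn3_le (R := R) n.+1; rewrite big_ord_recl /= expr1n divr1; lra.
Qed.

Lemma Im_Li3_ge x : sin x - 1 / 4 <= Im (Li3 (eit x)).
Proof.
have := @Im_Li3_rot x 0; rewrite oppr0 eit0 mulr1 => h.
apply: (cvg_ge (N := 1) h) => -[//|n _].
rewrite big_ord_recl /= expr1n divr1 !mul1r addr0 lerD2l lerNl -sumrN -[leRHS]mul1r.
apply: le_trans (sum_cube_tail n); apply: ler_sum => k _.
by rewrite -mulrN ler_piMr// ?divr_ge0 ?exprn_ge0// lerNl sin_geN1.
Qed.

(** Since |sin(k x)| <= k sin x, the terms k >= 2 take away at most 2/3 of sin x. *)
Lemma Im_Li3_ge_sin x : 0 <= x <= pi -> 1 / 3 * sin x <= Im (Li3 (eit x)).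
Proof.
move=> xpi; have s0 := sin_ge0_pi xpi.
have := @Im_Li3_rot x 0; rewrite oppr0 eit0 mulr1 => h.
apply: (cvg_ge (N := 1) h) => -[//|n _].
rewrite big_ord_recl /= expr1n divr1 !mul1r addr0.
have : - (2 / 3 * sin x) <= \sum_(i < n) 1 / (bump 0 i).+1%:R ^+ 3 * sin ((bump 0 i).+1%:R * x + 0).
  rewrite lerNl -sumrN; apply: (@le_trans _ _ (\sum_(k < n) (1 / (k + 1).+1%:R ^+ 2 * sin x))).
    apply: ler_sum => k _; rewrite /bump /= add1n addn1 addr0 -mulrN.
    have k0 : 0 < k.+2%:R :> R by [].
    have -> : 1 / k.+2%:R ^+ 2 * sin x = 1 / k.+2%:R ^+ 3 * (k.+2%:R * sin x).
      by field; rewrite gt_eqF.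
    rewrite ler_wpM2l ?divr_ge0 ?exprn_ge0//; apply: le_trans (ler_norm _) _.
    by rewrite normrN; apply: le_trans (normr_sin_natM _ _) _; rewrite ger0_norm.
  rewrite -mulr_suml ler_wpM2r//; apply: le_trans (sum_sq_tail 1 n) _.
  by rewrite mulr1 ler_pdivrMr; lra.
lra.
Qed.

Lemma Re_Li3_pi_lt0 : Re (Li3 (eit pi)) < 0.
Proof.
suff : Re (Li3 (eit pi)) <= - (3 / 4) by lra.
have := @Re_Li3_rot pi 0; rewrite oppr0 eit0 mulr1 => h.
apply: (cvg_le (N := 1) h) => -[//|n _].
rewrite big_ord_recl /= expr1n divr1 !mul1r addr0 cospi.
suff : \sum_(i < n) 1 / (bump 0 i).+1%:R ^+ 3 * cos ((bump 0 i).+1%:R * pi + 0) <= 1 / 4 :> R by lra.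
apply: le_trans (sum_cube_tail n); apply: ler_sum => k _.
by rewrite ler_piMr// ?divr_ge0 ?exprn_ge0// cos_le1.
Qed.

Lemma Li3_neq0 x : 0 < x <= pi -> Li3 (eit x) != 0.
Proof.
move=> /andP[x0]; rewrite le_eqVlt => /predU1P[->|xpi].
  by apply/eqP => E; have := Re_Li3_pi_lt0; rewrite E ltxx.
have s0 : 0 < sin x by apply: sin_gt0_pi; rewrite x0.
apply/eqP => E; have := @Im_Li3_ge_sin x; rewrite E /= ltW// ltW// => /(_ isT).
by rewrite leNgt mulr_gt0.
Qed.

(** For x > 0 this places the argument of Li3(e^{ix}) below 3x/2, so that the argument phi of its
    cube root satisfies 2 phi < x. The margin is 1 - 1/8 - 4/5 = 3/40: the terms k = 1, 2 are exact,
    and for k >= 3 the angle (k - 3/2)x is an odd multiple of x/2. *)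
Lemma Li3_arg_bound x : 0 <= x <= pi ->
  Im (Li3 (eit x) * eit (- (3 / 2 * x))) <= - (3 / 40 * sin (x / 2)).
Proof.
move=> /andP[x0 xpi]; have p0 := pi_gt0 R.
have s0 : 0 <= sin (x / 2) by apply: sin_ge0_pi; apply/andP; split; lra.
apply: (cvg_le (N := 2) (@Im_Li3_rot x (3 / 2 * x))) => -[//|[//|n]] _.
rewrite !big_ord_recl /= /bump /= expr1n.
have -> : sin (1 * x - 3 / 2 * x) = - sin (x / 2) by rewrite -sinN; congr sin; field.
have -> : sin (2 * x - 3 / 2 * x) = sin (x / 2) by congr sin; field.
have : \sum_(i < n) 1 / (1 + (1 + i)).+1%:R ^+ 3 * sin ((1 + (1 + i)).+1%:R * x - 3 / 2 * x) <=
    4 / 5 * sin (x / 2) :> R.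
  apply: (@le_trans _ _ (\sum_(k < n) (2 * (1 / (k + 2).+1%:R ^+ 2) * sin (x / 2)))).
    apply: ler_sum => k _; rewrite addnA add1n addn2 add2n.
    have k0 : 0 < k.+3%:R :> R by [].
    have -> : 2 * (1 / k.+3%:R ^+ 2) * sin (x / 2) = 1 / k.+3%:R ^+ 3 * (2 * k.+3%:R * sin (x / 2)).
      by field; rewrite gt_eqF.
    rewrite ler_wpM2l ?divr_ge0 ?exprn_ge0//; apply: le_trans (ler_norm _) _.
    have -> : k.+3%:R * x - 3 / 2 * x = (2 * k + 3)%:R * (x / 2).
      by rewrite natrD natrM -!natr1; field.
    apply: le_trans (normr_sin_natM _ _) _; rewrite ger0_norm// ler_wpM2r//.
    by rewrite -natrM ler_nat; lia.
  rewrite -mulr_suml ler_wpM2r// -mulr_sumr.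
  have := sum_sq_tail 2 n; have -> : 2 / (2 * 2%:R + 1) = 2 / 5 :> R by congr (_ / _); lra.
  lra.
have -> : 1 / (1 + 0).+1%:R ^+ 3 = 1 / 8 :> R by congr (_ / _); ring.
rewrite divr1 mul1r; lra.
Qed.

(** With w = t(1 + i v) the claim becomes Re((1 + i a)^3 (1 - i v)^2) <= (1 + v^2)^2, and the
    difference of the two sides is (v - a)^2 ((v + a)^2 + 3 - a^2). *)
Lemma cube_root_bound (l a : R) w : 0 < l -> a ^+ 2 <= 3 -> 0 < Re w ->
  Re ((l%:C * (1 +i* a)) ^+ 3 / w ^+ 2) <= l ^+ 3 / Re w ^+ 2.
Proof.
move=> l0 a3; set t := Re w => t0; pose v := Im w / t.
have -> : w = t%:C * (1 +i* v).
  apply: complexP; rewrite ?ReZ ?ImZ /= ?mulr1// /v mulrCA divff ?mulr1//.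
  by rewrite gt_eqF.
have q0 : 0 < 1 + v ^+ 2 by rewrite ltr_wpDr ?sqr_ge0.
have n0 : (1 -i* v) != 0 :> R[i] by rewrite eq_complex /= oner_eq0.
have n1 : (1 +i* v) != 0 :> R[i] by rewrite eq_complex /= oner_eq0.
have tn : t%:C != 0 :> R[i] by rewrite -nc_gt0 nc_real normr_gt0 gt_eqF.
have -> : (l%:C * (1 +i* a)) ^+ 3 / (t%:C * (1 +i* v)) ^+ 2 =
  (l ^+ 3 / t ^+ 2 * (1 + v ^+ 2)^-1 ^+ 2)%:C * ((1 +i* a) ^+ 3 * (1 -i* v) ^+ 2).
  have sE : (1 +i* v) * (1 -i* v) = (1 + v ^+ 2)%:C :> R[i].
    by apply: complexP => /=; ring.
  have -> : (l ^+ 3 / t ^+ 2 * (1 + v ^+ 2)^-1 ^+ 2)%:C =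
     l%:C ^+ 3 / t%:C ^+ 2 * (1 + v ^+ 2)%:C^-1 ^+ 2 :> R[i].
    by rewrite -fmorphV -!rmorphXn -fmorphV -!rmorphM.
  by rewrite -sE; field; rewrite n0 n1 tn.
rewrite ReZ.
have -> : Re ((1 +i* a) ^+ 3 * (1 -i* v) ^+ 2) =
    (1 + v ^+ 2) ^+ 2 - (v - a) ^+ 2 * (v ^+ 2 + 2 * a * v + 3).
  by rewrite /=; ring.
have c0 : 0 <= l ^+ 3 / t ^+ 2 by rewrite divr_ge0 ?exprn_ge0// ltW.
rewrite -mulrA -[leRHS]mulr1 ler_wpM2l// mulrC exprVn ler_pdivrMr ?exprn_gt0// mul1r.
rewrite gerBl mulr_ge0 ?sqr_ge0//.
have -> : v ^+ 2 + 2 * a * v + 3 = (v + a) ^+ 2 + (3 - a ^+ 2) by ring.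
by rewrite addr_ge0 ?sqr_ge0// subr_ge0.
Qed.

Lemma sin_pi3 : sin (pi / 3) ^+ 2 = 3 / 4 :> R /\ cos (pi / 3) = 1 / 2 :> R.
Proof.
have p0 := pi_gt0 R.
have s0 : 0 < sin (pi / 3 : R) by apply: sin_gt0_pi; apply/andP; split; lra.
have s2 : sin (pi / 3 *+ 2) = sin (pi / 3) :> R.
  have -> : pi / 3 *+ 2 = pi - pi / 3 :> R by rewrite -mulr_natr; field.
  by rewrite sinB sinpi cospi; ring.
have c : cos (pi / 3) = 1 / 2 :> R.
  move: s2; rewrite sin_mulr2n -mulr_natr => E.
  have : (cos (pi / 3) * 2) * sin (pi / 3) = 1 * sin (pi / 3) :> R by rewrite mul1r -[RHS]E; ring.
  by move/(mulIf (lt0r_neq0 s0)); lra.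
by split=> //; rewrite sin2cos2 c; field.
Qed.

Lemma cexp_polar x y : cexp (x +i* y) = (expR x)%:C * eit y.
Proof. by apply: complexP; rewrite ?ReZ ?ImZ eitE. Qed.

(** In the closed upper half-plane the principal argument lies in [0, pi], so that of the cube root
    lies in [0, pi/3]; this is the source of a^2 = tan^2 phi <= 3. *)
Lemma cube_rootP w : w != 0 -> 0 <= Im w -> exists rho phi : R,
  [/\ 0 < rho, 0 <= phi <= pi / 3, cpow w (1 / 3) = rho%:C * eit phi,
      w = (rho ^+ 3)%:C * eit (3 * phi) & 0 < Im w -> phi < pi / 3].
Proof.
move=> w0 Iw; exists (expR (ln (nc w) / 3)), (carg w / 3).
have p0 := pi_gt0 R.
have /andP[c1 c2] := carg_itv w.
have nw : 0 < nc w by rewrite nc_gt0.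
have [_ ImE] := clogE w0.
have c0 : 0 <= carg w.
  rewrite leNgt; apply/negP => c0; have s0 : 0 < sin (- carg w) by apply: sin_gt0_pi; apply/andP; split; lra.
  by move: Iw; rewrite ImE pmulr_rge0//; move: s0; rewrite sinN; lra.
split; rewrite ?expR_gt0//.
- by apply/andP; split; lra.
- rewrite /cpow (negbTE w0) -cexp_polar; congr cexp.
  by apply: complexP; rewrite (ReZ, ImZ) div1r mulrC.
- rewrite -expRM_natl; have -> : 3 * (ln (nc w) / 3) = ln (nc w) by field.
  rewrite lnK ?posrE//.
  have -> : 3 * (carg w / 3) = carg w by field.
  rewrite eitE; have [ReE' ImE'] := clogE w0.
  by apply: complexP; rewrite ?ReZ ?ImZ.
- move=> Iw'; have : carg w != pi.
    by apply: contraTneq Iw' => E; rewrite ImE E sinpi mulr0 ltxx.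
  move=> cn; have : carg w < pi by rewrite lt_neqAle cn.
  lra.
Qed.

(** With the cube root written l(1 + i a) this is l^3, the quantity that bounds Re(Li3(z)/w^2) on Re
    w = 1 and that is compared with 1/4. *)
Definition growth_rate z : R := Re (cpow (Li3 z) (1 / 3)) ^+ 3.

End Li3Circle.

(** * Monotonicity of the growth rate *)

Section GrowthRate.
Context {R : realType}.
Implicit Types (x y b d phi : R) (z w : R[i]).

(** An integrated form of [shifted_sine_sum], through the mean value theorem for the difference of
    the two sides. *)
Lemma shifted_cosine_sum n b x1 x2 : 0 <= b -> b <= x1 -> 0 < x1 -> x1 < x2 -> x2 <= pi ->
  (3 <= n)%N ->
  13 / 144 * (cos x1 - cos x2) <=
  \sum_(k < n.+1) sqw n.+1 k / k.+1%:R * cos (k.+1%:R * x1 - b) -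
  \sum_(k < n.+1) sqw n.+1 k / k.+1%:R * cos (k.+1%:R * x2 - b) :> R.
Proof.
move=> b0 bx1 x10 x12 x2pi n3.
pose df x : R := 13 / 144 * sin x - \sum_(k < n.+1) sqw n.+1 k * sin (k.+1%:R * x - b).
pose f x : R := \sum_(k < n.+1) sqw n.+1 k / k.+1%:R * cos (k.+1%:R * x - b) - 13 / 144 * cos x.
have Df x : is_derive x 1 f (df x).
  have Dk (k : 'I_n.+1) : is_derive x 1
     (fun r : R => sqw n.+1 k / k.+1%:R * cos (k.+1%:R * r - b))
     (- (sqw n.+1 k * sin (k.+1%:R * x - b))).
    have D : is_derive x 1 (fun r : R => k.+1%:R * r - b) k.+1%:R.
      by apply: is_derive_eq; rewrite /GRing.scale /=; ring.
    have k0 : k.+1%:R != 0 :> R by [].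
    apply: is_derive_eq; rewrite /GRing.scale /=.
    by move: (sin _) (sqw _ _) => s q; field.
  have -> : f = (fun r => \sum_(k < n.+1) sqw n.+1 k / k.+1%:R * cos (k.+1%:R * r - b)) -
     (fun r => 13 / 144 * cos r) by [].
  have -> : df x = \sum_(k < n.+1) - (sqw n.+1 k * sin (k.+1%:R * x - b)) - (- (13 / 144 * sin x)).
    by rewrite sumrN opprK addrC.
  apply: is_deriveB.
    by have := is_derive_sum Dk; rewrite fct_sumE.
  by apply: is_derive_eq; rewrite /GRing.scale /=; ring.
have [|c] := MVT x12 (fun x _ => Df x).
  apply: continuous_subspaceT => x; apply/differentiable_continuous/derivable1_diffP.
  by case: (Df x).
rewrite in_itv /= => /andP[c1 c2] E.
have : df c <= 0.
  rewrite /df subr_le0; apply: shifted_sine_sum => //; first by lra.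
  by apply/andP; split; lra.
have xd : 0 < x2 - x1 by rewrite subr_gt0.
move=> /(ler_wpM2r (ltW xd)); rewrite mul0r -E /f; lra.
Qed.

Lemma sqw_cosine_sum_close n b x :
  `|\sum_(k < n.+1) (1 / k.+1%:R ^+ 3 * cos (k.+1%:R * x - b)) -
    \sum_(k < n.+1) sqw n.+1 k / k.+1%:R * cos (k.+1%:R * x - b)| <= n.+1%:R^-1 :> R.
Proof.
rewrite -sumrB.
have E k : (k < n.+1)%N -> 1 / k.+1%:R ^+ 3 * cos (k.+1%:R * x - b) -
    sqw n.+1 k / k.+1%:R * cos (k.+1%:R * x - b) =
    1 / n.+2%:R ^+ 2 * (1 / k.+1%:R) * cos (k.+1%:R * x - b) :> R.
  by move=> kn; rewrite /sqw kn; move: (cos _) => c; field; rewrite !gt_eqF.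
apply: le_trans (ler_norm_sum _ _ _) _.
apply: (@le_trans _ _ (\sum_(k < n.+1) 1 / n.+2%:R ^+ 2)).
  apply: ler_sum => k _; rewrite E// -mulrA normrM ger0_norm ?divr_ge0//.
  rewrite ler_piMr ?divr_ge0// normrM ger0_norm ?divr_ge0//.
  rewrite -[leRHS]mulr1 ler_pM ?divr_ge0//.
    by rewrite ler_pdivrMr// mul1r ler1n.
  by rewrite ler_norml cos_geN1 cos_le1.
rewrite sumr_const card_ord -[leLHS]mulr_natr mulrAC mul1r ler_pdivrMr ?exprn_gt0//.
rewrite mulrC ler_pdivlMr// -expr2 lerXn2r ?nnegrE// ler_nat//.
Qed.

(** The margin 13/144 (cos x1 - cos x2) does not depend on n, so strictness survives the limit;
    passing from the weights 1/k^3 to those built on [sqw] costs O(1/n). *)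
Lemma Re_Li3_rot_decr b x1 x2 : 0 <= b -> b <= x1 -> 0 < x1 -> x1 < x2 -> x2 <= pi ->
  Re (Li3 (eit x2) * eit (- b)) < Re (Li3 (eit x1) * eit (- b)).
Proof.
move=> b0 bx1 x10 x12 x2pi; rewrite -subr_gt0.
apply: (@lt_le_trans _ _ (13 / 144 * (cos x1 - cos x2))).
  rewrite mulr_gt0// subr_gt0 ltr_cos ?in_itv /= ?x12//; apply/andP; split; lra.
have S x : (\sum_(k < n.+1) (1 / k.+1%:R ^+ 3 * cos (k.+1%:R * x - b)))%R @[n --> \oo] -->
    Re (Li3 (eit x) * eit (- b)).
  by have := @Re_Li3_rot R x b; rewrite -(cvg_shiftS (fun n => \sum_(k < n) _)).
have L : (\sum_(k < n.+1) (1 / k.+1%:R ^+ 3 * cos (k.+1%:R * x1 - b)) -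
   \sum_(k < n.+1) (1 / k.+1%:R ^+ 3 * cos (k.+1%:R * x2 - b)) + 2 * n.+1%:R^-1)%R @[n --> \oo] -->
    Re (Li3 (eit x1) * eit (- b)) - Re (Li3 (eit x2) * eit (- b)) + 2 * 0.
  apply: cvgD; first by apply: cvgB; exact: S.
  by apply: cvgM; [exact: cvg_cst|exact: cvg_harmonic].
rewrite mulr0 addr0 in L; apply: (cvg_ge (N := 3) L) => n n3.
have := shifted_cosine_sum b0 bx1 x10 x12 x2pi n3.
have := sqw_cosine_sum_close n b x1; have := sqw_cosine_sum_close n b x2.
rewrite !ler_norml => /andP[_]; rewrite lerBlDr => h2 /andP[]; rewrite lerBrDr => h1 _ h.
move: (\sum_(k < n.+1) _) (\sum_(k < n.+1) _) (\sum_(k < n.+1) _) (\sum_(k < n.+1) _) h h1 h2.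
by move: n.+1%:R^-1 (cos x1) (cos x2) => v c1 c2 A1 A2 A3 A4; lra.
Qed.

Lemma cos_ge_half x : 0 <= x <= pi / 3 -> 1 / 2 <= cos x.
Proof.
move=> /andP[x0 x3]; have [_ <-] := @sin_pi3 R; have p0 := pi_gt0 R.
by rewrite leNgt ltr_cos ?in_itv /= -?leNgt//; apply/andP; split; lra.
Qed.

Lemma growth_rateP x : 0 < x <= pi -> exists rho phi : R,
  [/\ 0 < rho, 0 <= phi <= pi / 3, Li3 (eit x) = (rho ^+ 3)%:C * eit (3 * phi)
    & growth_rate (eit x) = (rho * cos phi) ^+ 3].
Proof.
move=> xpi; have /andP[x0 xp] := xpi.
have [|rho [phi [r0 p01 E1 E2 _]]] := cube_rootP (Li3_neq0 xpi).
  apply: le_trans (Im_Li3_ge_sin _); rewrite ?(ltW x0)//.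
  by rewrite mulr_ge0// sin_ge0_pi// (ltW x0).
exists rho, phi; split=> //.
by rewrite /growth_rate E1 ReZ eitE.
Qed.

Lemma Li3_eit_cube x : 0 < x <= pi -> exists l a : R,
  [/\ 0 < l, a ^+ 2 <= 3, cpow (Li3 (eit x)) (1 / 3) = l%:C * (1 +i* a),
      Li3 (eit x) = (l%:C * (1 +i* a)) ^+ 3 & x < pi -> a ^+ 2 < 3].
Proof.
move=> xpi; have /andP[x0 xp] := xpi; have p0 := pi_gt0 R.
have [|rho [phi [r0 p01 E1 E2 p3]]] := cube_rootP (Li3_neq0 xpi).
  apply: le_trans (Im_Li3_ge_sin _); rewrite ?(ltW x0)//.
  by rewrite mulr_ge0// sin_ge0_pi// (ltW x0).
have c0 := cos_ge_half p01; set c := cos phi in c0 *.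
have cn : 0 < c by lra.
have L : rho%:C * eit phi = (rho * c)%:C * (1 +i* (sin phi / c)).
  by rewrite eitE; apply: complexP; rewrite ?ReZ ?ImZ /= ?mulr1// mulrACA divff ?mulr1// gt_eqF.
have s2 : sin phi ^+ 2 = 1 - c ^+ 2 by rewrite sin2cos2.
exists (rho * c), (sin phi / c); split.
- by rewrite mulr_gt0.
- rewrite expr_div_n ler_pdivrMr ?exprn_gt0// s2.
  have : (1 / 2) ^+ 2 <= c ^+ 2 by rewrite lerXn2r ?nnegrE//; lra.
  lra.
- by rewrite E1.
- rewrite -L {1}E2 exprMn eitX; congr (_ * _); exact: rmorphXn.
- move=> xlt; rewrite expr_div_n ltr_pdivrMr ?exprn_gt0// s2.
  have I0 : 0 < Im (Li3 (eit x)).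
    apply: lt_le_trans (Im_Li3_ge_sin _); rewrite ?(ltW x0)//.
    by rewrite mulr_gt0// sin_gt0_pi// x0.
  have /andP[f0 _] := p01; have f3 := p3 I0.
  have c3 : 1 / 2 < c.
    have [_ <-] := @sin_pi3 R; rewrite ltr_cos ?in_itv //=; apply/andP; split; lra.
  have : (1 / 2) ^+ 2 < c ^+ 2 by rewrite ltrXn2r ?nnegrE//; lra.
  lra.
Qed.

Lemma growth_rate_cube z l a : cpow (Li3 z) (1 / 3) = l%:C * (1 +i* a) -> growth_rate z = l ^+ 3.
Proof. by rewrite /growth_rate => ->; rewrite ReZ /= mulr1. Qed.

(** [cube_root_bound] tested at w = e^{i phi}/cos phi = 1 + i tan phi. Every phi in the range gives
    a lower bound, and the argument of the cube root itself gives equality. *)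
Lemma growth_rate_ge x phi : 0 < x <= pi -> 0 <= phi <= pi / 3 ->
  cos phi ^+ 2 * Re (Li3 (eit x) * eit (- (2 * phi))) <= growth_rate (eit x).
Proof.
move=> xpi phi3; have [l [a [l0 a3 /growth_rate_cube-> L _]]] := Li3_eit_cube xpi.
have q0 := cos_ge_half phi3.
have cn : cos phi != 0 by rewrite gt_eqF//; lra.
pose w := (cos phi)^-1%:C * eit phi.
have rw : Re w = 1 by rewrite /w ReZ eitE mulVf.
have := cube_root_bound l0 a3 (_ : 0 < Re w); rewrite -L rw => /(_ ltr01).
rewrite expr1n divr1; apply: le_trans; rewrite le_eqVlt; apply/orP; left; apply/eqP.
have -> : (w ^+ 2)^-1 = (cos phi ^+ 2)%:C * eit (- (2 * phi)).
  have P : (cos phi ^+ 2)%:C * eit (- (2 * phi)) * w ^+ 2 = 1.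
    rewrite /w exprMn eitX mulrACA -eitD addNr eit0 mulr1.
    apply: complexP; rewrite -(rmorphXn (real_complex R)) ?ReZ ?ImZ /=; last by rewrite mulr0.
    by rewrite -exprMn mulfV// expr1n.
  have w2 : w ^+ 2 != 0.
    by apply/eqP => W; move: P; rewrite W mulr0 => /esym/eqP; rewrite oner_eq0.
  by apply: (mulIf w2); rewrite P mulVf.
by rewrite mulrCA ReZ.
Qed.

(** The direction phi optimal at [x] is inserted into [growth_rate_ge] at y = x - d, and
    [Re_Li3_rot_decr] compares the two values with b = 2 phi. This requires 2 phi <= y, whence the
    short step: [Li3_arg_bound] has to survive the passage from x to y. *)
Lemma growth_rate_step x d : 0 < d -> d <= sin (x / 2) / 50 -> d < x -> x <= pi ->
  growth_rate (eit x) < growth_rate (eit (x - d)).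
Proof.
move=> d0 ds dx xpi; have p0 := pi_gt0 R; have p2 := pi_ge2 R.
have xp : 0 < x <= pi by apply/andP; split; lra.
have yp : 0 < x - d <= pi by apply/andP; split; lra.
have [rho [phi [r0 phi3 E ->]]] := growth_rateP xp.
have /andP[f0 f3] := phi3.
set y := x - d in yp *; have /andP[y0 _] := yp.
have s1 := sin_le1 (x / 2).
(* As |Li3| <= 5/4, the rotation by 3d/2 adds at most (5/4)(3/2)d <= 3/80 sin(x/2), by the constant
   50; this is what cos(3d/2) >= 1/2 leaves of the margin 3/40. *)
have A : Im (Li3 (eit x) * eit (- (3 / 2 * y))) <= 0.
  have -> : Li3 (eit x) * eit (- (3 / 2 * y)) =
      Li3 (eit x) * eit (- (3 / 2 * x)) * eit (3 / 2 * d).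
    by rewrite -[RHS]mulrA -eitD; congr (_ * eit _); rewrite /y; field.
  have := Li3_arg_bound (_ : 0 <= x <= pi); rewrite (ltW (lt_trans d0 dx)) xpi => /(_ isT).
  have nb : nc (Li3 (eit x) * eit (- (3 / 2 * x))) <= 5 / 4.
    rewrite ncM nc_eit mulr1; apply: cvgC_le (Li3_cvg (nc_eit_le1 x)) _.
    near=> n; apply: le_trans (nc_sum _ _ _) _; apply: le_trans (sum_invn3_le n).
    apply: ler_sum => k _; exact: Li3term_le (nc_eit_le1 x).
  move: (Li3 _ * _) nb => L nb ImL; have ReL := le_trans (Re_le L) nb.
  rewrite ImM eitE /=.
  have dd : 0 <= 3 / 2 * d <= pi / 3 by apply/andP; split; lra.
  have c1 := cos_ge_half dd.
  have sd : 0 <= sin (3 / 2 * d) <= 3 / 2 * d.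
    apply/andP; split; first by apply: sin_ge0_pi; apply/andP; split; lra.
    have /andP[t0 _] := dd.
    have := @norm_diff_le R sin cos id (cst 1) 0 (3 / 2 * d) t0.
    rewrite sin0 !subr0 => h; apply: le_trans (ler_norm _) (h _ _ _) => t _ //.
    by rewrite /= ler_norml cos_geN1 cos_le1.
  move: sd => /andP[sd0 sd].
  have : Im L * cos (3 / 2 * d) <= - (3 / 40 * sin (x / 2)) * (1 / 2).
    apply: (@le_trans _ _ (- (3 / 40 * sin (x / 2)) * cos (3 / 2 * d))).
      by rewrite ler_wpM2r//; lra.
    by rewrite ler_wnM2l// oppr_le0 mulr_ge0//; lra.
  have : Re L * sin (3 / 2 * d) <= 5 / 4 * (3 / 2 * d).
    apply: (@le_trans _ _ (5 / 4 * sin (3 / 2 * d))); first by rewrite ler_wpM2r.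
    by rewrite ler_wpM2l.
  lra.
have yphi : 2 * phi <= y.
  rewrite leNgt; apply/negP => yphi.
  have s0 : 0 < sin (3 * phi - 3 / 2 * y) by apply: sin_gt0_pi; apply/andP; split; lra.
  move: A; rewrite E -mulrA -eitD ImZ eitE /= leNgt mulr_gt0 ?exprn_gt0//.
apply: lt_le_trans (growth_rate_ge yp phi3).
have c0 : 0 < cos phi by have := cos_ge_half phi3; lra.
apply: (@le_lt_trans _ _ (cos phi ^+ 2 * Re (Li3 (eit x) * eit (- (2 * phi))))).
  rewrite E -mulrA -eitD ReZ eitE /=.
  have -> : 3 * phi - 2 * phi = phi by ring.
  by rewrite exprMn; move: (cos phi) (rho) => c r; lra.
rewrite ltr_pM2l ?exprn_gt0//; apply: Re_Li3_rot_decr => //; rewrite /y; lra.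
Unshelve. all: by end_near. Qed.

(** The admissible step at any angle between y and x is at least h = sin(y/2)/50, so finitely many
    steps lead from x to y. *)
Lemma growth_rate_decr x y : 0 < y -> y < x -> x <= pi ->
  growth_rate (eit x) < growth_rate (eit y).
Proof.
move=> y0; have p0 := pi_gt0 R.
pose h := sin (y / 2) / 50.
have step x' : y < x' -> x' <= pi -> h <= sin (x' / 2) / 50.
  move=> yx xpi; rewrite ler_pM2r ?invr_gt0// ltW// ltr_sin ?in_itv /=; first lra.
    by apply/andP; split; lra.
  by apply/andP; split; lra.
move=> yx xpi.
have h0 : 0 < h by rewrite divr_gt0// sin_gt0_pi//; apply/andP; split; lra.
have [N Nh] : exists N : nat, x - y <= N%:R * h.
  exists (Num.Def.truncn ((x - y) / h)).+1.
  by rewrite -ler_pdivrMr// ltW// truncnS_gt.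
elim: N x yx xpi Nh => [|N IHN] x yx xpi; first by rewrite mul0r subr_le0 leNgt yx.
rewrite -natr1 mulrDl mul1r => Nh.
have := step x yx xpi => hx.
have [xh|xh] := leP (x - y) h.
  have E : x - (x - y) = y by ring.
  by rewrite -E; apply: growth_rate_step; rewrite ?subr_gt0 ?gtrBl ?(le_trans xh).
apply: (@lt_trans _ _ (growth_rate (eit (x - h)))).
  by apply: growth_rate_step; lra.
by apply: IHN; lra.
Qed.

(** By monotonicity only the angle 2 pi/3 matters. There phi = pi/4 in [growth_rate_ge] picks out
    half of Im Li3, which exceeds (4/5 - 1/4)/2 = 11/40. *)
Lemma growth_rate_gt x : 0 < x <= 2 * pi / 3 -> 1 / 4 < growth_rate (eit x).
Proof.
move=> /andP[x0]; have p0 := pi_gt0 R.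
have H : 1 / 4 < growth_rate (eit (2 * pi / 3)) :> R.
  have q3 : 0 < 2 * @pi R / 3 <= pi by apply/andP; split; lra.
  have q4 : 0 <= @pi R / 4 <= pi / 3 by apply/andP; split; lra.
  apply: lt_le_trans (growth_rate_ge q3 q4).
  have -> : eit (- (2 * (pi / 4))) = 0 -i* 1 :> R[i].
    have -> : 2 * (pi / 4) = pi / 2 :> R by field.
    by rewrite eitE cosN sinN cos_pihalf sin_pihalf.
  rewrite ReM [Re (0 -i* 1)]/= [Im (0 -i* 1)]/= mulr0 sub0r mulrN1 opprK.
  have c : cos (pi / 4) ^+ 2 = 1 / 2 :> R.
    have : cos (pi / 4 *+ 2) = 0 :> R by rewrite -mulr_natr -[RHS]cos_pihalf; congr cos; field.
    by rewrite cos_mulr2n -mulr_natr; lra.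
  have := Im_Li3_ge (2 * pi / 3 : R).
  have -> : sin (2 * pi / 3) = sin (pi / 3) :> R.
    have -> : 2 * pi / 3 = pi - pi / 3 :> R by field.
    rewrite sinB sinpi cospi; ring.
  have [s2 _] := @sin_pi3 R; rewrite c.
  have s0 : 0 < sin (pi / 3) :> R by apply: sin_gt0_pi; apply/andP; split; lra.
  have : 4 / 5 < sin (pi / 3) :> R by nra.
  lra.
rewrite le_eqVlt => /predU1P[->//|x3].
by apply: lt_trans H _; apply: growth_rate_decr => //; lra.
Qed.

End GrowthRate.

(** * Roots of unity *)

Section MinorRoots.
Context {R : realType}.
Implicit Types (x y q : R) (z : R[i]).

(** With [c] conjugate to the coefficient, the real integral is 2 pi times its squared modulus, so
    the trivial bound on the integrand loses no constant. *)
Lemma coef_le (Q : {poly R[i]}) (t M : R) n :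
  (forall x : R[i], Re x = t -> `|Im x| <= pi -> nc (Q.[cexp (- x)]) <= M) ->
  nc Q`_n <= M * expR (n%:R * t).
Proof.
move=> QM; have p0 := pi_gt0 R.
set c : R[i] := (Q`_n)^*.
have [Q0|Qn0] := eqVneq Q`_n 0.
  rewrite Q0 nc0 mulr_ge0 ?expR_ge0//.
  apply: le_trans (nc_ge0 _) (QM (t%:C) _ _) => //=.
  by rewrite normr0 ltW.
have ncc : nc c = nc Q`_n by rewrite /c; case: (Q`_n) => u v /=; rewrite sqrrN.
have Qc : Re (Q`_n * c) = nc Q`_n ^+ 2.
  by rewrite /c nc_sqr; case: (Q`_n) => u v /=; ring.
have E := @coef_integral R Q t%:C c 1 (- pi) n ltr01.
rewrite divr1 Qc in E.
have nQ : 0 < nc Q`_n by rewrite nc_gt0.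
suff : 2 * pi * nc Q`_n ^+ 2 <= 2 * pi * (M * expR (n%:R * t) * nc Q`_n).
  by rewrite ler_pM2l ?mulr_gt0// expr2 ler_pM2r.
rewrite -E.
set B := M * _ * _.
have ab : - pi <= - pi + 2 * pi :> R by lra.
have -> : 2 * pi * B = \int[mu]_(y in `[- pi, - pi + 2 * pi]) cst B y.
  rewrite Rintegral_cst//.
  have := @lebesgue_measure_itv R `[- pi, - pi + 2 * pi]; rewrite /= lte_fin ifT; last by lra.
  by rewrite -EFinB => /(congr1 fine) /= ->; move: B => B; ring.
apply: le_Rintegral => //.
- apply: continuous_compact_integrable; first exact: segment_compact.
  by apply: continuous_subspaceT; exact: coef_integrand_continuous.
- apply: continuous_compact_integrable; first exact: segment_compact.
  by apply: continuous_subspaceT => y; exact: cst_continuous.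
- move=> y h; have /andP[y1 y2] : - pi <= y <= - pi + 2 * pi by move: h; rewrite /= in_itv.
  have Rt : Re (t%:C + (1 * y)*i) = t by rewrite /= addr0.
  apply: le_trans (Re_le _) _; rewrite !ncM ncc /cst /B ler_wpM2r ?nc_ge0//.
  apply: ler_pM; rewrite ?nc_ge0//.
    by apply: QM => //; rewrite /= add0r mul1r ler_norml; apply/andP; split; lra.
  by rewrite nc_cexp Re_natM Rt.
Qed.

Lemma Tsum_circle_bound z l a q : nc z <= 1 -> z != 1 -> 0 < l -> a ^+ 2 <= 3 ->
  Li3 z = (l%:C * (1 +i* a)) ^+ 3 -> l ^+ 3 <= q -> 1 / 4 < q ->
  exists K d : R, 0 < d /\ forall x : R[i], 0 < Re x -> Re x <= d -> `|Im x| <= pi ->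
    Re (Tsum z x) <= q / Re x ^+ 2 + K.
Proof.
move=> z1 zn1 l0 a3 Lz lq q4.
have [c0 c00 Hc0] := @hkern_minor R.
pose eta := q - 1 / 4; have eta0 : 0 < eta by rewrite subr_gt0.
pose C := 1 + 1 / (c0 * eta).
have ce0 : 0 < c0 * eta by rewrite mulr_gt0.
have C1 : 1 <= C by rewrite lerDl divr_ge0// ltW.
have C0 : 0 < C by rewrite (lt_le_trans ltr01).
have HC : 1 / (c0 * C ^+ 2) <= eta.
  rewrite ler_pdivrMr ?mulr_gt0 ?exprn_gt0//.
  have : 1 <= c0 * eta * C by rewrite /C mulrDr mulr1 mul1r divff ?gt_eqF// lerDr ltW.
  nra.
have [d d0 Hd] := Tsum_major z1 zn1 C0 ltr01.
set w := (1 / 12)%:C * clog (1 - z) in Hd.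
exists (nc w + 1), d; split=> // x x0 xd xpi.
have [xC|xC] := leP `|Im x| (C * Re x).
  have := le_trans (Re_le _) (Hd x x0 xd (conj (ltW x0) xC)).
  have := cube_root_bound l0 a3 x0; rewrite -Lz.
  have : l ^+ 3 / Re x ^+ 2 <= q / Re x ^+ 2 by rewrite ler_pM2r// invr_gt0 exprn_gt0.
  have := Re_le w; rewrite !ReB.
  move: (Re (Tsum z x)) (Re (Li3 z / _)) (Re w) (nc w) (l ^+ 3 / _) (q / _) => *; lra.
have Imn : Im x != 0.
  by apply: contraTneq xC => ->; rewrite normr0 -leNgt mulr_ge0// ltW.
apply: le_trans (Re_le _) _; apply: le_trans (Tsum_minor z1 x0) _.
apply: (@le_trans _ _ (q / Re x ^+ 2)); last by rewrite lerDl addr_ge0 ?nc_ge0.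
have -> : q / Re x ^+ 2 = eta * (1 / Re x ^+ 2) + 1 / Re x ^+ 2 * (1 / 4).
  by rewrite /eta; ring.
rewrite lerD2r; apply: le_trans (Hc0 _ x0 xpi Imn) _.
apply: (@le_trans _ _ (1 / (c0 * C ^+ 2) * (1 / Re x ^+ 2))); last first.
  by rewrite ler_wpM2r// divr_ge0// exprn_ge0// ltW.
have -> : 1 / (c0 * C ^+ 2) * (1 / Re x ^+ 2) = 1 / (c0 * (C * Re x) ^+ 2).
  by field; rewrite !gt_eqF.
have I2 : 0 < c0 * Im x ^+ 2 by rewrite pmulr_rgt0// exprn_even_gt0.
have C2 : 0 < c0 * (C * Re x) ^+ 2 by rewrite mulr_gt0 ?exprn_gt0 ?mulr_gt0.
rewrite !div1r lef_pV2 ?posrE// ler_pM2l//.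
rewrite -(real_normK (num_real (Im x))) lerXn2r ?nnegrE ?mulr_ge0 ?(ltW C0) ?(ltW x0)//.
exact: ltW.
Qed.

(** The circle is the one adapted to the dominant rate [m], on which (n+1)t = 2mX with X = 1/t^2.
    For q halfway between max(l^3, 1/4) and [m], the coefficient times e^{-3mX} is at most e^K
    e^{-(m-q)X} + e^{-mX}, smaller than any power of t. *)
Lemma minor_root_coef z l a m (H : nat -> R[i]) (t : nat -> R) :
  nc z <= 1 -> z != 1 -> 0 < l -> a ^+ 2 <= 3 ->
  Li3 z = (l%:C * (1 +i* a)) ^+ 3 -> l ^+ 3 < m -> 1 / 4 < m ->
  (forall n N K, (n <= N)%N -> (n < K)%N -> (box_poly z N K)`_n = H n) ->
  (forall n, 0 < t n) -> (forall n, n.+1%:R * t n ^+ 3 = 2 * m :> R) ->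
  t n @[n --> \oo] --> (0 : R) ->
  nc (H n.+1) * expR (- (3 * (m / t n ^+ 2))) / t n ^+ 2 @[n --> \oo] --> (0 : R).
Proof.
move=> z1 zn1 l0 a3 Lz lm m4 HE t0 tn tlim.
pose q := (Num.max (l ^+ 3) (1 / 4) + m) / 2.
have M1 : l ^+ 3 <= Num.max (l ^+ 3) (1 / 4) by rewrite le_max lexx.
have M2 : 1 / 4 <= Num.max (l ^+ 3) (1 / 4) by rewrite le_max lexx orbT.
have M3 : Num.max (l ^+ 3) (1 / 4) < m by rewrite gt_max lm.
have lq : l ^+ 3 <= q by rewrite /q; lra.
have q4 : 1 / 4 < q by rewrite /q; lra.
have qm : 0 < m - q by rewrite /q; lra.
have [K [d [d0 Hd]]] := Tsum_circle_bound z1 zn1 l0 a3 Lz lq q4.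
set dl := m - q in qm.
have m0 : 0 < m by lra.
pose A := 2 * (expR K / dl ^+ 2 + 1 / m ^+ 2).
have L : A * t n ^+ 2 @[n --> \oo] --> (0 : R).
  rewrite -(mulr0 A); apply: cvgM; first exact: cvg_cst.
  by rewrite -(mulr0 0); under eq_fun do rewrite expr2; exact: cvgM.
apply: (@squeeze_cvgr _ _ _ _ (cst 0) _ _ _ _ _ L); last exact: cvg_cst.
near=> n; apply/andP; split.
  by rewrite /cst divr_ge0 ?exprn_ge0 ?mulr_ge0 ?nc_ge0 ?expR_ge0// ltW.
have td : t n <= d by apply: ltW; near: n; move/cvgr_lt : tlim => /(_ _ d0).
have X0 : 0 < 1 / t n ^+ 2 by rewrite divr_gt0// exprn_gt0.
set X := 1 / t n ^+ 2 in X0.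
have [N [k [nN nk HP]]] := box_poly_approx n.+1 z1 (t0 n) ltr01.
have bound (x : R[i]) : Re x = t n -> `|Im x| <= pi ->
    nc ((box_poly z N k).[cexp (- x)]) <= expR (q * X + K) + 1.
  move=> xt xpi; rewrite -[_.[_]](subrK (cexp (Tsum z x))).
  apply: le_trans (ncD _ _) _; rewrite addrC; apply: lerD; last exact: HP.
  rewrite nc_cexp ler_expR /X mulrA mulr1 -xt; apply: Hd; rewrite ?xt//.
have := coef_le n.+1 bound; rewrite HE// => h.
have nt : n.+1%:R * t n = 2 * m * X.
  by rewrite /X -(tn n); field; rewrite gt_eqF.
have tail u : 0 < u -> expR (- (u * X)) <= 2 / u ^+ 2 * t n ^+ 4.
  move=> u0; have uX : 0 <= u * X by rewrite mulr_ge0// ltW.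
  have h1 := expR_ge1Dxn 1 uX; rewrite (_ : 2`!%:R = 2) in h1; last by [].
  have -> : 2 / u ^+ 2 * t n ^+ 4 = ((u * X) ^+ 2 / 2)^-1.
    by rewrite /X; field; rewrite !gt_eqF.
  rewrite expRN lef_pV2 ?posrE ?expR_gt0//; first by lra.
  by rewrite divr_gt0 ?exprn_gt0// mulr_gt0.
rewrite -mulrA -/X.
have -> : 3 * (m / t n ^+ 2) = 3 * m * X by rewrite /X; ring.
have t2 : 0 < t n ^+ 2 by rewrite exprn_gt0.
rewrite mulrA ler_pdivrMr//.
have -> : A * t n ^+ 2 * t n ^+ 2 = expR K * (2 / dl ^+ 2 * t n ^+ 4) + 2 / m ^+ 2 * t n ^+ 4.
  by rewrite /A; ring.
apply: (@le_trans _ _ ((expR (q * X + K) + 1) * expR (n.+1%:R * t n) * expR (- (3 * m * X)))).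
  by rewrite ler_wpM2r ?expR_ge0.
have -> : (expR (q * X + K) + 1) * expR (n.+1%:R * t n) * expR (- (3 * m * X)) =
    expR K * expR (- (dl * X)) + expR (- (m * X)).
  rewrite nt mulrDl mulrDl mul1r -!expRD; congr (expR _ + expR _); rewrite /dl; ring.
by apply: lerD; rewrite ?ler_pM2l ?expR_gt0 ?tail.
Unshelve. all: by end_near. Qed.

End MinorRoots.

Section RootsOfUnity.
Context {R : realType}.
Implicit Types (x y : R) (z u : R[i]).

Definition trace_poly z n : R[i] :=
  \sum_(p <- fset_set [set p | is_plane_partition n p]) z ^+ pp_trace p.

Lemma coef_box_poly z n N K : (n <= N)%N -> (n < K)%N -> (box_poly z N K)`_n = trace_poly z n.
Proof. by move=> nN nK; rewrite /trace_poly (pp_trace_gf N K). Qed.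

Lemma eit_neq1 x : 0 < x < 2 * pi -> eit x != 1.
Proof.
move=> /andP[x0 x2]; apply/eqP; rewrite eitE => -[c1 s0]; have p0 := pi_gt0 R.
have [xp|xp|xp] := ltgtP x pi.
- by have := @sin_gt0_pi R x; rewrite x0 xp s0 ltxx => /(_ isT).
- have := @sin_gt0_pi R (x - pi); rewrite sinB sinpi cospi s0 => h.
  by move: h; rewrite mul0r mulr0 subrr ltxx => h; suff : false by []; apply: h; apply/andP; split; lra.
- by move: c1; rewrite xp cospi; lra.
Qed.

Lemma conjc_unit u : nc u = 1 -> (u^*)%C = u^-1.
Proof.
move=> u1; have u0 : u != 0 by rewrite -nc_gt0 u1.
apply: (mulfI u0); rewrite divff//; apply: complexP => /=.
  by have := nc_sqr u; rewrite u1 expr1n; case: u {u1 u0} => a b /= ->; ring.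
by case: u {u1 u0} => a b /=; ring.
Qed.

Lemma trace_poly_conj z n : trace_poly (z^*)%C n = ((trace_poly z n)^*)%C.
Proof.
by rewrite /trace_poly rmorph_sum; apply: eq_bigr => p _; rewrite rmorphXn.
Qed.

Variable b : nat.
Hypothesis b0 : (0 < b)%N.
Local Notation zt := (zeta R b).

Lemma zetaX j : zt ^+ j = eit (j%:R * (2 * pi / b%:R)).
Proof. by rewrite -eitX. Qed.

Lemma zetaXb : zt ^+ b = 1.
Proof.
rewrite zetaX; have -> : b%:R * (2 * pi / b%:R) = 1%:R * (2 * pi) :> R.
  by rewrite mul1r mulrCA divff ?mulr1// pnatr_eq0 -lt0n.
exact: cexp_2pi_i.
Qed.

Lemma nc_zeta : nc zt = 1. Proof. exact: nc_eit. Qed.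

Lemma nc_zetaz (e : int) : nc (zt ^ e) = 1.
Proof.
case: e => k; first by rewrite -exprnP ncX nc_zeta expr1n.
by rewrite NegzE -exprnN ncV ncX nc_zeta expr1n invr1.
Qed.

Lemma zeta_neq0 : zt != 0. Proof. by rewrite -nc_gt0 nc_zeta. Qed.

Lemma zetaz_mod (e : int) : zt ^ e = zt ^ (e %% b)%Z.
Proof.
rewrite {1}(divz_eq e b) expfzDr ?zeta_neq0// [(_ * b%:Z)%R]mulrC -exprz_exp.
by rewrite -exprnP zetaXb exp1rz mul1r.
Qed.

(** After reduction of the exponent modulo b the angle lies in [0, 2 pi), where [eit] takes the
    value 1 only at 0. *)
Lemma zetaz_eq1 (e : int) : (zt ^ e == 1) = (b %| e)%Z.
Proof.
have bp : 0 < b%:R :> R by rewrite ltr0n.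
apply/eqP/idP => [|]; last first.
  by rewrite zetaz_mod => /dvdz_mod0P ->; rewrite expr0z.
rewrite zetaz_mod => E; apply/dvdz_mod0P.
have r0 : (0 <= e %% b)%Z by rewrite modz_ge0// eqz_nat -lt0n.
have rb : (e %% b < b)%Z by rewrite ltz_mod// eqz_nat -lt0n.
case: (e %% b)%Z r0 rb E => // r _; rewrite ltz_nat => rb.
case: r rb => // r rb; rewrite -exprnP zetaX => E.
have p0 := pi_gt0 R.
suff h : 0 < r.+1%:R * (2 * @pi R / b%:R) < 2 * @pi R by have := eit_neq1 h; rewrite E eqxx.
rewrite mulr_gt0 ?divr_gt0 ?mulr_gt0//= mulrCA -[ltRHS]mulr1 ltr_pM2l ?mulr_gt0//.
by rewrite ltr_pdivrMr// mul1r ltr_nat.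
Qed.

Lemma zetaz_sum (e : int) : \sum_(j < b) (zt ^ e) ^+ j = (b%:R *+ (b %| e)%Z : R[i]).
Proof.
rewrite -zetaz_eq1; case: eqP => [->|/eqP E].
  under eq_bigr do rewrite expr1n.
  by rewrite sumr_const card_ord mulr1n.
rewrite mulr0n; have E' : zt ^ e - 1 != 0 by rewrite subr_eq0.
apply: (mulfI E'); rewrite -subrX1 mulr0 exprnP exprz_exp mulrC -exprz_exp.
by rewrite -exprnP zetaXb exp1rz subrr.
Qed.

Lemma pp_zeta (a : int) n :
  b%:R * (pp a b n)%:R = \sum_(j < b) (zt ^ (- a)) ^+ j * trace_poly (zt ^+ j) n.
Proof.
transitivity (\sum_(p <- fset_set [set p | is_plane_partition n p])
    \sum_(j < b) (zt ^ ((pp_trace p)%:Z - a)) ^+ j); last first.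
  rewrite exchange_big /=; apply: eq_bigr => j _; rewrite /trace_poly mulr_sumr.
  apply: eq_bigr => p _; rewrite expfzDr ?zeta_neq0// exprMn mulrC; congr (_ * _).
  by rewrite -exprnP -!exprM mulnC.
under eq_bigr do rewrite zetaz_sum.
have finP := finite_plane_partition n.
have -> : pp a b n = (\sum_(p <- fset_set [set p | is_plane_partition n p])
   (b %| ((pp_trace p)%:Z - a)%R)%Z)%N.
  rewrite /pp card_fset_sum1; set S := fset_set _; set S' := fset_set [set p | _ n p].
  have -> : S = [fset p in S' | (b %| (pp_trace p)%:Z - a)%Z]%fset.
    apply/fsetP => p; rewrite !inE /= !in_fset_set//; last first.
      by apply: sub_finite_set finP => q [].
    apply/idP/andP.
      move=> /set_mem[h1 h2]; split; first exact: mem_set.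
      by rewrite -eqz_mod_dvd; apply/eqP.
    by move=> [/set_mem h1 h2]; apply: mem_set; split=> //; apply/eqP; rewrite eqz_mod_dvd.
  rewrite -big_fset_condE.
  by rewrite big_mkcond; apply: eq_bigr => p _; case: (_ %| _)%Z.
rewrite natr_sum mulr_sumr; apply: eq_bigr => p _.
by rewrite mulr_natr.
Qed.

End RootsOfUnity.

(** * The phase and the constants of the theorem *)

Section PhaseConstants.
Context {R : realType}.
Implicit Types (l a g x : R) (z w J : R[i]).

Lemma sqrc_Re_inj z w : z ^+ 2 = w ^+ 2 -> 0 <= Re z -> 0 < Re w -> z = w.
Proof.
move=> /eqP; rewrite eqf_sqr => /orP[/eqP//|/eqP->]; by rewrite ReN => h1 h2; exfalso; lra.
Qed.

Lemma sqr_cpow_half w : w != 0 -> cpow w (1 / 2) ^+ 2 = w.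
Proof.
move=> w0; rewrite /cpow (negbTE w0) -cexpM_nat -[RHS](clogK w0); congr cexp.
by rewrite -(real_natC 2); apply: complexP; rewrite !(ReZ, ImZ); field.
Qed.

Lemma Re_cpow_half_ge0 w : w != 0 -> 0 <= Re (cpow w (1 / 2)).
Proof.
move=> w0; rewrite /cpow (negbTE w0) cexpE /= mulr_ge0 ?expR_ge0//.
have /andP[h1 h2] := carg_itv w.
apply: cos_ge0_pihalf; apply/andP; split; lra.
Qed.

(** Both sides have the same square, because (1 + a^2)J^2 = pi(1 + i a), and neither has a negative
    real part. Thus the Gaussian integral becomes the principal square root of the theorem, with no
    ambiguity of sign. *)
Lemma cpow_half_saddle l a J : 0 < l -> (1 -i* a) * J ^+ 2 = pi%:C -> 0 < Re J ->
  cpow (l%:C * (1 +i* a)) (1 / 2) =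
  (Num.sqrt (3 * pi) * (Num.sqrt ((1 + a ^+ 2) / (3 * l ^+ 3)) * l ^+ 2 / pi))%:C * J.
Proof.
move=> l0 EJ J0; have p0 := pi_gt0 R.
have n0 : (1 -i* a) != 0 :> R[i] by rewrite eq_complex /= oner_eq0.
have n1 : (1 +i* a) != 0 :> R[i] by rewrite eq_complex /= oner_eq0.
have w0 : l%:C * (1 +i* a) != 0.
  by rewrite mulf_neq0// -nc_gt0 nc_real normr_gt0 gt_eqF.
have a0 : 0 < 1 + a ^+ 2 by rewrite ltr_wpDr ?sqr_ge0.
apply: sqrc_Re_inj; last 1 first.
- rewrite ReZ !mulr_gt0 ?invr_gt0 ?exprn_gt0 ?sqrtr_gt0 ?mulr_gt0//.
  by rewrite invr_gt0 mulr_gt0 ?exprn_gt0.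
- rewrite sqr_cpow_half//; apply: (mulfI n0).
  rewrite exprMn [RHS]mulrCA EJ -rmorphXn -rmorphM !exprMn !sqr_sqrtr; last 2 first.
  + by rewrite divr_ge0 ?mulr_ge0 ?exprn_ge0// ltW.
  + by rewrite mulr_ge0// ltW.
  by move: (@pi R) p0 {EJ} => q q0; apply: complexP => /=; field; rewrite ?gt_eqF.
- exact: Re_cpow_half_ge0.
Qed.

End PhaseConstants.

Section MinorRootsOfUnity.
Context {R : realType}.
Variables (b : nat) (l a : R) (t : nat -> R).
Hypotheses (b3 : (3 <= b)%N)
  (Lz : cpow (Li3 (zeta R b)) (1 / 3) = l%:C * (1 +i* a)).

Let p0 := pi_gt0 R.

Lemma zeta_angle_le : 0 < 2 * @pi R / b%:R <= 2 * pi / 3.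
Proof.
have h : 3 <= b%:R :> R by rewrite (ler_nat R 3).
by rewrite divr_gt0 ?mulr_gt0//= ?ler_pM2l ?mulr_gt0// ?lef_pV2 ?posrE//; lra.
Qed.

Lemma zeta_growth_gt : 1 / 4 < l ^+ 3.
Proof. by rewrite -(growth_rate_cube Lz); apply: growth_rate_gt zeta_angle_le. Qed.

Lemma minor_root_of_unity j : (2 <= j)%N -> (j.+1 < b)%N ->
  (forall n, 0 < t n) -> (forall n, n.+1%:R * t n ^+ 3 = 2 * l ^+ 3 :> R) ->
  t n @[n --> \oo] --> (0 : R) ->
  nc (trace_poly (zeta R b ^+ j) n.+1) * expR (- (3 * (l ^+ 3 / t n ^+ 2))) / t n ^+ 2
    @[n --> \oo] --> (0 : R).
Proof.
move=> j2 jb t0 tn tlim; have b0 : (0 < b)%N by lia.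
(* Conjugation exchanges [j] and [b - j], so the angle may be taken in (2 pi/b, pi], where
   [growth_rate_decr] applies. *)
wlog jb2 : j j2 jb / (2 * j <= b)%N => [H|].
  have [h|h] := leqP (2 * j) b; first exact: H.
  have E n : nc (trace_poly (zeta R b ^+ j) n.+1) = nc (trace_poly (zeta R b ^+ (b - j)) n.+1).
    have -> : zeta R b ^+ (b - j) = ((zeta R b ^+ j)^*)%C.
      rewrite conjc_unit; last by rewrite ncX nc_zeta expr1n.
      have z0 : zeta R b ^+ j != 0 by rewrite expf_neq0 ?zeta_neq0.
      apply: (mulIf z0); rewrite mulVf// -exprD subnK ?zetaXb//; lia.
    by rewrite trace_poly_conj; case: (trace_poly _ _) => u v /=; rewrite sqrrN.
  by under eq_fun do rewrite E; apply: H; lia.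
have bR : 0 < b%:R :> R by rewrite ltr0n.
have /andP[x1 x13] := zeta_angle_le; set x := 2 * pi / b%:R in x1 x13.
have jx : 2 * (j%:R * x) <= 2 * pi.
  have -> : 2 * (j%:R * x) = (2 * j)%:R / b%:R * (2 * pi).
    by rewrite natrM /x; field; rewrite gt_eqF.
  by rewrite ler_piMl ?mulr_ge0 ?(ltW p0)// ler_pdivrMr// mul1r ler_nat.
have xj : x < j%:R * x by rewrite -{1}(mul1r x) ltr_pM2r// ltr1n.
have jpi : 0 < j%:R * x <= pi by apply/andP; split; lra.
have [lj [aj [lj0 aj3 Ej Lj _]]] := Li3_eit_cube jpi.
rewrite zetaX -/x; apply: (minor_root_coef (z := eit (j%:R * x)) (l := lj) (a := aj)) => //.
- by rewrite nc_eit.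
- by apply: eit_neq1; have /andP[h1 h2] := jpi; apply/andP; split; lra.
- rewrite -(growth_rate_cube Lz) -(growth_rate_cube Ej).
  by apply: growth_rate_decr => //; case/andP: jpi.
- exact: zeta_growth_gt.
- by move=> n N K; exact: coef_box_poly.
Qed.

End MinorRootsOfUnity.

(** The term j = 0 cancels between the two classes, and the terms j = 1 and j = b - 1 are conjugate,
    hence the factor 2. *)
Lemma trace_class_difference (R : realType) (b n : nat) (a1 a2 : int) : (3 <= b)%N ->
  (pp a1 b n)%:R - (pp a2 b n)%:R = 2 / b%:R *
      Re ((zeta R b ^ (- a1) - zeta R b ^ (- a2)) * trace_poly (zeta R b) n) +
    1 / b%:R * \sum_(2 <= j < b.-1) Re
      (((zeta R b ^ (- a1)) ^+ j - (zeta R b ^ (- a2)) ^+ j) * trace_poly (zeta R b ^+ j) n) :> R.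
Proof.
move=> b3.
have recr (F : nat -> R[i]) : \sum_(2 <= j < b) F j = \sum_(2 <= j < b.-1) F j + F b.-1.
  by case: b b3 => // m m2; rewrite big_nat_recr.
have b0 : (0 < b)%N by lia.
pose T j := ((zeta R b ^ (- a1)) ^+ j - (zeta R b ^ (- a2)) ^+ j) * trace_poly (zeta R b ^+ j) n.
have bR : b%:R != 0 :> R by rewrite pnatr_eq0 -lt0n.
have E : b%:R * ((pp a1 b n)%:R - (pp a2 b n)%:R) = Re (\sum_(0 <= j < b) T j).
  transitivity (Re (b%:R * ((pp a1 b n)%:R - (pp a2 b n)%:R) : R[i])).
    by rewrite -!real_natC -rmorphB -rmorphM.
  rewrite mulrBr !pp_zeta// -sumrB big_mkord; congr Re.
  by apply: eq_bigr => j _; rewrite /T mulrBl.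
have conjE (a : int) j : (j <= b)%N ->
    (zeta R b ^ (- a)) ^+ (b - j) = (((zeta R b ^ (- a)) ^+ j)^*)%C.
  move=> jb; have nu := @nc_zetaz R b (- a).
  have ub : (zeta R b ^ (- a)) ^+ b = 1.
    by rewrite exprnP exprz_exp mulrC -exprz_exp -exprnP zetaXb// exp1rz.
  have u0 : (zeta R b ^ (- a)) ^+ j != 0 by rewrite expf_neq0// -nc_gt0 nu.
  rewrite conjc_unit; last by rewrite ncX nu expr1n.
  by apply: (mulIf u0); rewrite mulVf// -exprD subnK.
have zconj j : (j <= b)%N -> zeta R b ^+ (b - j) = ((zeta R b ^+ j)^*)%C.
  by move=> jb; have := conjE (-1) j jb; rewrite opprK expr1z.
have T1 : Re (T b.-1) = Re (T 1%N).
  rewrite /T -subn1 !conjE ?zconj; try lia.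
  rewrite trace_poly_conj -rmorphB -rmorphM.
  by move: (_ * _) => w; case: w.
have T0 : T 0%N = 0 by rewrite /T subrr mul0r.
have -> : 2 / b%:R * Re ((zeta R b ^ (- a1) - zeta R b ^ (- a2)) * trace_poly (zeta R b) n) =
    (Re (T 1%N) + Re (T b.-1)) / b%:R.
  by rewrite T1 /T !expr1; move: (Re _) => r; field.
apply: (mulfI bR); rewrite E big_ltn// T0 add0r big_ltn; last lia.
rewrite recr !ReD -Re_sum; move: (Re (T 1%N)) => r.
by field.
Qed.

Section Scales.
Context {R : realType}.
Variable l : R.
Hypothesis l0 : 0 < l.

(** The solution of n t^3 = 2 l^3 with n + 1 in place of n, so that the index is never 0. *)
Definition saddle_radius n : R := 2 `^ (1 / 3) * l * n.+1%:R `^ (- (1 / 3)).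
Local Notation t := saddle_radius.

Lemma powR_root3 (x : R) : 0 < x -> (x `^ (1 / 3)) ^+ 3 = x.
Proof.
by move=> x0; rewrite -powR_mulrn ?powR_ge0// -powRrM divfK// powRr1// ltW.
Qed.

Lemma powR_root3_sqr (x : R) : 0 < x -> (x `^ (1 / 3)) ^+ 2 = x `^ (2 / 3).
Proof.
by move=> x0; rewrite -powR_mulrn ?powR_ge0// -powRrM mulrAC mul1r.
Qed.

Lemma saddle_radius_gt0 n : 0 < t n.
Proof. by rewrite !mulr_gt0// powR_gt0. Qed.

Lemma saddle_radius_cube n : n.+1%:R * t n ^+ 3 = 2 * l ^+ 3.
Proof.
have n0 : 0 < n.+1%:R :> R by [].
rewrite /t powRN !exprMn exprVn !powR_root3//; move: (n.+1%:R : R) n0 => x x0.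
by field; rewrite gt_eqF.
Qed.

Lemma saddle_radius_sqr n : t n ^+ 2 = 2 `^ (2 / 3) * l ^+ 2 / n.+1%:R `^ (2 / 3).
Proof. by rewrite /t powRN !exprMn exprVn !powR_root3_sqr. Qed.

Lemma saddle_radius_cvg0 : t n @[n --> \oo] --> (0 : R).
Proof.
apply/cvgrPdist_lt => e e0; have e3 : 0 < e ^+ 3 / (2 * l ^+ 3).
  by rewrite divr_gt0 ?mulr_gt0 ?exprn_gt0.
near=> n; rewrite sub0r normrN gtr0_norm ?saddle_radius_gt0//.
rewrite -(@ltr_pXn2r _ 3)// ?nnegrE ?(ltW e0) ?(ltW (saddle_radius_gt0 n))//.
have -> : t n ^+ 3 = n.+1%:R^-1 * (2 * l ^+ 3).
  by rewrite -(saddle_radius_cube n) mulrA mulVf ?mul1r.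
rewrite -ltr_pdivlMr ?mulr_gt0 ?exprn_gt0//.
by near: n; move/cvgr_lt : (@cvg_harmonic R) => /(_ _ e3).
Unshelve. all: by end_near. Qed.

End Scales.

Lemma cvg_sum0 (R : realType) (r : seq nat) (P : pred nat) (u : nat -> nat -> R) :
  (forall j, P j -> u j n @[n --> \oo] --> (0 : R)) ->
  \sum_(j <- r | P j) u j n @[n --> \oo] --> (0 : R).
Proof.
move=> u0; elim: r => [|j r IHr].
  by under eq_fun do rewrite big_nil; exact: cvg_cst.
under eq_fun do rewrite big_cons; have [Pj|_//] := boolP (P j).
have := cvgD (u0 j Pj) IHr; rewrite addr0; exact.
Qed.

Theorem corollary1p2 (R : realType) (b : nat) (a1 a2 : int)
    (l1 l2 B alpha : R) :
  (3 <= b)%N ->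
  (a1 != a2 %[mod b%:Z])%Z ->
  l1 +i* l2 = cpow (Li3 (zeta R b)) (1 / 3) ->
  0 < B ->
  0 <= alpha < 2 * pi ->
  B%:C * cexp (alpha*i) =
    (2 `^ (2 / 3) / (b%:R * Num.sqrt (3 * pi)))%:C
    * (zeta R b ^ (- a1) - zeta R b ^ (- a2))
    * cpow (1 - zeta R b) (1 / 12) * cpow (l1 +i* l2) (1 / 2) ->
  (fun n : nat =>
     ((pp a1 b n)%:R - (pp a2 b n)%:R)
       / (B * n%:R `^ (- (2 / 3))
          * expR (3 / 2 `^ (2 / 3) * l1 * n%:R `^ (2 / 3)))
     - cos (alpha + 3 / 2 `^ (2 / 3) * l2 * n%:R `^ (2 / 3)))
  @ \oo --> (0 : R).
Proof.
move=> b3 _ El B0 _ EB; have p0 := pi_gt0 R.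
have bR : 0 < b%:R :> R by rewrite ltr0n; lia.
have /andP[x1 x13] := @zeta_angle_le R b b3.
have [|l [a [l0 _ Ec EL a3]]] := @Li3_eit_cube R (2 * pi / b%:R).
  by apply/andP; split; lra.
have {}a3 : a ^+ 2 < 3 by apply: a3; lra.
rewrite -/(zeta R b) in Ec EL.
have [E1 E2] : l1 = l /\ l2 = l * a.
  by move: El; rewrite Ec => -[-> ->]; split; ring.
rewrite El Ec in EB; rewrite {}E1 {}E2 {El}.
have m4 := zeta_growth_gt b3 Ec.
pose z := zeta R b; pose t := saddle_radius l.
have t0 := saddle_radius_gt0 l0; have tn := @saddle_radius_cube R l.
have tlim := saddle_radius_cvg0 l0.
have zn1 : z != 1 by apply: eit_neq1; apply/andP; split; lra.
have nz : nc z <= 1 by rewrite nc_zeta.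
have HE n N K : (n <= N)%N -> (n < K)%N -> (box_poly z N K)`_n = trace_poly z n.
  exact: coef_box_poly.
have S := saddle_point nz zn1 l0 a3 EL m4 HE t0 tn tlim.
pose g : R := Num.sqrt ((1 + a ^+ 2) / (3 * l ^+ 3)).
pose P : R := 2 `^ (2 / 3).
have P0 : 0 < P by rewrite powR_gt0.
pose c : R[i] := 1 +i* a.
pose W : R[i] := cexp ((1 / 12)%:C * clog (1 - z)).
pose U n : R[i] := (2 * pi / (g * t n ^+ 2))%:C * trace_poly z n.+1 *
  cexp (- ((3 * (l ^+ 3 / t n ^+ 2))%:C * c)).
have {}S : cvgC U (W * cint (cgauss a)) by [].
pose zd : R[i] := z ^ (- a1) - z ^ (- a2).
(* This factor turns the limit of [U], multiplied by [zd], into B e^{i alpha}, and the window factor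
   2 pi/(g t^2) into 2 nu/b. *)
pose k : R := P / b%:R * (g * l ^+ 2 / pi).
have RM (p q : R) : (p * q)%:C = p%:C * q%:C :> R[i] by exact: rmorphM.
have g0 : 0 < g by rewrite sqrtr_gt0 divr_gt0 ?mulr_gt0 ?exprn_gt0// ltr_wpDr ?sqr_ge0.
have VB : cvgC (fun n => k%:C * zd * U n) (B%:C * eit alpha).
  rewrite /eit EB (cpow_half_saddle l0 (cint_cgauss_sqr a) (Re_cint_cgauss_gt0 a)) -/g.
  have -> : cpow (1 - zeta R b) (1 / 12) = W.
    by rewrite /cpow subr_eq0 eq_sym (negbTE zn1).
  rewrite -/z -/zd.
  have -> : (2 `^ (2 / 3) / (b%:R * Num.sqrt (3 * pi)))%:C * zd * W *
      ((Num.sqrt (3 * pi) * (g * l ^+ 2 / pi))%:C * cint (cgauss a)) =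
      k%:C * zd * (W * cint (cgauss a)).
    have s0 : Num.sqrt (3 * pi) != 0 :> R by rewrite gt_eqF// sqrtr_gt0 mulr_gt0.
    have -> : k = 2 `^ (2 / 3) / (b%:R * Num.sqrt (3 * pi)) * (Num.sqrt (3 * pi) * (g * l ^+ 2 / pi)).
      rewrite /k /P; move: (2 `^ _) (g * l ^+ 2 / pi) (Num.sqrt _) s0 => p q s s0.
      by field; rewrite s0 gt_eqF.
    by rewrite [in RHS]RM; ring.
  by apply: cvgCM => //; exact: cvgC_cst.
clear EB S.
pose nu n : R := n.+1%:R `^ (2 / 3).
pose N n : R := l ^+ 3 / t n ^+ 2.
have nu0 n : 0 < nu n by rewrite powR_gt0.
have tnu n : t n ^+ 2 = P * l ^+ 2 / nu n by exact: saddle_radius_sqr.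
have N3 n : 3 / P * l * nu n = 3 * N n.
  by rewrite /N tnu; field; rewrite !gt_eqF.
have kE n : k * (2 * pi / (g * t n ^+ 2)) = 2 / b%:R * nu n.
  by rewrite tnu /k; move: (pi) p0 => q q0; field; rewrite !gt_eqF.
(* The critical exponent is 3N(1 + i a); multiplication by e^{3iNa} undoes its oscillation and
   leaves a positive multiple of the term of [z] in [trace_class_difference]. *)
have VE n : k%:C * zd * U n * eit (3 * N n * a) =
    (2 / b%:R * nu n * expR (- (3 * N n)))%:C * (zd * trace_poly z n.+1).
  have -> : eit (3 * N n * a) = cexp ((3 * N n)%:C * c) * (expR (- (3 * N n)))%:C.
    have -> : (3 * N n)%:C * c = (3 * N n) +i* (3 * N n * a).
      by apply: complexP; rewrite ?ReZ ?ImZ /= ?mulr1.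
    rewrite cexp_polar [RHS]mulrAC -RM -expRD subrr expR0 mul1r.
    by [].
  have -> : (2 / b%:R * nu n * expR (- (3 * N n)))%:C =
      k%:C * (2 * pi / (g * t n ^+ 2))%:C * (expR (- (3 * N n)))%:C :> R[i].
    by rewrite -kE !RM.
  rewrite /U -/(N n).
  have : cexp (- ((3 * N n)%:C * c)) * cexp ((3 * N n)%:C * c) = 1.
    by rewrite -cexpD addNr cexp0.
  set e1 := cexp (- _); set e2 := cexp ((3 * N n)%:C * c) => e12.
  transitivity (k%:C * (2 * pi / (g * t n ^+ 2))%:C * (expR (- (3 * N n)))%:C *
     (zd * trace_poly z n.+1) * (e1 * e2)); [by ring|by rewrite e12 mulr1].
pose Rj j n : R := nc (trace_poly (z ^+ j) n.+1) * expR (- (3 * N n)) / t n ^+ 2.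
(* The first summand is the saddle point error of the two conjugate dominant roots, the second
   bounds all the others through [minor_root_of_unity]. *)
pose F n : R := nc (k%:C * zd * U n - B%:C * eit alpha) / B +
  2 * P * l ^+ 2 / (b%:R * B) * \sum_(2 <= j < b.-1) Rj j n.
have FL : F n @[n --> \oo] --> (0 : R).
  have L1 := cvgC_nc (cvgCB VB (cvgC_cst (B%:C * eit alpha))).
  rewrite subrr nc0 in L1.
  have L2 : \sum_(2 <= j < b.-1) Rj j n @[n --> \oo] --> (0 : R).
    under eq_fun do rewrite big_nat_cond.
    apply: cvg_sum0 => j /andP[/andP[j2 jb] _].
    rewrite ltn_predRL in jb; exact: (minor_root_of_unity b3 Ec j2 jb t0 tn tlim).
  pose C : R := 2 * P * l ^+ 2 / (b%:R * B).
  have L3 : nc (k%:C * zd * U n - B%:C * eit alpha) / B @[n --> \oo] --> 0 * B^-1.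
    by apply: cvgM => //; exact: cvg_cst.
  have L4 : C * (\sum_(2 <= j < b.-1) Rj j n) @[n --> \oo] --> C * 0.
    by apply: cvgM => //; exact: cvg_cst.
  by have := cvgD L3 L4; rewrite mul0r mulr0 addr0; exact.
have main n : `|((pp a1 b n.+1)%:R - (pp a2 b n.+1)%:R)
       / (B * n.+1%:R `^ (- (2 / 3))
          * expR (3 / 2 `^ (2 / 3) * l * n.+1%:R `^ (2 / 3)))
     - cos (alpha + 3 / 2 `^ (2 / 3) * (l * a) * n.+1%:R `^ (2 / 3))| <= F n.
  rewrite -/P -/(nu n) powRN -/(nu n) N3.
  have -> : 3 / P * (l * a) * nu n = 3 * N n * a by rewrite -N3; ring.
  rewrite trace_class_difference// -/z -/zd.
  set Z := Re (zd * _); set Q := \sum_(2 <= j < b.-1) _.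
  have cE : cos (alpha + 3 * N n * a) = Re (B%:C * eit alpha * eit (3 * N n * a)) / B.
    rewrite -[B%:C * _ * _]mulrA -eitD ReZ [B * _]mulrC mulfK ?gt_eqF//.
    by rewrite eitE.
  have ZE : 2 / b%:R * Z * nu n * expR (- (3 * N n)) =
      Re (k%:C * zd * U n * eit (3 * N n * a)).
    by rewrite VE ReZ /Z; ring.
  have e0 : expR (3 * N n) != 0 by rewrite gt_eqF ?expR_gt0.
  have -> : (2 / b%:R * Z + 1 / b%:R * Q) / (B / nu n * expR (3 * N n)) =
      2 / b%:R * Z * nu n * expR (- (3 * N n)) / B + 1 / b%:R * Q * nu n * expR (- (3 * N n)) / B.
    rewrite expRN; move: (expR _) e0 (nu0 n) => e e0 nun.
    by field; rewrite e0 !gt_eqF.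
  rewrite ZE cE addrAC -mulrBl -ReB -mulrBl.
  apply: le_trans (ler_normD _ _) _; apply: lerD.
    rewrite normrM (gtr0_norm (_ : 0 < B^-1)) ?invr_gt0// ler_pM2r ?invr_gt0//.
    by apply: le_trans (normr_Re _) _; rewrite ncM nc_eit mulr1.
  have Qle : `|Q| <= 2 * \sum_(2 <= j < b.-1) nc (trace_poly (z ^+ j) n.+1).
    rewrite mulr_sumr; apply: le_trans (ler_norm_sum _ _ _) _; apply: ler_sum => j _.
    apply: le_trans (normr_Re _) _; rewrite ncM ler_wpM2r ?nc_ge0//.
    by apply: le_trans (ncB _ _) _; rewrite !ncX !nc_zetaz !expr1n.
  have -> : 2 * P * l ^+ 2 / (b%:R * B) * \sum_(2 <= j < b.-1) Rj j n =
     1 / b%:R * (2 * \sum_(2 <= j < b.-1) nc (trace_poly (z ^+ j) n.+1)) * nu n * expR (- (3 * N n)) / B.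
    rewrite /Rj -!mulr_suml.
    have -> : (t n ^+ 2)^-1 = nu n / (P * l ^+ 2) by rewrite tnu invf_div.
    move: (\sum_(_ <= _ < _) _) (expR _) (nu0 n) => s e nun.
    by field; rewrite !gt_eqF.
  have X0 : 0 < 1 / b%:R * nu n * expR (- (3 * N n)) / B.
    by rewrite !mulr_gt0 ?invr_gt0 ?expR_gt0.
  have -> (q : R) : 1 / b%:R * q * nu n * expR (- (3 * N n)) / B =
     1 / b%:R * nu n * expR (- (3 * N n)) / B * q by ring.
  have -> (q : R) : 1 / b%:R * q * nu n * expR (- (3 * N n)) / B =
     1 / b%:R * nu n * expR (- (3 * N n)) / B * q by ring.
  by rewrite normrM (gtr0_norm X0) ler_pM2l.
rewrite -cvg_shiftS; apply/cvgr0Pnorm_lt => e e0.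
near=> n; apply: le_lt_trans (main n) _.
by near: n; move/cvgr_lt : FL => /(_ _ e0).
Unshelve. all: by end_near. Qed.
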